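(* Let $m_C$ be the Cantor distribution and let $C_n$, $n\in\mathbb N_0$, be the sets defined in the context. Let $m$ be the measure on $\mathbb R$ given by $m(dx)=m_C(dx)+2\,dx$ and let $Y$ be the associated diffusion, i.e. the general diffusion in natural scale with state space $\mathbb R$ and speed measure $m$. Let $n\colon(0,1)\to\mathbb N$ be a function satisfying $\lim_{h\to0}2^{n(h)}\sqrt h=\infty$. Then for all $h\in(0,1)$, $y\in\mathbb R$ there exists a unique solution $a_h(y)\in(0,\sqrt h]$ of the equation $$\frac12\left(\frac32\right)^{n(h)}\int_{y-a_h(y)}^{y+a_h(y)}1_{C_{n(h)}}(u)\,\bigl(a_h(y)-|u-y|\bigr)\,du+a_h(y)^2=h.$$ Let $(X^{h,y}_t)_{t\in[0,\infty)}$, $h\in(0,1)$, be the linearly interpolated Markov chains started in $y$ with these scale factors $a_h$ (see context). Then for all $y\in\mathbb R$ the distributions of $(X^{h,y}_t)_{t\in[0,\infty)}$, $h\in(0,1)$, under $P$ converge weakly to the distribution of $(Y_t)_{t\in[0,\infty)}$ under $P_y$, as $h\to0$.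
   Context: Cantor sets and distribution: for $A\subseteq[0,1]$ let $\Psi(A)=\frac A3\cup\frac{A+2}3$; $C_0=[0,1]$ and $C_n=\Psi(C_{n-1})$ for $n\in\mathbb N$. Let $m_n(dx)=\left(\frac32\right)^n1_{C_n}(x)\,dx$, a probability measure on $\mathbb R$; $m_C$ is the weak limit of $(m_n)_{n\in\mathbb N}$ (the Cantor distribution, concentrated on $C=\bigcap_{n}C_n$). Diffusion: $Y$ is the continuous regular strong Markov process $((Y_t)_{t\ge0},(P_y)_{y\in\mathbb R})$ with state space $\mathbb R$, $P_y[Y_0=y]=1$, in natural scale ($P_y[H_b<H_a]=\frac{y-a}{b-a}$ for $a<y<b$, where $H_x=\inf\{t\ge0:Y_t=x\}$), and speed measure $m$ with the normalization $E_y[H_a\wedge H_b]=\int_{(a,b)}\frac{(b-y\vee u)(y\wedge u-a)}{b-a}\,m(du)$ for $a<b$, $y\in[a,b]$ (so Brownian motion has speed measure $2\,dx$). Markov chains: let $(\xi_k)_{k\in\mathbb N}$ be iid under $P$ with $P(\xi_k=\pm1)=\frac12$; $X^{h,y}_0=y$, $X^{h,y}_{(k+1)h}=X^{h,y}_{kh}+a_h(X^{h,y}_{kh})\xi_{k+1}$ for $k\in\mathbb N_0$, extended by linear interpolation: $X^{h,y}_t=X^{h,y}_{\lfloor t/h\rfloor h}+(t/h-\lfloor t/h\rfloor)\bigl(X^{h,y}_{(\lfloor t/h\rfloor+1)h}-X^{h,y}_{\lfloor t/h\rfloor h}\bigr)$. Weak convergence is in $C([0,\infty),\mathbb R)$ with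 the topology of uniform convergence on compact intervals. *)

(* Defs.v *)
From HB Require Import structures.
From mathcomp Require Import all_boot all_order all_algebra finmap.
From mathcomp Require Import all_classical all_reals all_analysis.
From mathcomp Require Import measurable_realfun.

Set Implicit Arguments.
Unset Strict Implicit.
Unset Printing Implicit Defensive.

Import Order.TTheory GRing.Theory Num.Theory.
Import numFieldNormedType.Exports.

Local Open Scope classical_set_scope.
Local Open Scope ring_scope.

Section linear_interpolation.
Context {R : realType}.
Implicit Types (x : nat -> R) (s : R).

(* the piecewise linear function with value [x k] at [k]; it is affine on
   s < 1, since [Num.truncn s = 0] for s < 0 *)
Definition linear_interp x s : R :=
  x (Num.truncn s) +
  (s - (Num.truncn s)%:R) * (x (Num.truncn s).+1 - x (Num.truncn s)).

(* [ramp 0] is not truncated at 0, as s < 0 is allowed *)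
Let ramp k s : R :=
  if k is 0%N then Num.min 1 s else Num.max 0 (Num.min 1 (s - k%:R)).

Let linear_interpE x s N : (Num.truncn s < N)%N ->
  linear_interp x s = x 0%N + \sum_(k < N) ramp k s * (x k.+1 - x k).
Proof.
rewrite /linear_interp; have := truncnS_gt s.
have : 0 <= s -> (Num.truncn s)%:R <= s by rewrite truncn_le.
have : (0 < Num.truncn s)%N -> 0 <= s by rewrite truncn_gt0; apply: le_trans.
move: (Num.truncn s) => j s0 js sj jN.
rewrite -(big_mkord xpredT (fun k => ramp k s * (x k.+1 - x k))).
rewrite (@big_cat_nat _ _ _ j.+1)//= big_nat_recr//=.
rewrite [X in _ = _ + (_ + X)]big_nat_cond [X in _ = _ + (_ + X)]big1.
  rewrite addr0 addrA; congr (_ + _).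
    rewrite (_ : \sum_(0 <= i < j) _ = \sum_(0 <= i < j) (x i.+1 - x i)).
      by rewrite telescope_sumr// addrC subrK.
    apply: eq_big_nat => i /andP[_ ij].
    suff -> : ramp i s = 1 by rewrite mul1r.
    have : 1 <= s - i%:R.
      have j0 : (0 < j)%N by exact: leq_ltn_trans ij.
      rewrite lerBrDr (le_trans _ (js (s0 j0)))// addrC natr1 ler_nat//.
    by case: i ij => [|i] ij; rewrite /ramp ?subr0 => /min_l -> //; rewrite max_r.
  congr (_ * _); rewrite /ramp.
  have : s - j%:R <= 1 by rewrite lerBlDr addrC natr1 ltW.
  case: j s0 js sj jN => [|j] s0 js sj jN; first by rewrite subr0 => /min_r ->.
  by move=> /min_r ->; rewrite max_r// subr_ge0 js// s0.
move=> i /andP[/andP[ji _] _].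
suff -> : ramp i s = 0 by rewrite mul0r.
case: i ji => // i ji; rewrite /ramp max_l// ge_min; apply/orP; right.
by rewrite subr_le0 (le_trans (ltW sj))// ler_nat.
Qed.

Let continuous_ramp k : continuous (ramp k).
Proof.
move=> s; rewrite /ramp; case: k => [|k].
  by apply: continuous_min; [exact: cvg_cst|exact: cvg_id].
apply: (@continuous_max _ _ (cst 0) (fun s => Num.min 1 (s - k.+1%:R))).
  exact: cvg_cst.
apply: continuous_min; first exact: cvg_cst.
by apply: cvgB; [exact: cvg_id|exact: cvg_cst].
Qed.

Lemma continuous_linear_interp x : continuous (linear_interp x).
Proof.
move=> s; pose N := (Num.truncn s).+1.
pose g u : R := x 0%N + \sum_(k < N) ramp k u * (x k.+1 - x k).
have gE : \near s, g s = linear_interp x s.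
  near=> u; rewrite /g -linear_interpE// ltnS truncn_le_nat.
  by near: u; apply: lt_nbhsl; exact: truncnS_gt.
rewrite /continuous_at -(nbhs_singleton gE).
apply: cvg_trans (near_eq_cvg gE) _.
apply: cvgD; first exact: cvg_cst.
apply: cvg_big => [|k _]; first exact: add_continuous.
by apply: cvgM; [exact: continuous_ramp|exact: cvg_cst].
Unshelve. all: by end_near. Qed.
End linear_interpolation.

(* [0, oo), with the subspace topology *)
Notation time R := (set_type (`[0%R, +oo[%classic : set (Real.sort R))).

Section path_space.
Context {R : realType}.

Definition seconds (t : time R) : R := \val t.

(* Negative reals are sent to time 0. *)
Lemma at_time_subproof (t : R) : Num.max 0 t \in (`[0%R, +oo[%classic : set R).
Proof. by rewrite inE /= in_itv/= andbT le_max lexx. Qed.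

Definition at_time (t : R) : time R :=
  exist (fun u => u \in _) _ (at_time_subproof t).

Lemma seconds_ge0 (t : time R) : 0 <= seconds t.
Proof. by have := valP t; rewrite inE /= in_itv /= andbT. Qed.

Lemma at_timeK (t : R) : 0 <= t -> seconds (at_time t) = t.
Proof. by move=> t0; rewrite /seconds/= max_r. Qed.

Lemma secondsK : cancel seconds at_time.
Proof. by move=> t; apply: val_inj; exact/at_timeK/seconds_ge0. Qed.

Lemma continuous_seconds : continuous seconds.
Proof. exact: initial_continuous. Qed.

Lemma continuous_at_time : continuous at_time.
Proof.
apply: continuous_comp_initial => t.
by apply: continuous_max; [exact: cvg_cst|exact: cvg_id].
Qed.

(* C([0, oo), R) *)
Definition cpath : Type := continuousType (time R) R.

HB.instance Definition _ := Choice.on cpath.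

(* uniform convergence on compact sets of times *)
HB.instance Definition _ := Topological.copy cpath
  (initial_topology (fun w : cpath => (w : {family compact, time R -> R}))).

HB.instance Definition _ := isPointed.Build cpath (cst 0 : continuousType _ _).

Definition borel_cpath := g_sigma_algebraType (@open cpath).

Definition path_at (w : cpath) (t : time R) : R := w t.

Definition shift_fun (s : time R) (w : cpath) (t : time R) : R :=
  path_at w (at_time (seconds s + seconds t)).

Lemma continuous_shift_fun s w : continuous (shift_fun s w).
Proof.
have cw : continuous (path_at w).
  exact: (@cts_fun _ _ (w : continuousType _ _)).
have c : continuous (fun t => at_time (seconds s + seconds t)).
  have c : continuous (fun t => seconds s + seconds t).
    move=> t; apply: (@continuousD R R^o _ (cst (seconds s)) seconds).
      exact: cst_continuous.
    exact: continuous_seconds.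
  by move=> t; exact: (continuous_comp (c t) (@continuous_at_time _)).
by move=> t; exact: (continuous_comp (c t) (cw _)).
Qed.

Definition shift_path (s : time R) (w : cpath) : cpath :=
  mkcts (@continuous_shift_fun s w).

Definition interp_fun (h : R) (x : nat -> R) (t : time R) : R :=
  linear_interp x (seconds t / h).

Lemma continuous_interp_fun h x : continuous (interp_fun h x).
Proof.
have c : continuous (fun t : time R => seconds t / h).
  move=> t; apply: continuousM; first exact: continuous_seconds.
  exact: cst_continuous.
by move=> t; exact: (continuous_comp (c t) (@continuous_linear_interp _ x _)).
Qed.

(* the path that is equal to [x k] at time [k * h], for h > 0 *)
Definition interp (h : R) (x : nat -> R) : cpath :=
  mkcts (@continuous_interp_fun h x).

End path_space.
Arguments cpath : clear implicits.
Arguments borel_cpath : clear implicits.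

Definition bounded_continuous {R : realType} {T : topologicalType} :
    set (T -> R) :=
  [set f | continuous f /\ exists M, forall x, `|f x| <= M].

Section cantor.
Context {R : realType}.

Definition cantor_step (A : set R) : set R :=
  [set x / 3 | x in A] `|` [set (x + 2) / 3 | x in A].

Definition cantor_approx (n : nat) : set R :=
  iter n cantor_step `[0, 1]%classic.

Lemma measurable_cantor_approx n : measurable (cantor_approx n).
Proof.
elim: n => [|n IH] /=; first exact: measurable_itv.
have aff (b : R) : measurable [set (x + b) / 3 | x in cantor_approx n].
  rewrite (_ : [set _ | _ in _] = (fun x => x * 3 - b) @^-1` cantor_approx n).
    rewrite -[X in measurable X]setTI; apply: continuous_measurable_fun => // x.
    by apply: cvgB; [apply: cvgM; [exact: cvg_id|exact: cvg_cst]|exact: cvg_cst].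
  apply/seteqP; split => [_ [x xC <-]|x xC]/=.
    by rewrite divfK// addrK.
  by exists (x * 3 - b) => //; rewrite subrK mulfK.
apply: measurableU; last exact: aff.
by have := aff 0; under eq_imagel do rewrite addr0.
Qed.

(* (3/2)^n 1_{C_n}(x) dx *)
Definition cantor_approx_measure (n : nat) :=
  mscale ((3 / 2) ^+ n)%:nng
    (mrestr (@lebesgue_measure R) (measurable_cantor_approx n)).

Definition is_cantor_distribution (mC : probability (measurableTypeR R) R) :
    Prop :=
  forall f : R -> R, bounded_continuous f ->
    (\int[cantor_approx_measure n]_x (f x)%:E)%E @[n --> \oo] -->
    (\int[mC]_x (f x)%:E)%E.

(* m(dx) = m_C(dx) + 2 dx *)
Definition cantor_speed (mC : probability (measurableTypeR R) R) :
    {measure set (measurableTypeR R) -> \bar R} :=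
  measure_add mC (mscale 2%:nng (@lebesgue_measure R)).

(* the equation for a = a_h(y), where n = n(h) *)
Definition scale_factor_eq (n : nat) (h y a : R) : Prop :=
  2^-1 * (3 / 2) ^+ n *
    (\int[lebesgue_measure]_(u in `[y - a, y + a])
        (\1_(cantor_approx n) u * (a - `|u - y|))) + a ^+ 2 = h.

End cantor.

Section diffusion.
Context {R : realType}.
Local Open Scope ereal_scope.

Definition hitting_time (x : R) (w : cpath R) : \bar R :=
  ereal_inf [set (seconds t)%:E | t in [set t | path_at w t = x]].

Context d (Omega : measurableType d).
Implicit Types (F : time R -> set (set Omega)) (Y : Omega -> cpath R)
  (P : R -> probability Omega R).

Definition is_filtration F : Prop :=
  [/\ forall t, sigma_algebra setT (F t),
      forall t, F t `<=` measurable &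
      forall s t, (seconds s <= seconds t)%R -> F s `<=` F t].

Definition adapted F Y : Prop :=
  forall t (B : set R), measurable B -> F t [set w | B (path_at (Y w) t)].

Definition is_stopping_time F (tau : Omega -> \bar R) : Prop :=
  (forall w, 0 <= tau w) /\
  (forall t, F t [set w | tau w <= (seconds t)%:E]).

Definition stopped_sigma_algebra F (tau : Omega -> \bar R) : set (set Omega) :=
  [set A | measurable A /\
    forall t, F t (A `&` [set w | tau w <= (seconds t)%:E])].

(* only meaningful when [tau w < +oo] *)
Definition stopped_at (tau : Omega -> \bar R) (w : Omega) : time R :=
  at_time (fine (tau w)).

Definition strong_markov F P Y : Prop :=
  forall tau, is_stopping_time F tau ->
  forall A, stopped_sigma_algebra F tau A ->
  forall (y : R) (B : set (borel_cpath R)), measurable B ->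
    P y (A `&` [set w | tau w < +oo] `&`
         [set w | B (shift_path (stopped_at tau w) (Y w))]) =
    \int[P y]_(w in A `&` [set w | tau w < +oo])
      P (path_at (Y w) (stopped_at tau w)) (Y @^-1` B).

(* The filtration is arbitrary: the natural filtration of Y, its right-continuous
   version, or a larger one. *)
Record regular_diffusion F P Y : Prop := RegularDiffusion {
  diffusion_filtration : is_filtration F ;
  diffusion_adapted : adapted F Y ;
  diffusion_kernel : forall B : set (borel_cpath R), measurable B ->
    measurable_fun [set: R] (fun y => P y (Y @^-1` B)) ;
  diffusion_start : forall y, P y [set w | path_at (Y w) (at_time 0) = y] = 1 ;
  diffusion_strong_markov : strong_markov F P Y ;
  diffusion_regular : forall y x : R,
    0 < P y [set w | hitting_time x (Y w) < +oo] }.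

Definition natural_scale P Y : Prop :=
  forall a y b : R, (a < y < b)%R ->
    P y [set w | hitting_time b (Y w) < hitting_time a (Y w)] =
    ((y - a) / (b - a))%:E.

Definition has_speed_measure P Y
    (m : {measure set (measurableTypeR R) -> \bar R}) : Prop :=
  forall a b y : R, (a < b)%R -> (a <= y <= b)%R ->
    \int[P y]_w mine (hitting_time a (Y w)) (hitting_time b (Y w)) =
    \int[m]_(u in `]a, b[)
      ((b - Num.max y u) * (Num.min y u - a) / (b - a))%:E.

End diffusion.

Section coin_tossing.
Context {R : realType} d (Omega : measurableType d) (P : probability Omega R).
Implicit Types xi : nat -> Omega -> R.

Record iid_coin_tosses xi : Prop := IIDCoinTosses {
  coin_measurable : forall k, measurable_fun setT (xi k) ;
  coin_up : forall k, P (xi k @^-1` [set 1]) = (2^-1)%:E ;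
  coin_down : forall k, P (xi k @^-1` [set -1]) = (2^-1)%:E ;
  coin_independent : forall (J : {fset nat}) (B : nat -> set R),
    (forall k, measurable (B k)) ->
    P (\bigcap_(k in [set` J]) xi k @^-1` B k) =
    (\prod_(k <- J) P (xi k @^-1` B k))%E }.

(* [xi k] is the (k+1)-st coin toss. *)
Fixpoint chain (a : R -> R) xi (y : R) (w : Omega) (k : nat) : R :=
  if k is k'.+1 then
    chain a xi y w k' + a (chain a xi y w k') * xi k' w
  else y.

Definition chain_path (a : R -> R) xi (h y : R) (w : Omega) : cpath R :=
  interp h (chain a xi y w).

End coin_tossing.

(* A set function, which is a measure when X is measurable. *)
Definition law {R : realType} d (Omega : measurableType d)
    (P : probability Omega R) (X : Omega -> cpath R) :
    set (borel_cpath R) -> \bar R :=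
  pushforward P (X : Omega -> borel_cpath R).

(* weak convergence of measures on C([0, oo), R) as h decreases to 0 *)
Definition cvg_weakly {R : realType} (mu : R -> set (borel_cpath R) -> \bar R)
    (nu : set (borel_cpath R) -> \bar R) : Prop :=
  forall f : cpath R -> R, bounded_continuous f ->
    (\int[mu h]_w (f w)%:E)%E @[h --> 0^'+] --> (\int[nu]_w (f w)%:E)%E.

(* Main.v *)
Require Import Defs.
From HB Require Import structures.
From mathcomp Require Import all_boot all_order all_algebra finmap.
From mathcomp Require Import all_classical all_reals all_analysis.
From mathcomp Require Import measurable_realfun.
From mathcomp Require Import ring lra.

(** The proof embeds the Markov chain into the diffusion.  Started at y, the
    diffusion leaves the interval of radius a(y) around y through each endpoint with
    probability 1/2, because it is in natural scale.  By the strong Markov property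
    the positions at the successive exit times, where each interval is centered at
    the previous exit point, form a random walk with the law of the chain
    ([chain_follows], [embedded_follows]).  Hence the interpolated chain may be
    replaced by the interpolation of these positions, which is a function of the
    path of the diffusion itself ([eq_walk_expectation]).  As the path is
    continuous, this interpolation is close to it as soon as the k-th exit time is
    close to k h, uniformly for k h in compact intervals ([embedded_path_cvg]).

    The mean duration of a step that starts at y is the integral of the tent of
    height a(y) and center y against half of the speed measure ([exit_mean]).  The
    equation for a(y) says that this integral equals h when the Cantor distribution
    is replaced by its n-th approximation.  The tent is a second difference of
    distances, so the error is governed by the potentials of the approximations;
    self-similarity divides the increments of these potentials by 6 in each step
    ([pot_diff]).  The error is therefore of order 6 ^ (- n(h)), which is o(h) as
    2 ^ n(h) times the square root of h tends to infinity.  So the mean duration of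
    a step is h (1 + o(1)), uniformly in y.

    It remains to show that the k-th exit time concentrates at k h
    ([embed_time_tail]).  Exit times have geometric tails ([exit_tail]), so that the
    second moment of a step is O(h ^ 2) and its Laplace transform at lam is at most
    exp (- lam h (1 - e) + O(lam ^ 2 h ^ 2)), where e = o(1).  The strong Markov
    property multiplies these bounds ([step_integral_le]), and Chernoff's inequality excludes that the k-th exit time
    is too small; given this, the bound on its mean excludes that it is too large.
    Monotonicity in k makes the estimate uniform ([late_event_small]).  The
    Borel-Cantelli lemma along fast sequences of time steps and dominated
    convergence conclude ([coin_tossing_cvg_weakly]). *)

Set Implicit Arguments.
Unset Strict Implicit.
Unset Printing Implicit Defensive.

Import Order.TTheory GRing.Theory Num.Theory.
Import numFieldNormedType.Exports.

Local Open Scope classical_set_scope.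
Local Open Scope ring_scope.

(** * The path space: topology and Borel sets *)
Section measurable_sets.
Context {R : realType} d (T : measurableType d).
Implicit Types f g : T -> R.

Lemma measurable_le_set f g :
  measurable_fun setT f -> measurable_fun setT g ->
  measurable [set x | f x <= g x].
Proof.
by move=> mf mg; rewrite -[X in measurable X]setTI; exact: measurable_fun_le.
Qed.

Lemma measurable_lt_set f g :
  measurable_fun setT f -> measurable_fun setT g ->
  measurable [set x | f x < g x].
Proof.
move=> mf mg; rewrite (_ : [set _ | _] = ~` [set x | g x <= f x]).
  by apply: measurableC; exact: measurable_le_set.
by apply/seteqP; split => x /=; rewrite ltNge => /negP.
Qed.

Lemma bigcapT_measurable_rat (A : rat -> set T) :
  (forall p, measurable (A p)) -> measurable (\bigcap_p A p).
Proof.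
move=> mA; rewrite -[X in measurable X]setCK setC_bigcap; apply: measurableC.
by apply: bigcupT_measurable_rat => p; exact: measurableC.
Qed.

End measurable_sets.

Section path_space_facts.
Context {R : realType}.
Implicit Types (w v : cpath R) (s t : R).

(** Paths as functions on the whole real line, constant before time 0, so that
    real analysis applies without carrying proofs that times are nonnegative. *)
Definition ev w t : R := path_at w (at_time t).

Arguments ev : simpl never.

Lemma evE w (t : time R) : path_at w t = ev w (seconds t).
Proof. by rewrite /ev secondsK. Qed.

Lemma ev_neg w t : t <= 0 -> ev w t = ev w 0.
Proof.
move=> t0; rewrite /ev; congr (path_at w _); apply: val_inj => /=.
by rewrite max_l// max_l.
Qed.

Lemma continuous_ev w : continuous (ev w).
Proof.
move=> t; apply: (continuous_comp (@continuous_at_time _ t)).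
exact: (@cts_fun _ _ (w : continuousType _ _)).
Qed.

Lemma ev_shift (s : time R) w t : 0 <= t ->
  ev (shift_path s w) t = ev w (seconds s + t).
Proof.
move=> t0; rewrite /ev /path_at/= /shift_fun; congr (path_at w (at_time (_ + _))).
exact: at_timeK.
Qed.

Lemma ev_interp h (x : nat -> R) t : 0 <= t ->
  ev (interp h x) t = linear_interp x (t / h).
Proof.
move=> t0; transitivity (linear_interp x (seconds (at_time t) / h)) => //.
by rewrite at_timeK.
Qed.

(** A linear interpolation is a convex combination of two consecutive values. *)
Lemma linear_interp_dist (x : nat -> R) s (c e : R) : 0 <= s ->
  `|x (Num.truncn s) - c| <= e -> `|x (Num.truncn s).+1 - c| <= e ->
  `|linear_interp x s - c| <= e.
Proof.
move=> s0; rewrite /linear_interp.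
have := truncnS_gt s; have : (Num.truncn s)%:R <= s by rewrite truncn_le.
move: (Num.truncn s) => j; rewrite -natr1 => js sj.
rewrite !ler_norml => /andP[? ?] /andP[? ?]; apply/andP; split; nra.
Qed.

Lemma uniformly_continuous_segment (g : R -> R) (M e : R) :
  continuous g -> 0 < e ->
  exists2 d, 0 < d & forall s t, 0 <= s <= M -> `|s - t| <= d ->
    `|g s - g t| < e.
Proof.
move=> cg e0; have e20 : 0 < e / 2 by rewrite divr_gt0.
have /compact_near_coveringP/(_ R (0^'+)
  (fun d s => forall t, `|s - t| <= d -> `|g s - g t| < e) _) near_cov :=
  @segment_compact R 0 M.
have [|d /= d0 H] := near_cov.
- move=> x _.
  have /cvgrPdist_lt /(_ _ e20) [r /= r0 gr] := cg x.
  exists (ball x (r / 2), `]0, r / 2[%classic).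
    split; first by apply: nbhsx_ballx; rewrite divr_gt0.
    by near=> d => /=; rewrite in_itv/=; apply/andP; split;
      near: d; [exact: nbhs_right_gt|apply: nbhs_right_lt; rewrite divr_gt0].
  move=> [s d] /= [sx]; rewrite in_itv/= => /andP[d0 dr] t st.
  have sx' : `|x - s| < r by apply: lt_trans sx _; lra.
  have tx : `|x - t| < r.
    rewrite -(subrKA s) (le_lt_trans (ler_normD _ _))//.
    by move: sx => /=; rewrite /ball/= => sx; lra.
  have := gr _ tx; have := gr _ sx'.
  rewrite !ltr_norml => /andP[? ?] /andP[? ?]; apply/andP; split; lra.
- exists (d / 2); first by rewrite divr_gt0.
  move=> s t s0; apply: (H (d / 2)) => //=; last by rewrite divr_gt0.
  by rewrite /ball/= sub0r normrN gtr0_norm ?divr_gt0//; lra.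
Unshelve. all: by end_near. Qed.

Definition tube w (m d : R) : set (cpath R) :=
  [set v | forall t, 0 <= t <= m -> `|ev v t - ev w t| < d].

(** A compact set of times is bounded, so the tubes over [[0, m]] form a basis
    of neighbourhoods.  Coupling the length and the width of the tube in one
    natural number makes the basis countable. *)
Lemma nbhs_tube w (A : set (cpath R)) :
  nbhs w A -> exists (m : nat), tube w m%:R m.+1%:R^-1 `<=` A.
Proof.
pose G : set_system (cpath R) :=
  filter_from [set: nat] (fun m => tube w m%:R m.+1%:R^-1).
have FG : Filter G.
  apply: filter_from_filter; first by exists 0%N.
  move=> i j _ _; exists (maxn i j) => // v H.
  split=> t /andP[t0 tm]; (apply: lt_le_trans; first apply: H).
  - by rewrite t0 (le_trans tm)// ler_nat leq_maxl.
  - by rewrite lef_pV2 ?posrE// ler_nat ltnS leq_maxl.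
  - by rewrite t0 (le_trans tm)// ler_nat leq_maxr.
  - by rewrite lef_pV2 ?posrE// ler_nat ltnS leq_maxr.
suff Gw : G --> w by move=> /Gw[m _ H]; exists m.
move=> B; rewrite nbhsE; case=> C [[V oV <-] Vw] UB.
have : {family compact, (fmap (fun v : cpath R => (v : {family compact, time R -> R})) G) --> (w : time R -> R)}.
  apply/fam_cvgP => K cK U /uniform_nbhs [E [entE EU]].
  move: entE; rewrite -entourage_ballE; case=> [e /= e0 eE].
  have [M M0 KM] : exists2 M : R, 0 < M & forall t : time R, K t -> seconds t <= M.
    have /compact_bounded [M [Mr HM]] : compact (seconds @` K).
      apply: continuous_compact => //; apply: continuous_subspaceT.
      exact: continuous_seconds.
    exists (`|M| + 1); first by rewrite ltr_wpDl.
    move=> t Kt; apply: le_trans (ler_norm _) _; apply: (HM (`|M| + 1)).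
      by rewrite (le_lt_trans (ler_norm M))// ltrDl.
    by exists t.
  exists (maxn (Num.truncn M).+1 (Num.truncn e^-1)) => // v H.
  apply: EU => t Kt; apply: eE; rewrite /ball/= distrC.
  have := H (seconds t); rewrite -!evE => {}H.
  apply: lt_le_trans (H _) _.
    rewrite seconds_ge0/= (le_trans (KM _ Kt))//.
    apply/ltW/(lt_le_trans (truncnS_gt _)).
    by rewrite ler_nat leq_maxl.
  rewrite invf_ple ?posrE// (le_trans (ltW (truncnS_gt _)))//.
  by rewrite ler_nat ltnS leq_maxr.
move=> /(_ V) H; have : nbhs (w : {family compact, time R -> R}) V.
  exact: open_nbhs_nbhs.
by move=> /H [m _ Hm]; exists m => // v /Hm /UB.
Qed.

Lemma tube_nbhs w m d : 0 < d -> nbhs w (tube w m d).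
Proof.
move=> d0.
have cK : compact (at_time @` `[0, m]%classic : set (time R)).
  apply: continuous_compact; last exact: segment_compact.
  by apply: continuous_subspaceT; exact: continuous_at_time.
have entE : entourage [set xy : R * R | ball xy.1 d xy.2].
  exact: (entourage_ball _ (PosNum d0)).
have cI : continuous (fun v : cpath R => (v : {family compact, time R -> R})).
  exact: initial_continuous.
have : nbhs w [set v : cpath R | forall y, (at_time @` `[0, m]) y ->
    ball (path_at w y) d (path_at v y)].
  exact: cI w _ (@fam_nbhs (time R) R compact _ _ (w : time R -> R) entE cK).
apply: (@filterS _ _ (@nbhs_filter (cpath R : topologicalType) w)) => v H t t0m.
by rewrite distrC; apply: (H (at_time t)); exists t => //=; rewrite in_itv.
Qed.

Lemma continuous_ev_path t : continuous (fun w => ev w t).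
Proof.
move=> w A; rewrite -nbhs_ballE; case=> e /= e0 eA.
apply: (@filterS _ _ (@nbhs_filter (cpath R : topologicalType) w) _ _ _
  (@tube_nbhs w (Num.max 0 t) _ e0)) => v H; apply: eA.
rewrite /ball/= distrC; have [t0|t0] := leP 0 t.
  by apply: H; rewrite t0 le_max lexx orbT.
by rewrite !(ev_neg _ (ltW t0)); apply: H; rewrite lexx le_max lexx.
Qed.

(** Countably many paths, dense for locally uniform convergence
    ([grid_path_dense]). *)
Let grid_path (i : nat * seq rat) : cpath R :=
  interp i.1.+1%:R^-1 (fun j => ratr (nth 0 i.2 j)).

Lemma grid_path_dense w (m : nat) (e : R) : 0 < e ->
  exists i, forall t, 0 <= t <= m%:R -> `|ev w t - ev (grid_path i) t| <= e.
Proof.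
move=> e0; have e20 : 0 < e / 2 by rewrite divr_gt0.
have [d d0 wd] :=
  @uniformly_continuous_segment (ev w) m%:R (e / 2) (@continuous_ev w) e20.
pose k := Num.truncn d^-1.
have kd : k.+1%:R^-1 <= d.
  by rewrite invf_ple ?posrE//; exact/ltW/truncnS_gt.
have [|q qP] := @choice _ _
    (fun j p => `|ratr p - ev w (j%:R / k.+1%:R)| < e / 2).
  move=> j; have [|p] := @rat_in_itvoo R (ev w (j%:R / k.+1%:R) - e / 2)
    (ev w (j%:R / k.+1%:R) + e / 2); first by lra.
  by rewrite in_itv/= => /andP[? ?]; exists p; rewrite ltr_norml; lra.
exists (k, mkseq q (m * k.+1).+2) => t /andP[t0 tm].
have h0 : (0 : R) < k.+1%:R^-1 by rewrite invr_gt0.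
have kE : k.+1%:R * k.+1%:R^-1 = 1 :> R by rewrite divff.
rewrite distrC ev_interp//= invrK.
have tk0 : 0 <= t * k.+1%:R by rewrite mulr_ge0.
have := truncnS_gt (t * k.+1%:R).
have : (Num.truncn (t * k.+1%:R))%:R <= t * k.+1%:R by rewrite truncn_le.
have : (Num.truncn (t * k.+1%:R) < (m * k.+1).+1)%N.
  rewrite ltnS truncn_le_nat (le_lt_trans (_ : _ <= (m * k.+1)%:R))//.
    by rewrite natrM ler_pM2r.
  by rewrite ltr_nat.
have close (j : nat) : (j < (m * k.+1).+2)%N ->
    `|t - j%:R / k.+1%:R| <= k.+1%:R^-1 ->
    `|ratr (nth 0 (mkseq q (m * k.+1).+2) j) - ev w t| <= e.
  move=> jm tj; rewrite nth_mkseq// -(subrKA (ev w (j%:R / k.+1%:R))).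
  rewrite (le_trans (ler_normD _ _))// [leRHS]splitr lerD ?(ltW (qP j))//.
  by rewrite ltW// distrC wd ?t0//; exact: le_trans kd.
move=> jm jt tj; apply: linear_interp_dist => //; apply: close.
- by rewrite ltnS ltnW.
- rewrite ger0_norm; last by rewrite subr_ge0 ler_pdivrMr.
  rewrite -[X in X - _](@mulfK _ k.+1%:R)// -mulrBl -[leRHS]mul1r ler_pM2r//.
  by rewrite lerBlDr addrC natr1 ltW.
- by rewrite ltnS.
- have {tj} tj : t <= (Num.truncn (t * k.+1%:R)).+1%:R / k.+1%:R.
    by rewrite ler_pdivlMr// ltW.
  rewrite ler0_norm ?subr_le0// opprB.
  rewrite -[X in _ - X](@mulfK _ k.+1%:R)// -mulrBl -[leRHS]mul1r ler_pM2r//.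
  by rewrite lerBlDr -natr1 addrC lerD2l.
Qed.

Section measurable_path_map.
Context d (T : measurableType d).

(** By continuity a tube is a condition on rational times only. *)
Lemma measurable_closed_tube (Z : T -> cpath R) w (m r : R) :
  0 <= m -> (forall t, measurable_fun setT (fun x => ev (Z x) t)) ->
  measurable [set x | forall t, 0 <= t <= m -> `|ev (Z x) t - ev w t| <= r].
Proof.
move=> m0 mZ.
rewrite (_ : [set _ | _] = \bigcap_(p : rat)
    [set x | `|ev (Z x) (Num.min m (ratr p)) - ev w (Num.min m (ratr p))| <= r]).
  apply: bigcapT_measurable_rat => p.
  have mg : measurable_fun setT
      (fun x => `|ev (Z x) (Num.min m (ratr p)) - ev w (Num.min m (ratr p))|).
    by apply: measurableT_comp => //; apply: measurable_funB.
  exact: measurable_le_set.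
apply/seteqP; split => [x xt p _ /=|x xp t /andP[t0 tm]].
  have [p0|p0] := leP 0 (Num.min m (ratr p) : R); last first.
    by rewrite !(ev_neg _ (ltW p0)); apply: xt; rewrite lexx.
  by apply: xt; rewrite p0 ge_min lexx.
rewrite leNgt; apply/negP => rt.
pose g s := `|ev (Z x) (Num.min m s) - ev w (Num.min m s)|.
have cg : continuous g.
  have cu u : continuous (fun s => ev u (Num.min m s)).
    move=> s; have cmin : {for s, continuous (fun s => Num.min m s)}.
      by apply: continuous_min; [exact: cvg_cst|exact: cvg_id].
    exact: (continuous_comp cmin (@continuous_ev u _)).
  by move=> s; apply: cvg_norm; apply: cvgB; exact: cu.
have oG : open [set s | r < g s].
  by apply: (@open_comp _ _ g [set s | r < s]) => //; exact: open_gt.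
have /dense_rat /(_ oG) [z [/= rp [p _ pE]]] : [set s | r < g s] !=set0.
  by exists t; rewrite /= /g min_r.
by have := xp p I; rewrite /= leNgt => /negP; apply; rewrite pE.
Qed.

(** A path is determined by countably many evaluations and the path space is
    separable, so the Borel sets are generated by the evaluations. *)
Lemma measurable_path (Z : T -> cpath R) :
  (forall t, measurable_fun setT (fun x => ev (Z x) t)) ->
  measurable_fun setT (Z : T -> borel_cpath R).
Proof.
move=> mZ; apply: (@measurability _ _ _ (borel_cpath R) _ _ (@open (cpath R))).
  by [].
move=> _ [U oU <-]; rewrite setTI.
pose D (i : nat * (nat * seq rat)) : set (cpath R) := [set v | forall t,
  0 <= t <= i.1%:R -> `|ev v t - ev (grid_path i.2) t| <= (2 * i.1.+1%:R)^-1].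
rewrite (_ : _ @^-1` _ = \bigcup_i (if `[< D i `<=` U >] then Z @^-1` D i else set0)).
  apply: countable_bigcupT_measurable; first exact: countableP.
  move=> i; case: ifP => // _; exact: measurable_closed_tube.
apply/seteqP; split => x /=; last first.
  by move=> [i _]; case: ifPn => // /asboolP DU /DU.
move=> Ux; have [m mU] := nbhs_tube (open_nbhs_nbhs (conj oU Ux)).
have [e [e0 E E2]] : exists e : R,
    [/\ 0 < e, m.+1%:R^-1 = 4 * e & (2 * m.+1%:R)^-1 = 2 * e].
  exists (4 * m.+1%:R)^-1; split; first by rewrite invr_gt0 mulr_gt0.
    by rewrite invfM mulrA divff ?mul1r.
  have -> : (4 : R) = 2 * 2 by lra.
  by rewrite -mulrA [in RHS]invfM mulrA divff ?mul1r.
have [i iP] := grid_path_dense (Z x) m e0.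
exists (m, i) => //; case: ifPn => [_ /= t tm|/asboolP[]].
  by rewrite (le_trans (iP _ tm))//= E2; lra.
move=> v Dv; apply: mU => t tm; have := iP _ tm; have := Dv _ tm => /=.
rewrite E E2 !ler_norml ltr_norml => /andP[? ?] /andP[? ?].
by apply/andP; split; lra.
Qed.

End measurable_path_map.

Lemma measurable_continuous_path (f : cpath R -> R) :
  continuous f -> measurable_fun setT (f : borel_cpath R -> R).
Proof.
move=> cf; apply: (measurability (@RGenOpens.G R)).
  exact: RGenOpens.measurableE.
move=> _ [_ [x [y ->]] <-]; rewrite setTI; apply: sub_sigma_algebra.
by have /continuousP := cf; apply; exact: interval_open.
Qed.

Lemma measurable_ev t : measurable_fun setT (fun w : borel_cpath R => ev w t).
Proof. by apply: measurable_continuous_path; exact: continuous_ev_path. Qed.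

End path_space_facts.

Arguments ev : simpl never.

(** * Hitting times and exit times of a path *)
Section hitting_times.
Context {R : realType}.
Implicit Types (w : cpath R) (x s t l u : R).

(** The set of times at which a path visits a level is closed, so the infimum
    is a minimum. *)
Lemma hitting_timeP x w :
  (hitting_time x w = +oo%E /\ forall s, 0 <= s -> ev w s != x) \/
  exists s, [/\ 0 <= s, hitting_time x w = s%:E, ev w s = x &
                forall r, 0 <= r < s -> ev w r != x].
Proof.
have hitE : hitting_time x w =
    ereal_inf [set s%:E | s in [set s | 0 <= s /\ ev w s = x]].
  congr ereal_inf; apply/seteqP; split => y [/= t].
    move=> tx <-; exists (seconds t) => //=; split; first exact: seconds_ge0.
    by rewrite -evE.
  by move=> [t0 tx] <-; exists (at_time t); rewrite ?at_timeK.
have [[s0 [s00 s0x]]|nx] := pselect (exists s, 0 <= s /\ ev w s = x).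
  right.
  pose K := `[0, s0]%classic `&` ev w @^-1` [set x].
  have cK : compact K.
    apply: (@subclosed_compact _ _ `[0, s0]%classic).
    - apply: closedI; first exact: interval_closed.
      by apply: closed_comp; [move=> ? _; exact: continuous_ev|exact: closed_eq].
    - exact: segment_compact.
    - by move=> ? [].
  have K0 : K !=set0 by exists s0; split => //=; rewrite in_itv/= s00 lexx.
  have [c] := @compact_EVT_min _ _ id K K0 cK (continuous_subspaceT (fun=> cvg_id)).
  rewrite inE => -[/=]; rewrite in_itv/= => /andP[c0 cs0] cx cmin.
  have cmin' r : 0 <= r < c -> ev w r != x.
    move=> /andP[r0 rc]; apply/eqP => rx.
    suff : c <= r by rewrite leNgt rc.
    apply: cmin; rewrite inE; split => //=.
    by rewrite in_itv/= r0 (le_trans (ltW rc)).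
  exists c; split => //; rewrite hitE; apply/eqP; rewrite eq_le; apply/andP; split.
    by apply: ereal_inf_lbound; exists c.
  apply: le_ereal_inf_tmp => _ [r [/= r0 rx] <-]; rewrite lee_fin leNgt.
  by apply/negP => rc; have := cmin' r; rewrite r0 rc rx eqxx => /(_ isT).
left; split; last by move=> s s0; apply/eqP => sx; apply: nx; exists s.
rewrite hitE -(@ereal_inf0 R); congr ereal_inf; apply/seteqP; split => // y [s sx _].
by exfalso; apply: nx; exists s.
Qed.

Lemma hitting_time_ge0 x w : (0 <= hitting_time x w)%E.
Proof. by have [[-> _]|[s [s0 ->]]] := hitting_timeP x w. Qed.

Lemma hitting_time_leP x w t :
  (hitting_time x w <= t%:E)%E <-> exists s, 0 <= s <= t /\ ev w s = x.
Proof.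
have [[-> H]|[s [s0 -> sx H]]] := hitting_timeP x w.
  split => // -[s [/andP[s0 _] sx]].
  by have := H _ s0; rewrite sx eqxx.
rewrite lee_fin; split=> [st|[r [/andP[r0 rt] rx]]].
  by exists s; rewrite s0.
rewrite leNgt; apply/negP => ts; have := H r.
by rewrite r0 (le_lt_trans rt)// rx eqxx => /(_ isT).
Qed.

Lemma hitting_time_fin x w s : hitting_time x w = s%:E -> 0 <= s /\ ev w s = x.
Proof.
by have [[-> //]|[r [r0 -> rx _]]] := hitting_timeP x w; case=> <-.
Qed.

(** What makes hitting times stopping times for a filtration that need be
    neither complete nor right-continuous: the event that a level has been hit by
    time t only involves countably many times before t.  If the infimum of the
    distance to the level over these times is 0, it is attained by compactness. *)
Lemma hitting_time_le_rat x w t : 0 <= t ->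
  (hitting_time x w <= t%:E)%E <->
  forall n : nat, exists p : rat, `|ev w (Num.min t (ratr p)) - x| < n.+1%:R^-1.
Proof.
move=> t0; split => [/hitting_time_leP[s [/andP[s0 st] sx]] n|H].
  pose g r := `|ev w (Num.min t r) - x|.
  have cg : continuous g.
    move=> r; have cmin : {for r, continuous (fun r => Num.min t r)}.
      by apply: continuous_min; [exact: cvg_cst|exact: cvg_id].
    apply: cvg_norm; apply: cvgB; last exact: cvg_cst.
    exact: (continuous_comp cmin (@continuous_ev _ w _)).
  have oG : open [set r | g r < n.+1%:R^-1].
    by apply: (@open_comp _ _ g [set r | r < _]) => //; exact: open_lt.
  have /dense_rat /(_ oG) [z [/= zp [p _ pE]]] : [set r | g r < n.+1%:R^-1] !=set0.
    by exists s; rewrite /= /g min_r// sx subrr normr0 invr_gt0.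
  by exists p; rewrite pE.
have cg : continuous (fun r => `|ev w r - x|).
  by move=> r; apply: cvg_norm; apply: cvgB; [exact: continuous_ev|exact: cvg_cst].
have [c] := EVT_min t0 (continuous_subspaceT cg).
rewrite in_itv/= => c0t cmin; apply/hitting_time_leP; exists c; split => //.
apply/eqP; rewrite -subr_eq0 -normr_eq0 eq_le normr_ge0 andbT leNgt.
apply/negP => c0; have [p] := H (Num.truncn `|ev w c - x|^-1).
apply/negP; rewrite -leNgt; apply: (@le_trans _ _ `|ev w c - x|).
  by rewrite invf_ple ?posrE// ltW// truncnS_gt.
have [p0|p0] := leP 0 (Num.min t (ratr p) : R).
  by apply: cmin; rewrite in_itv/= p0 ge_min lexx.
by rewrite (ev_neg _ (ltW p0)); apply: cmin; rewrite in_itv/= lexx.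
Qed.

Lemma stays_inside l u w t : l <= ev w 0 <= u -> 0 <= t ->
  (forall s, 0 <= s <= t -> ev w s != l /\ ev w s != u) -> l < ev w t < u.
Proof.
move=> /andP[lw wu] t0 H; have cw A : {within A, continuous (ev w)}.
  exact: continuous_subspaceT (@continuous_ev R w).
rewrite !ltNge; apply/andP; split; apply/negP => tl.
  have [|c] := @IVT _ _ _ _ l t0 (cw _); first by rewrite ge_min le_max tl orbT lw.
  by rewrite in_itv/= => /H[/eqP].
have [|c] := @IVT _ _ _ _ u t0 (cw _); first by rewrite ge_min le_max tl orbT wu.
by rewrite in_itv/= => /H[_ /eqP].
Qed.

Definition exit_time l u w : \bar R := mine (hitting_time l w) (hitting_time u w).

Lemma exit_time_ge0 l u w : (0 <= exit_time l u w)%E.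
Proof. by rewrite le_min !hitting_time_ge0. Qed.

Lemma exit_time_inside l u w t : l <= ev w 0 <= u -> 0 <= t ->
  (t%:E < exit_time l u w)%E -> l < ev w t < u.
Proof.
move=> w0 t0 tlu; apply: stays_inside => // s s0t.
move: tlu; rewrite lt_min !ltNge => /andP[/negP lt /negP ut].
by split; apply/eqP => sx; [apply: lt|apply: ut]; apply/hitting_time_leP; exists s.
Qed.

Lemma hitting_time_shift x w (c : time R) t : 0 <= t ->
  ((seconds c + t)%:E < hitting_time x w)%E ->
  (t%:E < hitting_time x (shift_path c w))%E.
Proof.
move=> t0; rewrite !ltNge => /negP H; apply/negP => /hitting_time_leP.
move=> [s [/andP[s0 st]]]; rewrite ev_shift// => sx; apply: H.
apply/hitting_time_leP; exists (seconds c + s); split => //.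
by rewrite addr_ge0 ?seconds_ge0//= lerD2l.
Qed.

Lemma exit_time_shift l u w (c : time R) t : 0 <= t ->
  ((seconds c + t)%:E < exit_time l u w)%E ->
  (t%:E < exit_time l u (shift_path c w))%E.
Proof.
by move=> t0; rewrite !lt_min => /andP[? ?]; rewrite !hitting_time_shift.
Qed.

Lemma exit_time_at l u w s : exit_time l u w = s%:E ->
  0 <= s /\
  if (hitting_time u w < hitting_time l w)%E then ev w s = u else ev w s = l.
Proof.
rewrite /exit_time /Order.min; case: ifPn => [lu /hitting_time_fin|].
  by rewrite ltNge (ltW lu).
rewrite -leNgt => ul hs; have := hitting_time_fin hs.
case: ifPn => //; rewrite -leNgt => lu _.
by apply: hitting_time_fin; rewrite -hs; apply/eqP; rewrite eq_le lu.
Qed.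

End hitting_times.

Section measurable_hitting_times.
Context {R : realType} d (T : measurableType d).
Variable Z : T -> cpath R.

(** The level [c] may depend on the path: it does when a step of the walk starts
    from the current position.  Only the past before [t] has to be measurable, so
    that the lemma also applies to the events of a filtration. *)
Lemma measurable_hitting_time_le (c : T -> R) t :
  (forall s, s <= t -> measurable_fun setT (fun x => ev (Z x) s)) ->
  measurable_fun setT c ->
  measurable [set x | (hitting_time (c x) (Z x) <= t%:E)%E].
Proof.
move=> mZ mc; have [t0|t0] := leP 0 t; last first.
  rewrite (_ : [set _ | _] = set0)//; apply/seteqP; split => // x /=.
  by rewrite leNgt (lt_le_trans _ (hitting_time_ge0 _ _))// lte_fin.
rewrite (_ : [set _ | _] = \bigcap_(n : nat) \bigcup_(p : rat)
    [set x | `|ev (Z x) (Num.min t (ratr p)) - c x| < n.+1%:R^-1]).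
  apply: bigcapT_measurable => n; apply: bigcupT_measurable_rat => p.
  apply: measurable_lt_set => //; apply: measurableT_comp => //.
  by apply: measurable_funB => //; apply: mZ; rewrite ge_min lexx.
apply/seteqP; split => x /=.
  by move=> /(hitting_time_le_rat _ _ t0) H n _; have [p] := H n; exists p.
move=> H; apply/(hitting_time_le_rat _ _ t0) => n.
by have [p] := H n I; exists p.
Qed.

Hypothesis mZ : forall s, measurable_fun setT (fun x => ev (Z x) s).

Lemma measurable_hitting_time (c : T -> R) : measurable_fun setT c ->
  measurable_fun setT (fun x => hitting_time (c x) (Z x)).
Proof.
move=> mc; apply: (measurability (@ErealGenOInfty.G R)).
  exact: ErealGenOInfty.measurableE.
move=> _ [_ [t ->] <-]; rewrite setTI.
rewrite (_ : _ @^-1` _ = ~` [set x | (hitting_time (c x) (Z x) <= t%:E)%E]).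
  by apply: measurableC; apply: measurable_hitting_time_le.
apply/seteqP; split => x /=; rewrite in_itv/= andbT ltNge.
  by move/negP.
by move=> H; apply/negP.
Qed.

Lemma measurable_exit_time (l u : T -> R) :
  measurable_fun setT l -> measurable_fun setT u ->
  measurable_fun setT (fun x => exit_time (l x) (u x) (Z x)).
Proof. by move=> ml mu; apply: measurable_mine; exact: measurable_hitting_time. Qed.

(** The evaluation at a random time is a limit of evaluations at the times
    rounded to a grid, on which countably many cases suffice. *)
Lemma measurable_ev_at (s : T -> R) : measurable_fun setT s ->
  measurable_fun setT (fun x => ev (Z x) (s x)).
Proof.
move=> ms.
pose D (k : nat) x : R := (Num.floor (s x * k.+1%:R))%:~R / k.+1%:R.
apply: (@measurable_fun_cvg _ _ _ _ (fun k x => ev (Z x) (D k x))).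
  move=> k; move=> _ B mB; rewrite setTI.
  rewrite (_ : _ @^-1` _ = \bigcup_(z : int)
      ([set x | z%:~R <= s x * k.+1%:R] `&` [set x | s x * k.+1%:R < (z + 1)%:~R]
       `&` [set x | B (ev (Z x) (z%:~R / k.+1%:R))])).
    apply: countable_bigcupT_measurable; first exact: countableP.
    move=> z; apply: measurableI; last first.
      rewrite -[X in measurable X]setTI; exact: mZ.
    have mf : measurable_fun setT (fun x => s x * k.+1%:R).
      exact: measurable_funM.
    by apply: measurableI; [exact: measurable_le_set|exact: measurable_lt_set].
  apply/seteqP; split => x /=.
    move=> xB; exists (Num.floor (s x * k.+1%:R)) => //=.
    by have /andP[] := floor_itv (s x * k.+1%:R).
  by move=> [z _ [/= [zs sz] xB]]; rewrite /D (floor_def (m := z)) ?zs.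
move=> x _; have cD : (fun k => D k x) @ \oo --> s x.
  apply/cvgrPdist_lt => e e0; near=> k; rewrite /D.
  have := floor_itv (s x * k.+1%:R); rewrite intrD => /andP[lo hi].
  have kp : (0 : R) < k.+1%:R by [].
  have -> : s x - (Num.floor (s x * k.+1%:R))%:~R / k.+1%:R =
      (s x * k.+1%:R - (Num.floor (s x * k.+1%:R))%:~R) / k.+1%:R.
    by rewrite mulrBl mulfK.
  rewrite ger0_norm ?divr_ge0 ?subr_ge0//.
  apply: (@le_lt_trans _ _ (k.+1%:R^-1)).
    by rewrite -[leRHS]mul1r ler_pM2r ?invr_gt0// lerBlDr addrC ltW.
  near: k; exact: near_infty_natSinv_lt (PosNum e0).
exact: (cvg_comp _ _ cD (@continuous_ev _ (Z x) (s x))).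
Unshelve. all: by end_near. Qed.

End measurable_hitting_times.

(** * Successive exits of a path *)
Section embedding.
Context {R : realType}.
Variable a : R -> R.
Implicit Types (w : cpath R) (t : R).

Definition step_time w : R :=
  fine (exit_time (ev w 0 - a (ev w 0)) (ev w 0 + a (ev w 0)) w).

(** Restarting the path at its exit time turns the successive exits into the
    iterates of one map on path space, to which the strong Markov property at the
    exit time applies inductively. *)
Definition next w : cpath R := shift_path (at_time (step_time w)) w.

Definition embed_time (k : nat) w : R :=
  \sum_(0 <= j < k) step_time (iter j next w).

Lemma step_time_ge0 w : 0 <= step_time w.
Proof. exact: fine_ge0 (exit_time_ge0 _ _ _). Qed.

Lemma embed_time_ge0 k w : 0 <= embed_time k w.
Proof. by apply: sumr_ge0 => j _; exact: step_time_ge0. Qed.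

Lemma ev_next w t : 0 <= t -> ev (next w) t = ev w (step_time w + t).
Proof. by move=> t0; rewrite ev_shift// at_timeK// step_time_ge0. Qed.

Lemma embed_timeS k w :
  embed_time k.+1 w = step_time w + embed_time k (next w).
Proof.
rewrite /embed_time big_nat_recl//=; congr (_ + _).
by apply: eq_bigr => j _; rewrite -iterS iterSr.
Qed.

Lemma embed_time_le j k w : (j <= k)%N -> embed_time j w <= embed_time k w.
Proof.
move=> jk; rewrite /embed_time [leRHS](@big_cat_nat _ _ _ j)//= lerDl.
by apply: sumr_ge0 => i _; exact: step_time_ge0.
Qed.

Lemma ev_iter_next k w t : 0 <= t ->
  ev (iter k next w) t = ev w (embed_time k w + t).
Proof.
elim: k w t => [|k IH] w t t0; first by rewrite /embed_time big_geq// add0r.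
by rewrite iterSr IH// ev_next ?addr_ge0 ?embed_time_ge0// embed_timeS addrA.
Qed.

Hypothesis ma : measurable_fun setT a.

Lemma measurable_step_time :
  measurable_fun setT (step_time : borel_cpath R -> R).
Proof.
apply: measurableT_comp => //; apply: measurable_exit_time.
- exact: measurable_ev.
- apply: measurable_funB; first exact: measurable_ev.
  by apply: measurableT_comp => //; exact: measurable_ev.
- apply: measurable_funD; first exact: measurable_ev.
  by apply: measurableT_comp => //; exact: measurable_ev.
Qed.

Lemma measurable_next :
  measurable_fun setT (next : borel_cpath R -> borel_cpath R).
Proof.
apply: measurable_path => t.
have -> : (fun w => ev (next w) t) =
    (fun w => ev w (step_time w + Num.max 0 t)).
  apply/funext => w; have [t0|t0] := leP 0 t; first by rewrite ev_next.
  by rewrite (ev_neg _ (ltW t0)) ev_next.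
apply: (@measurable_ev_at _ _ (borel_cpath R) id); first exact: measurable_ev.
by apply: measurable_funD; [exact: measurable_step_time|exact: measurable_cst].
Qed.

Lemma measurable_iter_next k :
  measurable_fun setT (iter k next : borel_cpath R -> borel_cpath R).
Proof.
elim: k => [|k IH]; first exact: measurable_id.
exact: (measurableT_comp measurable_next IH).
Qed.

Lemma measurable_embed_time k :
  measurable_fun setT (embed_time k : borel_cpath R -> R).
Proof.
apply: measurable_sum => j.
exact: (measurableT_comp measurable_step_time (measurable_iter_next j)).
Qed.

End embedding.

Arguments next : simpl never.
Arguments step_time : simpl never.

(** * Tools from measure theory *)
Section measure_facts.
Local Open Scope ereal_scope.
Context d (T : measurableType d) (R : realType).

Lemma ge0_integral_mrestr (mu : {measure set T -> \bar R}) (D : set T)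
    (mD : measurable D) (f : T -> \bar R) :
  measurable_fun setT f -> (forall x, 0 <= f x) ->
  \int[mrestr mu mD]_x f x = \int[mu]_(x in D) f x.
Proof.
move=> mf f0.
have D0 : mrestr mu mD (~` D) = 0 by rewrite /= /mrestr setICl measure0.
have mDC := measurableC mD.
rewrite (ge0_negligible_integral mDC measurableT mf (fun x _ => f0 x) D0).
rewrite setTD setCK; apply: eq_measure_integral => A mA AD.
by rewrite /= /mrestr setIidl.
Qed.

Lemma probability_setI1 (P : probability T R) (A G : set T) :
  measurable A -> measurable G -> P G = 1 -> P (A `&` G) = P A.
Proof.
move=> mA mG G1; have DI : P A = P (A `\` G) + P (A `&` G) by exact: measureDI.
suff D0 : P (A `\` G) = 0 by rewrite [RHS]DI D0 add0e.
apply/eqP; rewrite eq_le measure_ge0 andbT.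
rewrite (@le_trans _ _ (P (~` G)))// ?le_measure ?inE//.
- exact: measurableD.
- exact: measurableC.
by rewrite probability_setC// G1 subee.
Qed.

Lemma probability_ge_le (P : probability T R) (A B G : set T) :
  measurable A -> measurable B -> measurable G -> P G = 1 ->
  A `&` G `<=` B -> P A <= P B.
Proof.
move=> mA mB mG G1 AGB; rewrite -(probability_setI1 mA mG G1).
by apply: le_measure; rewrite ?inE//; exact: measurableI.
Qed.

Lemma probability_eq_on (P : probability T R) (A B G : set T) :
  measurable A -> measurable B -> measurable G -> P G = 1 ->
  A `&` G = B `&` G -> P A = P B.
Proof.
move=> mA mB mG G1 AGB.
by rewrite -(probability_setI1 mA mG G1) AGB probability_setI1.
Qed.

Lemma ge0_markov (mu : {measure set T -> \bar R}) (f : T -> \bar R) (A : set T)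
    (c : R) :
  measurable_fun setT f -> (forall x, 0 <= f x) -> measurable A -> (0 <= c)%R ->
  (forall x, A x -> c%:E <= f x) -> c%:E * mu A <= \int[mu]_x f x.
Proof.
move=> mf f0 mA c0 Af; have mIA : measurable_fun setT (fun x => (\1_A x)%:E : \bar R).
  by apply/measurable_EFinP; exact: measurable_indic.
rewrite -[in leLHS](setIT A) -integral_indic// -ge0_integralZl//.
apply: ge0_le_integral => //.
- by move=> x _; rewrite mule_ge0// lee_fin.
- exact: emeasurable_funM.
- move=> x _; rewrite indicE; case: (boolP (x \in A)) => [|_].
    by rewrite inE/= mule1 => /Af.
  by rewrite mule0.
Qed.

End measure_facts.

Section independence.
Local Open Scope ereal_scope.
Context d (T : measurableType d) (R : realType).
Context d1 (T1 : measurableType d1) d2 (T2 : measurableType d2).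
Variables (Q : {finite_measure set T -> \bar R}) (P2 : {finite_measure set T2 -> \bar R}).
Variables (X : T -> T1) (W : T -> T2).
Hypotheses (mX : measurable_fun setT X) (mW : measurable_fun setT W).
Hypothesis QE : forall A B, measurable A -> measurable B ->
  Q (X @^-1` A `&` W @^-1` B) = Q (X @^-1` A) * P2 B.

(** The hypothesis says that the joint image measure of [X] and [W] is a
    product measure, and Tonelli's theorem then splits the integral. *)
Lemma ge0_integral_indep (phi : T1 -> \bar R) (psi : T2 -> \bar R) :
  measurable_fun setT phi -> measurable_fun setT psi ->
  (forall x, 0 <= phi x) -> (forall x, 0 <= psi x) ->
  \int[Q]_x (phi (X x) * psi (W x)) =
  (\int[Q]_x phi (X x)) * (\int[P2]_w psi w).
Proof.
move=> mphi mpsi phi0 psi0.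
pose push1 := pushforward Q X : {measure set T1 -> \bar R}.
pose q1 := push1 mX.
have fq1 : fin_num_fun q1.
  move=> A mA; apply: fin_num_measure.
  by rewrite -[X in measurable X]setTI; exact: mX.
pose m1f := Measure_isFinite.Build _ _ _ _ fq1.
pose m1 : {finite_measure set T1 -> \bar R} := HB.pack (Measure.sort q1) (Measure.class q1) m1f.
have mXW : measurable_fun setT (fun x => (X x, W x)).
  exact: measurable_fun_pair.
pose XW x := (X x, W x).
pose push2 := pushforward Q XW : {measure set (T1 * T2) -> \bar R}.
pose m' := push2 mXW.
have m'E := @product_measure_unique _ _ _ _ _ m1 P2 m' QE.
pose f (z : T1 * T2) := phi z.1 * psi z.2.
have mf : measurable_fun setT f.
  apply: emeasurable_funM.
    by apply: measurableT_comp => //; exact: measurable_fst.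
  by apply: measurableT_comp => //; exact: measurable_snd.
have f0 z : 0 <= f z by exact: mule_ge0.
transitivity (\int[m']_z f z).
  by rewrite ge0_integral_pushforward.
rewrite -(@eq_measure_integral _ _ _ _ _ (m1 \x P2)); last first.
  by move=> A mA _; exact: m'E.
rewrite fubini_tonelli1//.
transitivity (\int[m1]_x (phi x * \int[P2]_w psi w)).
  apply: eq_integral => x _.
  transitivity (\int[P2]_w (phi x * psi w)) => //.
  by rewrite ge0_integralZl.
rewrite ge0_integralZr//; last exact: integral_ge0.
by rewrite ge0_integral_pushforward.
Qed.

End independence.

(** * One step of the embedded walk *)
Section diffusion_steps.
Context {R : realType} d (Omega : measurableType d).
Variables (F : time R -> set (set Omega)) (P : R -> probability Omega R)
  (Y : Omega -> cpath R).
Hypothesis Y_diffusion : regular_diffusion F P Y.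
Implicit Types (y z l u : R) (B : set (borel_cpath R)) (x : Omega).

Let mFt t : (F t).-sigma.-measurable = F t.
Proof.
apply: measurable_g_measurableTypeE.
by have [+ _ _] := diffusion_filtration Y_diffusion; exact.
Qed.

Let Fmeas t : F t `<=` measurable.
Proof. by have [_ + _] := diffusion_filtration Y_diffusion; exact. Qed.

Let measurable_ev_F (t : time R) (s : R) : s <= seconds t ->
  measurable_fun setT (fun x : g_sigma_algebraType (F t) => ev (Y x) s).
Proof.
move=> st _ B mB; rewrite setTI mFt.
have [_ _ Fmon] := diffusion_filtration Y_diffusion.
apply: (Fmon (at_time s)); last exact: (diffusion_adapted Y_diffusion).
by rewrite /seconds/= ge_max st seconds_ge0.
Qed.

Lemma measurable_ev_diffusion s : measurable_fun setT (fun x => ev (Y x) s).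
Proof.
move=> _ B mB; rewrite setTI; apply: (@Fmeas (at_time s)).
exact: (diffusion_adapted Y_diffusion).
Qed.

Lemma measurable_diffusion : measurable_fun setT (Y : Omega -> borel_cpath R).
Proof. by apply: measurable_path => s; exact: measurable_ev_diffusion. Qed.

Lemma measurable_diffusion_event B : measurable B -> measurable (Y @^-1` B).
Proof.
by move=> mB; rewrite -[X in measurable X]setTI; exact: measurable_diffusion.
Qed.

Lemma measurable_ev_eq (s : Omega -> R) z : measurable_fun setT s ->
  measurable [set x | ev (Y x) (s x) = z].
Proof.
move=> ms; have := measurable_ev_at measurable_ev_diffusion ms.
by move=> /(_ measurableT [set z] (measurable_set1 z)); rewrite setTI.
Qed.

Lemma diffusion_start0 y : P y [set x | ev (Y x) 0 = y] = 1%E.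
Proof. exact: (diffusion_start Y_diffusion). Qed.

Let tau l u x := exit_time l u (Y x).

Lemma measurable_exit l u : measurable_fun setT (tau l u).
Proof.
by apply: measurable_exit_time; [exact: measurable_ev_diffusion|..];
  exact: measurable_cst.
Qed.

Let exit_le_F l u (t : time R) s : s <= seconds t ->
  F t [set x | (tau l u x <= s%:E)%E].
Proof.
move=> st; rewrite -mFt.
rewrite (_ : [set _ | _] = [set x | (hitting_time l (Y x) <= s%:E)%E] `|`
                           [set x | (hitting_time u (Y x) <= s%:E)%E]); last first.
  by apply/seteqP; split => x /=; rewrite /tau ge_min => /orP.
by apply: measurableU; apply: (@measurable_hitting_time_le _ _
  (g_sigma_algebraType (F t)) Y (cst _) s) => // r rs;
  apply: measurable_ev_F; exact: le_trans st.
Qed.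

Lemma exit_stopping_time l u : is_stopping_time F (tau l u).
Proof. by split=> [x|t]; [exact: exit_time_ge0|exact: exit_le_F]. Qed.

Let exited l u (D : set R) := [set x | (tau l u x < +oo)%E /\ D (fine (tau l u x))].

Let measurable_exited l u D : measurable D -> measurable (exited l u D).
Proof.
move=> mD; apply: measurableI.
  rewrite -[X in measurable X]setTI; apply: emeasurable_fun_infty_o => //.
    exact: measurable_exit.
have : measurable_fun setT (fun x => fine (tau l u x)).
  by apply: measurableT_comp => //; exact: measurable_exit.
by move=> /(_ measurableT D mD); rewrite setTI.
Qed.

(** The past up to the exit time: on the event that the exit occurs before [t],
    the exit time is its minimum with [t], which is known at time [t]. *)
Let exited_stopped l u D : measurable D ->
  stopped_sigma_algebra F (tau l u) (exited l u D).
Proof.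
move=> mD; split=> [|t]; first exact: measurable_exited.
pose g x := fine (mine (tau l u x) (seconds t)%:E).
have mg : measurable_fun setT (g : g_sigma_algebraType (F t) -> R).
  apply: (measurability (@RGenOInfty.G R)).
    exact: RGenOInfty.measurableE.
  move=> _ [_ [s ->] <-]; rewrite setTI.
  rewrite (_ : _ @^-1` _ = ~` [set x | g x <= s]); last first.
    by apply/seteqP; split => x /=; rewrite in_itv/= andbT ltNge => /negP.
  apply: measurableC; have [ts|st] := leP (seconds t) s.
    rewrite (_ : [set _ | _] = setT)//; apply/seteqP; split => // x _ /=.
    have fin : mine (tau l u x) (seconds t)%:E \is a fin_num.
      rewrite ge0_fin_numE; first by rewrite gt_min ltry orbT.
      by rewrite le_min exit_time_ge0 lee_fin seconds_ge0.
    by apply: le_trans ts; rewrite -lee_fin fineK// ge_min lexx orbT.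
  have gE : [set x : Omega | g x <= s] = [set x | (tau l u x <= s%:E)%E].
    apply/seteqP; split => v /=; rewrite /g.
      have [tt|tt] := leP (tau l u v) (seconds t)%:E.
        rewrite -lee_fin fineK// ge0_fin_numE ?exit_time_ge0//.
        exact: le_lt_trans tt (ltry _).
      by rewrite /= leNgt st.
    move=> ts; rewrite min_l; last by rewrite (le_trans ts)// lee_fin ltW.
    rewrite -lee_fin fineK// ge0_fin_numE ?exit_time_ge0//.
    exact: le_lt_trans ts (ltry _).
  by rewrite mFt [A in F t A]gE; apply: exit_le_F; exact: ltW.
rewrite -mFt.
rewrite (_ : _ `&` _ = g @^-1` D `&` [set x | (tau l u x <= (seconds t)%:E)%E]).
  apply: measurableI; last by rewrite mFt; exact: exit_le_F.
  by rewrite -[X in measurable X]setTI; exact: mg.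
apply/seteqP; split => x /= [].
  by move=> [_ Dx] tt; split => //; rewrite /g min_l.
rewrite /g => + tt; rewrite min_l// => Dx; split => //; split => //.
exact: le_lt_trans tt (ltry _).
Qed.

Let shifted l u x := shift_path (at_time (fine (tau l u x))) (Y x).

Let ev_shifted0 l u x : ev (shifted l u x) 0 = ev (Y x) (fine (tau l u x)).
Proof. by rewrite ev_shift// addr0 at_timeK// fine_ge0// exit_time_ge0. Qed.

Let measurable_shifted l u :
  measurable_fun setT (shifted l u : Omega -> borel_cpath R).
Proof.
apply: measurable_path => s.
have -> : (fun x => ev (shifted l u x) s) =
    (fun x => ev (Y x) (fine (tau l u x) + Num.max 0 s)).
  have tau0 x : 0 <= fine (tau l u x) by rewrite fine_ge0// exit_time_ge0.
  apply/funext => x; have [s0|s0] := leP 0 s; first by rewrite ev_shift// at_timeK.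
  by rewrite (ev_neg _ (ltW s0)) ev_shift// at_timeK.
apply: measurable_ev_at; first exact: measurable_ev_diffusion.
apply: measurable_funD => //; apply: measurableT_comp => //.
exact: measurable_exit.
Qed.

(** Given the exit point, the path after the exit is independent of the exit
    time.  The strong Markov property is applied to the paths of [B] that start at
    [z]: the kernel then vanishes unless the exit point is [z], so that no
    information on the exit point has to be put into the past. *)
Let strong_markov_exit l u y z D B : measurable D -> measurable B ->
  P y (exited l u D `&` [set x | ev (Y x) (fine (tau l u x)) = z] `&`
       [set x | B (shifted l u x)]) =
  (P y (exited l u D `&` [set x | ev (Y x) (fine (tau l u x)) = z]) *
   P z (Y @^-1` B))%E.
Proof.
move=> mD mB.
have mE : measurable [set x | ev (Y x) (fine (tau l u x)) = z].
  apply: measurable_ev_eq; apply: measurableT_comp => //; exact: measurable_exit.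
have mB0 : measurable (B `&` [set w : borel_cpath R | ev w 0 = z]).
  apply: measurableI => //.
  have := @measurable_ev R 0 measurableT [set z] (measurable_set1 z).
  by rewrite setTI.
have := diffusion_strong_markov Y_diffusion (exit_stopping_time l u)
  (exited_stopped l u mD) y mB0.
have -> : exited l u D `&` [set x | (tau l u x < +oo)%E] = exited l u D.
  by apply/seteqP; split => x [] //= []; split.
rewrite (_ : _ `&` _ = exited l u D `&`
    [set x | ev (Y x) (fine (tau l u x)) = z] `&` [set x | B (shifted l u x)]); last first.
  apply/seteqP; split => x [].
    move=> Dx [Bx zx]; split => //; split => //=.
    by rewrite -ev_shifted0; exact: zx.
  move=> [Dx zx] Bx; split => //; split => //.
  by rewrite /= -ev_shifted0 in zx; exact: zx.
move=> ->.
pose c := P z (Y @^-1` B).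
have c0 : (0 <= c)%E by exact: measure_ge0.
rewrite (eq_integral (fun x => c * (\1_[set x | ev (Y x) (fine (tau l u x)) = z] x)%:E)%E); last first.
  move=> x _; have [zx|zx] := pselect (ev (Y x) (fine (tau l u x)) = z).
    rewrite indicE mem_set// mule1.
    have -> : path_at (Y x) (stopped_at (tau l u) x) = z by [].
    apply: (probability_eq_on _ _ _ (diffusion_start0 z)).
    - exact: measurable_diffusion_event.
    - exact: measurable_diffusion_event.
    - by have := @measurable_ev_eq (cst 0) z; apply; exact: measurable_cst.
    - by apply/seteqP; split => x' /=; [move=> [[]]|move=> []].
  rewrite indicE memNset// mule0.
  set z' := path_at _ _; have z'z : z' <> z by [].
  have mz' : measurable [set x | ev (Y x) 0 = z'].
    by have := @measurable_ev_eq (cst 0) z'; apply; exact: measurable_cst.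
  rewrite (@probability_eq_on _ _ _ (P z') _ set0 _ _ _ mz' (diffusion_start0 z')) ?measure0//.
    exact: measurable_diffusion_event.
  rewrite set0I; apply/seteqP; split => // x' /= [[_ xz] xz'].
  by apply: z'z; rewrite -xz' -xz.
have mDx := measurable_exited l u mD.
rewrite ge0_integralZl//; last first.
  by apply/measurable_EFinP; exact: measurable_indic.
by rewrite integral_indic// muleC setIC.
Qed.

Section one_step.
Variables (a : R -> R) (y : R).
Hypotheses (ma : measurable_fun setT a) (ay0 : 0 < a y).
Let l := y - a y.
Let u := y + a y.
Hypothesis exit_lty : P y [set x | (exit_time l u (Y x) < +oo)%E] = 1%E.

Let good := [set x | ev (Y x) 0 = y] `&` [set x | (tau l u x < +oo)%E].

Let mstart : measurable [set x | ev (Y x) 0 = y].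
Proof. by have := @measurable_ev_eq (cst 0) y; apply; exact: measurable_cst. Qed.

Let mfin : measurable [set x | (tau l u x < +oo)%E].
Proof.
rewrite -[X in measurable X]setTI; apply: emeasurable_fun_infty_o => //.
exact: measurable_exit.
Qed.

Let mgood : measurable good. Proof. exact: measurableI. Qed.

Let good1 : P y good = 1%E.
Proof. by rewrite /good setIC probability_setI1// diffusion_start0. Qed.

Let good_step x : good x -> step_time a (Y x) = fine (tau l u x).
Proof. by move=> [/= x0 _]; rewrite /step_time x0. Qed.

Let good_next x : good x -> next a (Y x) = shifted l u x.
Proof. by move=> gx; rewrite /next good_step. Qed.

Lemma measurable_step_diffusion : measurable_fun setT (fun x => step_time a (Y x)).
Proof. exact: (measurableT_comp (measurable_step_time ma) measurable_diffusion). Qed.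

Lemma measurable_next_diffusion :
  measurable_fun setT (fun x => next a (Y x) : borel_cpath R).
Proof. exact: (measurableT_comp (measurable_next ma) measurable_diffusion). Qed.

Lemma measurable_next_at z : measurable [set x | ev (next a (Y x)) 0 = z].
Proof.
have := measurableT_comp (@measurable_ev R 0) measurable_next_diffusion.
by move=> /(_ measurableT [set z] (measurable_set1 z)); rewrite setTI.
Qed.

(** The same for the step of the walk that starts at [y]; the two descriptions
    agree on the event that [Y] starts at [y] and exits in finite time. *)
Lemma step_markov z D B : measurable D -> measurable B ->
  P y ((fun x => step_time a (Y x)) @^-1` D `&` [set x | ev (next a (Y x)) 0 = z]
       `&` (fun x => next a (Y x)) @^-1` B) =
  (P y ((fun x => step_time a (Y x)) @^-1` D `&` [set x | ev (next a (Y x)) 0 = z])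
   * P z (Y @^-1` B))%E.
Proof.
move=> mD mB.
have mE : measurable [set x | ev (Y x) (fine (tau l u x)) = z].
  apply: measurable_ev_eq; apply: measurableT_comp => //; exact: measurable_exit.
have mSD : measurable ((fun x => step_time a (Y x)) @^-1` D).
  by rewrite -[X in measurable X]setTI; exact: measurable_step_diffusion.
have mNB : measurable ((fun x => next a (Y x)) @^-1` B).
  by rewrite -[X in measurable X]setTI; exact: measurable_next_diffusion.
have mSB : measurable [set x | B (shifted l u x)].
  by rewrite -[X in measurable X]setTI; exact: measurable_shifted.
have mexD := measurable_exited l u mD.
have mz := measurable_next_at z.
have E1 : (fun x => step_time a (Y x)) @^-1` D `&`
    [set x | ev (next a (Y x)) 0 = z] `&` good =
    exited l u D `&` [set x | ev (Y x) (fine (tau l u x)) = z] `&` good.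
  apply/seteqP; split => x [[Dx zx] gx]; have gs := good_step gx;
    have gn := good_next gx; split => //.
    split; last by rewrite /= -ev_shifted0 -gn; exact: zx.
    by split; [case: gx|rewrite -gs; exact: Dx].
  case: Dx => _ Dx; split; first by rewrite /preimage/= gs; exact: Dx.
  by rewrite /= gn ev_shifted0; exact: zx.
rewrite (probability_eq_on _ _ mgood good1 E1); [|exact: measurableI..].
rewrite -strong_markov_exit//; apply: (probability_eq_on _ _ mgood good1).
- by apply: measurableI => //; exact: measurableI.
- by apply: measurableI => //; exact: measurableI.
rewrite setIAC E1; apply/seteqP; split => x [[Ex]].
  move=> gx Bx; split => //; split => //=.
  by rewrite -good_next//; exact: Bx.
move=> Bx gx; split => //.
by rewrite /= -good_next in Bx; last exact: gx.
Qed.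

Lemma step_up : natural_scale P Y -> P y [set x | ev (next a (Y x)) 0 = u] = 2^-1%:E.
Proof.
move=> ns; have lyu : l < y < u by rewrite /l /u ltrDl ltrBlDr ltrDl ay0.
have -> : 2^-1%:E = ((y - l) / (u - l))%:E :> \bar R.
  have -> : u - l = 2 * a y by rewrite /u /l; ring.
  have -> : y - l = a y by rewrite /l; ring.
  by congr (_%:E); field; rewrite gt_eqF.
rewrite -(ns _ _ _ lyu).
have lu : l != u by rewrite lt_eqF//; case/andP: lyu; exact: lt_trans.
apply: (probability_eq_on _ _ mgood good1); first exact: measurable_next_at.
  rewrite -[X in measurable X]setTI; apply: emeasurable_fun_lt => //.
    by apply: measurable_hitting_time; [exact: measurable_ev_diffusion|exact: measurable_cst].
  by apply: measurable_hitting_time; [exact: measurable_ev_diffusion|exact: measurable_cst].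
apply/seteqP; split => x [H gx]; split => //; move: H;
  have /fineK tauE : tau l u x \is a fin_num.
- by rewrite ge0_fin_numE ?exit_time_ge0//; case: gx.
- have [_] := exit_time_at (esym tauE); rewrite /= good_next// ev_shifted0.
  case: ifPn => // _ -> /eqP; by rewrite (negbTE lu).
- by rewrite ge0_fin_numE ?exit_time_ge0//; case: gx.
- have [_] := exit_time_at (esym tauE); rewrite /= good_next// ev_shifted0.
  by move=> + xlu; rewrite xlu.
Qed.

(** Natural scale gives the probability of the upper exit only; the lower one
    follows because the exit is almost surely finite. *)
Lemma step_down : natural_scale P Y -> P y [set x | ev (next a (Y x)) 0 = l] = 2^-1%:E.
Proof.
move=> ns; have mu := measurable_next_at u.
have lu : l < u by rewrite /l /u ltrBlDr -addrA ltrDl addr_gt0.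
transitivity (P y (~` [set x | ev (next a (Y x)) 0 = u])).
  apply: (probability_eq_on _ _ mgood good1); first exact: measurable_next_at.
    exact: measurableC.
  apply/seteqP; split => x [H gx]; split => //; move: H => /=.
    by move=> -> /eqP; rewrite (lt_eqF lu).
  rewrite good_next// ev_shifted0.
  have /fineK tauE : tau l u x \is a fin_num.
    by rewrite ge0_fin_numE ?exit_time_ge0//; case: gx.
  by have [_] := exit_time_at (esym tauE); case: ifPn.
rewrite probability_setC// step_up//.
have -> : 1%E = (2^-1 + 2^-1 : R)%:E by congr (_%:E); lra.
by rewrite EFinD addeK.
Qed.

Lemma integral_step_time :
  (\int[P y]_x (step_time a (Y x))%:E = \int[P y]_x exit_time l u (Y x))%E.
Proof.
have good0 : P y (~` good) = 0%E by rewrite probability_setC// good1 subee.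
apply: ge0_ae_eq_integral => //.
- by apply/measurable_EFinP; exact: measurable_step_diffusion.
- exact: measurable_exit.
- by move=> x _; rewrite lee_fin step_time_ge0.
- by move=> x _; exact: exit_time_ge0.
exists (~` good); split; first exact: measurableC.
  exact: good0.
move=> x; apply: contra_not => gx _; rewrite good_step// fineK//.
by rewrite ge0_fin_numE ?exit_time_ge0//; case: gx.
Qed.

Lemma step_markov_event z B : natural_scale P Y -> measurable B ->
  z = u \/ z = l -> (forall w, B w -> ev w 0 = z) ->
  P y ((fun x => next a (Y x)) @^-1` B) = (2^-1%:E * P z (Y @^-1` B))%E.
Proof.
move=> ns mB zul Bz; have := @step_markov z setT B measurableT mB.
rewrite preimage_setT setTI.
have -> : P y [set x | ev (next a (Y x)) 0 = z] = 2^-1%:E.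
  by case: zul => ->; [exact: step_up|exact: step_down].
by move=> <-; congr (P y _); apply/seteqP; split => x /= => [/[dup] /Bz|[]].
Qed.

Let YB : {mfun Omega >-> borel_cpath R} :=
  HB.pack (Y : Omega -> borel_cpath R) (isMeasurableFun.Build _ _ _ _ _ measurable_diffusion).

Local Open Scope ereal_scope.

(** The form in which the Markov property is iterated: a bound for the
    remaining walk that is uniform in its starting point factors out.
    Splitting along the two possible exit points reduces the claim to
    independence for each of them. *)
Lemma step_integral_le (phi : R -> \bar R) (psi : borel_cpath R -> \bar R) M :
  natural_scale P Y ->
  measurable_fun setT phi -> measurable_fun setT psi ->
  (forall s, 0 <= phi s) -> (forall w, 0 <= psi w) ->
  (forall z, \int[P z]_x psi (Y x) <= M) ->
  \int[P y]_x (phi (step_time a (Y x)) * psi (next a (Y x))) <=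
  (\int[P y]_x phi (step_time a (Y x))) * M.
Proof.
move=> ns mphi mpsi phi0 psi0 psiM.
have mS := measurable_step_diffusion; have mN := measurable_next_diffusion.
have mphiS : measurable_fun setT (fun x => phi (step_time a (Y x))).
  exact: (measurableT_comp mphi mS).
have mpsiN : measurable_fun setT (fun x => psi (next a (Y x))).
  exact: (measurableT_comp mpsi mN).
have mphipsi : measurable_fun setT
  (fun x => phi (step_time a (Y x)) * psi (next a (Y x))).
  exact: emeasurable_funM.
pose N z := [set x | ev (next a (Y x)) 0 = z].
have mNz z : measurable (N z) := measurable_next_at z.
have le z : \int[P y]_(x in N z) (phi (step_time a (Y x)) * psi (next a (Y x))) <=
    (\int[P y]_(x in N z) phi (step_time a (Y x))) * M.
  rewrite -(ge0_integral_mrestr (P y) (mNz z))//; last by move=> x; exact: mule_ge0.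
  rewrite -(ge0_integral_mrestr (P y) (mNz z))//.
  rewrite (@ge0_integral_indep _ _ _ _ _ _ _ (mrestr (P y) (mNz z))
    (distribution (P z) YB) _ _ mS mN)//; last first.
    move=> A B mA mB; rewrite /= /mrestr setIAC.
    exact: step_markov.
  apply: lee_wpmul2l; first exact: integral_ge0.
  by rewrite ge0_integral_pushforward//; exact: psiM.
have NE f : measurable_fun setT f -> (forall x, 0 <= f x) ->
    \int[P y]_x f x = \int[P y]_(x in N u) f x + \int[P y]_(x in N l) f x.
  move=> mf f0.
  have lu : (l < u)%R by rewrite /l /u ltrBlDr -addrA ltrDl addr_gt0.
  have dNul : [disjoint N u & N l].
    apply/disj_setPS => x [xu xl]; move: lu; rewrite -[u]xu -[l]xl.
    by rewrite ltxx.
  rewrite -ge0_integral_setU//; [|exact: measurable_funTS].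
  have N0 : P y (~` (N u `|` N l)) = 0.
    have PU : P y (N u `|` N l) = P y (N u) + P y (N l).
      by apply: measureU => //; exact/disj_set2P.
    have PNu : P y (N u) = 2^-1%:E by exact: step_up.
    have PNl : P y (N l) = 2^-1%:E by exact: step_down.
    have PU1 : P y (N u `|` N l) = 1.
      by rewrite PU PNu PNl -EFinD; congr (_%:E); lra.
    rewrite probability_setC; last exact: measurableU.
    by rewrite [X in (1 - X)%E]PU1 subee.
  rewrite (ge0_negligible_integral _ measurableT mf _ N0)//; last first.
    by apply: measurableC; exact: measurableU.
  by rewrite setTD setCK.
rewrite NE//; last by move=> x; exact: mule_ge0.
rewrite [leRHS](_ : _ = (\int[P y]_(x in N u) phi (step_time a (Y x))) * M +
    (\int[P y]_(x in N l) phi (step_time a (Y x))) * M); last first.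
  by rewrite NE// ge0_muleDl//; exact: integral_ge0.
exact: leeD.
Qed.

End one_step.

(** * The second moment of an exit time *)
Section exit_tail.
Local Open Scope ereal_scope.
Variables (l u c : R).
Hypotheses (c0 : (0 < c)%R)
  (exit_le : forall z, (l <= z <= u)%R ->
     \int[P z]_x exit_time l u (Y x) <= (c / 2)%:E).

Let measurable_exit_gt (s : R) : measurable [set x | s%:E < tau l u x].
Proof.
rewrite -[X in measurable X]setTI; apply: emeasurable_fun_o_infty => //.
exact: measurable_exit.
Qed.

(** Markov's inequality. *)
Let exit_gt_half z : (l <= z <= u)%R -> P z [set x | c%:E < tau l u x] <= 2^-1%:E.
Proof.
move=> zlu; have := exit_le zlu.
have : c%:E * P z [set x | c%:E < tau l u x] <= \int[P z]_x exit_time l u (Y x).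
  apply: ge0_markov => //; first exact: measurable_exit.
  - by move=> x; exact: exit_time_ge0.
  - exact: ltW.
  - by move=> x /ltW.
move=> /le_trans /[apply].
have /fineK <- : P z [set x | c%:E < tau l u x] \is a fin_num.
  exact: fin_num_measure.
by rewrite -EFinM !lee_fin ler_pM2l.
Qed.

(** Before the exit the path is still inside the interval, from where each
    further period of length [c] has conditional probability at least 1/2 to
    contain the exit. *)
Lemma exit_tail z (k : nat) : (l <= z <= u)%R ->
  P z [set x | (k%:R * c)%:E < tau l u x] <= (2^-1 ^+ k)%:E.
Proof.
elim: k z => [|k IH] z zlu; first by rewrite expr0 probability_le1.
have mY0 : measurable [set x | ev (Y x) 0 = z].
  by have := @measurable_ev_eq (cst 0%R) z; apply; exact: measurable_cst.
pose A := [set x | c%:E < tau l u x] `&` [set x | ev (Y x) 0 = z].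
pose ct := at_time c.
have ctc : seconds ct = c by rewrite at_timeK// ltW.
have FA : F ct A.
  rewrite -mFt; apply: measurableI.
    rewrite (_ : [set _ | _] = ~` [set x | tau l u x <= c%:E]).
      by apply: measurableC; rewrite mFt; apply: exit_le_F; rewrite ctc.
    by apply/seteqP; split => x /=; rewrite ltNge => /negP.
  have := @measurable_ev_F ct 0%R; rewrite ctc => /(_ (ltW c0)).
  by move=> /(_ measurableT [set z] (measurable_set1 z)); rewrite setTI.
have mA : measurable A by exact: measurableI.
have cst_stop : is_stopping_time F (cst c%:E).
  split=> [w|t]; first by rewrite lee_fin ltW.
  rewrite -mFt; have [ct'|ct'] := boolP (c%:E <= (seconds t)%:E).
    by rewrite (_ : [set _ | _] = setT)//; apply/seteqP; split.
  by rewrite (_ : [set _ | _] = set0)//; apply/seteqP; split => // x /= H.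
have Astop : stopped_sigma_algebra F (cst c%:E) A.
  split=> // t; have [ct'|ct'] := boolP (c%:E <= (seconds t)%:E).
    rewrite (_ : _ `&` _ = A); last by apply/seteqP; split => x [].
    have [_ _ Fmon] := diffusion_filtration Y_diffusion.
    by apply: (Fmon ct) => //; rewrite ctc.
  rewrite (_ : _ `&` _ = set0); last first.
    by apply/seteqP; split => // x /= [_ H]; move/negP : ct'; apply.
  by rewrite -mFt.
pose B : set (borel_cpath R) := [set w | (k%:R * c)%:E < exit_time l u w].
have mB : measurable B.
  rewrite -[X in measurable X]setTI; apply: emeasurable_fun_o_infty => //.
  by apply: (@measurable_exit_time _ _ (borel_cpath R) id) => //; exact: measurable_ev.
have := diffusion_strong_markov Y_diffusion cst_stop Astop z mB.
rewrite (_ : A `&` [set x | cst c%:E x < +oo] = A); last first.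
  by apply/seteqP; split => x []//; split => //=; rewrite ltry.
have mkc := measurable_exit_gt (k.+1%:R * c).
have -> : [set x | B (shift_path (stopped_at (cst c%:E) x) (Y x))] =
          (fun x => shift_path ct (Y x)) @^-1` B by [].
have msB : measurable ((fun x => shift_path ct (Y x)) @^-1` B).
  rewrite -[X in measurable X]setTI.
  have : measurable_fun setT (fun x => shift_path ct (Y x) : borel_cpath R).
    apply: measurable_path => s.
    have -> : (fun x => ev (shift_path ct (Y x)) s) =
        (fun x => ev (Y x) (c + Num.max 0 s))%R.
      apply/funext => x; have [s0|s0] := leP 0%R s; first by rewrite ev_shift// ctc.
      by rewrite (ev_neg _ (ltW s0)) ev_shift// ctc.
    exact: measurable_ev_diffusion.
  by move=> /(_ measurableT B mB).
have le1 : P z [set x | (k.+1%:R * c)%:E < tau l u x] <=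
    P z (A `&` (fun x => shift_path ct (Y x)) @^-1` B).
  apply: (probability_ge_le _ _ mY0 (diffusion_start0 z)) => //.
    exact: measurableI.
  move=> x [/= kx x0]; split; [split => //|] => /=.
    apply: le_lt_trans kx; rewrite lee_fin -[leLHS]mul1r ler_wpM2r ?(ltW c0)//.
    by rewrite ler1n.
  apply: exit_time_shift; first by rewrite mulr_ge0// ltW.
  by rewrite ctc -[X in (X + _)%R]mul1r -mulrDl nat1r.
move=> E; apply: (le_trans le1); rewrite [leLHS]E.
apply: (@le_trans _ _ (\int[P z]_(x in A) (2^-1 ^+ k)%:E)).
  apply: ge0_le_integral => //.
  - apply: measurable_funTS.
    have := measurableT_comp (diffusion_kernel Y_diffusion mB) (measurable_ev_diffusion c).
    by [].
  - move=> x [/= cx x0]; apply: IH.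
    have /andP[? ?] : (l < ev (Y x) c < u)%R.
      by apply: exit_time_inside => //; rewrite ?x0// ltW.
    by rewrite !ltW.
rewrite integral_cst//= exprSr EFinM; apply: lee_wpmul2l.
  by rewrite lee_fin exprn_ge0// invr_ge0.
apply: le_trans (exit_gt_half zlu).
by apply: le_measure; rewrite ?inE//; apply: subIsetl.
Qed.

Let geometric_weight_sum (N : nat) :
  (\sum_(0 <= k < N) (2 * k%:R + 3) * 2^-1 ^+ k <= 10 :> R)%R.
Proof.
have -> : (\sum_(0 <= k < N) (2 * k%:R + 3) * 2^-1 ^+ k =
    10 - (4 * N%:R + 10) * 2^-1 ^+ N :> R)%R.
  elim: N => [|N IH]; first by rewrite big_geq// expr0; lra.
  by rewrite big_nat_recr//= IH exprS -natr1; lra.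
by rewrite gerBl mulr_ge0// ?exprn_ge0// addr_ge0// mulr_ge0.
Qed.

Let sum_odd (n : nat) :
  (\sum_(0 <= k < n) (2 * k%:R + 3) = n%:R * (n%:R + 2) :> R)%R.
Proof.
elim: n => [|n IH]; first by rewrite big_geq// mul0r.
by rewrite big_nat_recr//= IH -natr1; ring.
Qed.

Lemma exit_second_moment z : (l <= z <= u)%R ->
  \int[P z]_x ((fine (exit_time l u (Y x))) ^+ 2)%:E <= (11 * c ^+ 2)%:E.
Proof.
move=> zlu; pose A (k : nat) := [set x | (k%:R * c)%:E < tau l u x].
pose w (k : nat) : \bar R := ((2 * k%:R + 3) * c ^+ 2)%:E.
have w0 k : 0 <= w k.
  by rewrite lee_fin mulr_ge0 ?sqr_ge0// addr_ge0// mulr_ge0.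
have mIA k : measurable_fun setT (fun x => (\1_(A k) x)%:E : \bar R).
  by apply/measurable_EFinP; apply: measurable_indic; exact: measurable_exit_gt.
pose f k x := w k * (\1_(A k) x)%:E.
have mf k : measurable_fun setT (f k) by exact: emeasurable_funM.
have f0 k x : 0 <= f k x by rewrite mule_ge0// lee_fin.
have c20 : (0 <= c ^+ 2)%R by exact: sqr_ge0.
have sum0 x : 0 <= \sum_(k <oo) f k x by exact: nneseries_ge0.
have msum : measurable_fun setT (fun x => \sum_(k <oo) f k x).
  exact: ge0_emeasurable_sum.
apply: (@le_trans _ _ (\int[P z]_x ((c ^+ 2)%:E + \sum_(k <oo) f k x))).
  apply: ge0_le_integral => //.
  - by move=> x _; rewrite lee_fin sqr_ge0.
  - apply/measurable_EFinP; apply: measurable_funX.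
    by apply: measurableT_comp => //; exact: measurable_exit.
  - exact: emeasurable_funD.
  (* With j the integer part of s / c, the first j terms of the series are all
     present and sum up to (j ^ 2 + 2 j) c ^ 2, so that adding c ^ 2 gives at
     least s ^ 2.  An infinite exit time is counted as 0 by [fine]. *)
  move=> x _; set s := fine _.
  have [tauoo|taufin] := eqVneq (tau l u x) +oo.
    by rewrite /s -/(tau l u x) tauoo expr0n/= adde_ge0.
  have tauE : tau l u x = s%:E.
    by rewrite fineK// ge0_fin_numE ?exit_time_ge0// lt_neqAle taufin leey.
  have s0 : (0 <= s)%R by rewrite fine_ge0// exit_time_ge0.
  have sc0 : (0 <= s / c)%R by rewrite divr_ge0// ltW.
  pose j := Num.truncn (s / c).
  have js : (j%:R * c <= s)%R by rewrite -ler_pdivlMr// truncn_le.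
  have sj : (s < (j%:R + 1) * c)%R by rewrite -ltr_pdivrMr// natr1 truncnS_gt.
  apply: (@le_trans _ _ ((c ^+ 2)%:E + \sum_(0 <= k < j) f k x)); last first.
    by apply: leeD => //; exact: nneseries_lim_ge.
  rewrite (eq_big_nat _ _ (F2 := w)); last first.
    move=> k /andP[_ kj]; rewrite /f indicE mem_set ?mule1// /A /= tauE lte_fin.
    by apply: lt_le_trans js; rewrite ltr_pM2r// ltr_nat.
  rewrite sumEFin -mulr_suml sum_odd -EFinD lee_fin.
  have j0 : (0 <= j%:R :> R)%R by [].
  by nra.
rewrite ge0_integralD//= integral_cst//= probability_setT mule1.
rewrite integral_nneseries//.
have -> : (11 * c ^+ 2)%:E = (c ^+ 2)%:E + (10 * c ^+ 2)%:E :> \bar R.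
  by rewrite -EFinD; congr (_%:E); ring.
apply: leeD => //; apply: lime_le.
  by apply: is_cvg_nneseries => k _ _; exact: integral_ge0.
apply: nearW => N.
apply: (@le_trans _ _ (\sum_(0 <= k < N) ((2 * k%:R + 3) * 2^-1 ^+ k * c ^+ 2)%:E)).
  apply: lee_sum => k _; rewrite /f ge0_integralZl// integral_indic//; last first.
    exact: measurable_exit_gt.
  rewrite setIT mulrAC EFinM; apply: lee_wpmul2l => //.
  exact: exit_tail.
by rewrite sumEFin -mulr_suml lee_fin ler_wpM2r// geometric_weight_sum.
Qed.

End exit_tail.

End diffusion_steps.

(** * The time scale of the embedded walk *)
Section almost_sure_exit.
Context d (T : measurableType d) {R : realType} (P : probability T R).

Lemma probability_lty (f : T -> \bar R) : measurable_fun setT f ->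
  (forall x, 0 <= f x)%E -> (\int[P]_x f x < +oo)%E ->
  P [set x | (f x < +oo)%E] = 1%E.
Proof.
move=> mf f0 foo.
have fi : P.-integrable setT f.
  by apply/integrableP; split => //; under eq_integral do rewrite gee0_abs//.
have [N [mN N0 subN]] := integrable_ae measurableT fi.
have mA : measurable [set x | (f x < +oo)%E].
  by rewrite -[X in measurable X]setTI; exact: emeasurable_fun_infty_o.
rewrite -[X in P X]setCK probability_setC; last exact: measurableC.
suff -> : P (~` [set x | (f x < +oo)%E]) = 0%E by rewrite sube0.
apply/eqP; rewrite eq_le measure_ge0 andbT -[leRHS]N0.
apply: le_measure; rewrite ?inE//; first exact: measurableC.
by move=> x fx; apply: subN => /(_ I); rewrite ge0_fin_numE.
Qed.

End almost_sure_exit.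

Section exp_bound.
Context {R : realType}.
Lemma expRN_le (x : R) : 0 <= x -> expR (- x) <= 1 - x + x ^+ 2.
Proof.
move=> x0; rewrite expRN.
have x1 : 0 < 1 + x by rewrite ltr_wpDr.
apply: (@le_trans _ _ (1 + x)^-1).
  by rewrite lef_pV2 ?posrE ?expR_gt0// expR_ge1Dx.
rewrite -[leLHS]mul1r ler_pdivrMr//.
have : 0 <= x ^+ 3 by rewrite exprn_ge0.
by rewrite !exprS expr0; nra.
Qed.
End exp_bound.

Section embedded_walk.
Context {R : realType} d (Omega : measurableType d).
Variables (F : time R -> set (set Omega)) (P : R -> probability Omega R)
  (Y : Omega -> cpath R).
Hypothesis Y_diffusion : regular_diffusion F P Y.
Hypothesis Y_natural_scale : natural_scale P Y.

(** What the limit theorem needs to know about a scale: the mean duration of a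
    step is [h] up to the relative error [e], from any starting point, and the mean
    exit time from inside the interval is of the same order, which controls the
    second moment. *)
Record approx_scale (a : R -> R) (h e : R) : Prop := ApproxScale {
  approx_scale_measurable : measurable_fun setT a ;
  approx_scale_gt0 : forall y, 0 < a y ;
  approx_scale_ge : forall y, (((1 - e) * h)%:E <=
    \int[P y]_x exit_time (y - a y) (y + a y) (Y x))%E ;
  approx_scale_le : forall y, (\int[P y]_x exit_time (y - a y) (y + a y) (Y x) <=
    ((1 + e) * h)%:E)%E ;
  approx_scale_inside : forall y z, y - a y <= z <= y + a y ->
    (\int[P z]_x exit_time (y - a y) (y + a y) (Y x) <= (4 * h)%:E)%E }.

Section fixed_scale.
Variables (a : R -> R) (h e : R).
Hypotheses (h0 : 0 < h) (e0 : 0 <= e) (ah : approx_scale a h e).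

Let ma := approx_scale_measurable ah.
Let a0 := approx_scale_gt0 ah.

Lemma approx_scale_exit_lty y : P y [set x | (exit_time (y - a y) (y + a y) (Y x) < +oo)%E] = 1%E.
Proof.
apply: probability_lty; first exact: (measurable_exit Y_diffusion).
  by move=> x; exact: exit_time_ge0.
exact: le_lt_trans (approx_scale_le ah y) (ltry _).
Qed.

Let exit_lty := approx_scale_exit_lty.

Let mS := @measurable_step_diffusion _ _ _ _ _ _ Y_diffusion _ ma.

Let mtau k : measurable_fun setT (fun x => embed_time a k (Y x)).
Proof.
exact: (measurableT_comp (measurable_embed_time ma k) (measurable_diffusion Y_diffusion)).
Qed.

Let mtau_next k : measurable_fun setT (fun x => embed_time a k (next a (Y x))).
Proof.
exact: (measurableT_comp (measurable_embed_time ma k)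
  (measurable_next_diffusion Y_diffusion ma)).
Qed.

Local Open Scope ereal_scope.

Lemma embed_time_mean k y :
  \int[P y]_x (embed_time a k (Y x))%:E <= (k%:R * ((1 + e) * h))%:E.
Proof.
elim: k y => [|k IH] y.
  rewrite mul0r (eq_integral (cst 0)) ?integral0// => x _.
  by rewrite /embed_time big_geq.
rewrite (eq_integral (fun x => (step_time a (Y x))%:E +
    (embed_time a k (next a (Y x)))%:E)); last first.
  by move=> x _; rewrite embed_timeS EFinD.
rewrite ge0_integralD//; first last.
- exact/measurable_EFinP.
- by move=> x _; rewrite lee_fin embed_time_ge0.
- exact/measurable_EFinP.
- by move=> x _; rewrite lee_fin step_time_ge0.
rewrite (integral_step_time Y_diffusion ma)//.
rewrite -nat1r mulrDl mul1r EFinD; apply: leeD; first exact: approx_scale_le ah y.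
have := @step_integral_le _ _ _ _ _ _ Y_diffusion a y ma (a0 y) (exit_lty y)
  (cst 1) (fun w => (embed_time a k w)%:E) (k%:R * ((1 + e) * h))%:E Y_natural_scale.
rewrite integral_cst//= probability_setT mule1 mul1e.
under eq_integral do rewrite mul1e.
apply => //.
- by apply/measurable_EFinP; exact: measurable_embed_time.
- by move=> w; rewrite lee_fin embed_time_ge0.
Qed.

(** By [exit_second_moment] with c = 8 h, twice the bound on the mean exit times
    from inside the interval. *)
Lemma step_second_moment y :
  \int[P y]_x ((step_time a (Y x)) ^+ 2)%:E <= ((11 * 8 ^+ 2) * h ^+ 2)%:E.
Proof.
have c0 : (0 < 8 * h)%R by rewrite mulr_gt0.
rewrite (ge0_ae_eq_integral (g := fun x =>
    ((fine (exit_time (y - a y) (y + a y) (Y x))) ^+ 2)%:E))//.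
- have := @exit_second_moment _ _ _ _ _ _ Y_diffusion (y - a y)%R (y + a y)%R _ c0.
  move=> /(_ _ y) H; apply: le_trans (H _ _) _.
  + move=> z zy; have -> : (8 * h / 2 = 4 * h)%R by lra.
    exact: approx_scale_inside ah y z zy.
  + by rewrite lerBlDr lerDl ltW//=.
  + by rewrite lee_fin; nra.
- by apply/measurable_EFinP; apply: measurable_funX.
- apply/measurable_EFinP; apply: measurable_funX; apply: measurableT_comp => //.
  exact: (measurable_exit Y_diffusion).
- by move=> x _; rewrite lee_fin sqr_ge0.
- by move=> x _; rewrite lee_fin sqr_ge0.
have mstart : measurable [set x | ev (Y x) 0%R = y].
  by have := measurable_ev_eq Y_diffusion (s := cst 0%R) y; apply; exact: measurable_cst.
exists (~` [set x | ev (Y x) 0%R = y]); split; first exact: measurableC.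
  transitivity (1 - P y [set x | ev (Y x) 0%R = y]).
    exact: probability_setC.
  by rewrite (diffusion_start0 Y_diffusion) subee.
by move=> x; apply: contra_not => /= x0 _; rewrite /step_time x0.
Qed.

(** Second order expansion of the Laplace transform at 0: the mean is at least
    (1 - e) h, and the remainder is controlled by the second moment. *)
Lemma step_laplace (lam : R) y : (0 <= lam)%R ->
  \int[P y]_x (expR (- (lam * step_time a (Y x))))%:E <=
  (expR ((11 * 8 ^+ 2) * (lam * h) ^+ 2 - (1 - e) * (lam * h)))%:E.
Proof.
move=> lam0.
pose E x := (expR (- (lam * step_time a (Y x))))%:E : \bar R.
pose S x := (step_time a (Y x))%:E : \bar R.
pose S2 x := ((step_time a (Y x)) ^+ 2)%:E : \bar R.
have mE : measurable_fun setT E.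
  apply/measurable_EFinP; apply: measurableT_comp => //.
  by apply: measurableT_comp => //; apply: measurable_funM.
have mS1 : measurable_fun setT S by exact/measurable_EFinP.
have mlS : measurable_fun setT (fun x => lam%:E * S x) by exact: emeasurable_funM.
have mS2 : measurable_fun setT S2.
  by apply/measurable_EFinP; apply: measurable_funX.
have mlS2 : measurable_fun setT (fun x => (lam ^+ 2)%:E * S2 x).
  exact: emeasurable_funM.
have E0 x : 0 <= E x by rewrite lee_fin expR_ge0.
have S0 x : 0 <= S x by rewrite lee_fin step_time_ge0.
have S20 x : 0 <= S2 x by rewrite lee_fin sqr_ge0.
have lS0 x : 0 <= lam%:E * S x by rewrite mule_ge0.
have lS20 x : 0 <= (lam ^+ 2)%:E * S2 x by rewrite mule_ge0// lee_fin sqr_ge0.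
have sum_le : \int[P y]_x E x + lam%:E * \int[P y]_x S x <=
    1 + (lam ^+ 2)%:E * \int[P y]_x S2 x.
  rewrite -ge0_integralZl// -ge0_integralD//.
  rewrite -ge0_integralZl//; last by rewrite lee_fin sqr_ge0.
  rewrite -[X in _ <= X + _](_ : \int[P y]_x (cst 1 x) = 1); last first.
    by rewrite integral_cst//= probability_setT mule1.
  rewrite -ge0_integralD//.
  apply: ge0_le_integral => //.
  - by move=> x _; rewrite adde_ge0.
  - exact: emeasurable_funD.
  - exact: emeasurable_funD.
  move=> x _; rewrite /E /S /S2 -!EFinM -!EFinD lee_fin.
  have := @expRN_le _ (lam * step_time a (Y x))%R.
  rewrite mulr_ge0 ?step_time_ge0// => /(_ isT).
  by rewrite exprMn; lra.
have Sge : ((1 - e) * h)%:E <= \int[P y]_x (step_time a (Y x))%:E.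
  rewrite (integral_step_time Y_diffusion ma)//; exact: approx_scale_ge ah y.
have Sle := step_second_moment y.
apply: (@le_trans _ _ (1 + ((11 * 8 ^+ 2) * (lam * h) ^+ 2 - (1 - e) * (lam * h)))%:E); last first.
  by rewrite lee_fin expR_ge1Dx.
have : \int[P y]_x (expR (- (lam * step_time a (Y x))))%:E + (lam * ((1 - e) * h))%:E <=
    (1 + lam ^+ 2 * ((11 * 8 ^+ 2) * h ^+ 2))%:E.
  apply: (@le_trans _ _ (\int[P y]_x (expR (- (lam * step_time a (Y x))))%:E +
    lam%:E * \int[P y]_x (step_time a (Y x))%:E)).
    by apply: leeD => //; rewrite EFinM; apply: lee_wpmul2l.
  apply: (le_trans sum_le); rewrite EFinD; apply: leeD => //.
  by rewrite [leRHS]EFinM; apply: lee_wpmul2l => //; rewrite lee_fin sqr_ge0.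
rewrite -leeBrDr// => /le_trans; apply.
by rewrite -EFinB lee_fin; lra.
Qed.

Lemma embed_time_laplace (lam : R) k y : (0 <= lam)%R ->
  \int[P y]_x (expR (- (lam * embed_time a k (Y x))))%:E <=
  (expR (k%:R * ((11 * 8 ^+ 2) * (lam * h) ^+ 2 - (1 - e) * (lam * h))))%:E.
Proof.
move=> lam0; elim: k y => [|k IH] y.
  rewrite mul0r expR0 (eq_integral (cst 1)).
    by rewrite integral_cst//= probability_setT mule1.
  by move=> x _; rewrite /embed_time big_geq// mulr0 oppr0 expR0.
rewrite (eq_integral (fun x => (expR (- (lam * step_time a (Y x))))%:E *
    (expR (- (lam * embed_time a k (next a (Y x)))))%:E)); last first.
  by move=> x _; rewrite embed_timeS mulrDr opprD expRD EFinM.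
rewrite -nat1r mulrDl mul1r expRD EFinM.
apply: le_trans (@step_integral_le _ _ _ _ _ _ Y_diffusion a y ma (a0 y) (exit_lty y)
  (fun s => (expR (- (lam * s)))%:E) (fun w => (expR (- (lam * embed_time a k w)))%:E)
  (expR (k%:R * ((11 * 8 ^+ 2) * (lam * h) ^+ 2 - (1 - e) * (lam * h))))%:E Y_natural_scale
  _ _ _ _ IH) _.
- apply/measurable_EFinP; apply: measurableT_comp => //.
  by apply: measurableT_comp => //; apply: measurable_funM.
- apply/measurable_EFinP; apply: measurableT_comp => //.
  apply: measurableT_comp => //; apply: measurable_funM => //.
  exact: measurable_embed_time.
- by move=> s; rewrite lee_fin expR_ge0.
- by move=> w; rewrite lee_fin expR_ge0.
apply: lee_wpmul2r; first by rewrite lee_fin expR_ge0.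
exact: step_laplace.
Qed.

(** Chernoff's bound. *)
Lemma embed_time_lower (lam del : R) k y : (0 <= lam)%R ->
  P y [set x | (embed_time a k (Y x) <= k%:R * h - del)%R] <=
  (expR (- (lam * (del - e * (k%:R * h) - (11 * 8 ^+ 2) * (lam * h) * (k%:R * h)))))%:E.
Proof.
move=> lam0; set A := [set x | _].
have mA : measurable A by exact: measurable_le_set.
have mE : measurable_fun setT (fun x => (expR (- (lam * embed_time a k (Y x))))%:E : \bar R).
  apply/measurable_EFinP; apply: measurableT_comp => //.
  by apply: measurableT_comp => //; apply: measurable_funM.
pose c := expR (- (lam * (k%:R * h - del))).
have c0 : (0 < c)%R by exact: expR_gt0.
have : c%:E * P y A <= \int[P y]_x (expR (- (lam * embed_time a k (Y x))))%:E.
  apply: ge0_markov => //.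
  - exact: expR_ge0.
  - by move=> x Ax; rewrite lee_fin ler_expR lerN2 ler_wpM2l.
move=> /le_trans /(_ (embed_time_laplace k y lam0)).
have /fineK <- : P y A \is a fin_num by exact: fin_num_measure.
rewrite -EFinM !lee_fin -ler_pdivlMl// => /le_trans; apply.
by rewrite /c -expRN -expRD ler_expR le_eqVlt; apply/orP; left; apply/eqP; ring.
Qed.

(** A variable that is rarely much smaller than m and whose mean is at most
    (1 + e) m is rarely much larger than m.  This spares an upper exponential
    bound. *)
Lemma embed_time_upper (del del' q : R) k y : (0 <= del)%R -> (0 <= del')%R ->
  P y [set x | (embed_time a k (Y x) <= k%:R * h - del')%R] <= q%:E ->
  del%:E * P y [set x | (k%:R * h + del < embed_time a k (Y x))%R] <=
  (e * (k%:R * h) + del' + k%:R * h * q)%:E.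
Proof.
move=> del0 del'0; set B := [set x | _] => PB; set A := [set x | _].
have mA : measurable A by exact: measurable_lt_set.
have mB : measurable B by exact: measurable_le_set.
have mIA : measurable_fun setT (fun x => (\1_A x)%:E : \bar R).
  by apply/measurable_EFinP; exact: measurable_indic.
have mIB : measurable_fun setT (fun x => (\1_B x)%:E : \bar R).
  by apply/measurable_EFinP; exact: measurable_indic.
set m := (k%:R * h)%R in A B mA mB mIA mIB PB *.
have m0 : (0 <= m)%R by rewrite mulr_ge0// ltW.
pose tau x := (embed_time a k (Y x))%:E : \bar R.
have mt : measurable_fun setT tau by exact/measurable_EFinP.
have t0 x : 0 <= tau x by rewrite lee_fin embed_time_ge0.
pose f1 x := del%:E * (\1_A x)%:E : \bar R.
pose f2 x := m%:E * (\1_B x)%:E : \bar R.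
have mf1 : measurable_fun setT f1 by exact: emeasurable_funM.
have mf2 : measurable_fun setT f2 by exact: emeasurable_funM.
have f10 x : 0 <= f1 x by rewrite mule_ge0 ?lee_fin.
have f20 x : 0 <= f2 x by rewrite mule_ge0 ?lee_fin.
(* [del * 1_A + m <= tau + del' + m * 1_B] holds pointwise *)
have := @ge0_le_integral _ _ _ (P y) _ measurableT
  (fun x => f1 x + m%:E) (fun x => tau x + (del'%:E + f2 x)).
have cst0 (r : R) : (0 <= r)%R -> \int[P y]_x r%:E = r%:E.
  by move=> r0; rewrite integral_cst//= probability_setT mule1.
have I1 : \int[P y]_x f1 x = del%:E * P y A.
  by rewrite ge0_integralZl// integral_indic// setIT.
have I2 : \int[P y]_x f2 x = m%:E * P y B.
  by rewrite ge0_integralZl// integral_indic// setIT.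
have mE0 : 0 <= m%:E :> \bar R by rewrite lee_fin.
have dE0 : 0 <= del'%:E :> \bar R by rewrite lee_fin.
pose g x := del'%:E + f2 x.
have g0 x : 0 <= g x by rewrite adde_ge0.
have mg : measurable_fun setT g by exact: emeasurable_funD.
rewrite (ge0_integralD _ _ (f2 := cst m%:E))//.
rewrite (ge0_integralD _ _ (f2 := g))//.
rewrite (ge0_integralD _ _ (f1 := cst del'%:E))//.
rewrite I1 I2 !cst0//.
move=> H; have {}H : del%:E * P y A + m%:E <= \int[P y]_x tau x + (del'%:E + m%:E * P y B).
  apply: H => //.
  - by move=> x _; rewrite adde_ge0// lee_fin.
  - exact: emeasurable_funD.
  - by apply: emeasurable_funD => //; apply: emeasurable_funD.
  move=> x _; rewrite /f1 /f2 /tau -!EFinM -!EFinD lee_fin !indicE.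
  have := embed_time_ge0 a k (Y x).
  have [xA|xA] := boolP (x \in A); have [xB|xB] := boolP (x \in B).
  - by move: xA xB; rewrite !inE /A /B /= mulr1 mulr1; lra.
  - by move: xA; rewrite !inE /A /= mulr1 mulr0; lra.
  - by rewrite mulr1 mulr0; lra.
  - by move: xB; rewrite notin_setE /B /= => /negP; rewrite -ltNge mulr0; lra.
have {}H := le_trans H (leeD2r _ (embed_time_mean k y)).
move: H PB.
have /fineK <- : P y A \is a fin_num by exact: fin_num_measure.
have /fineK <- : P y B \is a fin_num by exact: fin_num_measure.
rewrite -!EFinM -!EFinD !lee_fin => H PB.
by rewrite /m in m0 H *; nra.
Qed.

End fixed_scale.

(** The k-th exit time is close to k h.  The bound is uniform in the starting
    point and depends on the scale only through [h] and [e]. *)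
Lemma embed_time_tail (T del eta : R) : 0 < T -> 0 < del -> 0 < eta ->
  exists2 e1, 0 < e1 & exists2 h1, 0 < h1 & forall a h e,
    0 < h <= h1 -> 0 <= e <= e1 -> approx_scale a h e ->
    forall y k, k%:R * h <= T ->
    (P y [set x | (del < `|embed_time a k (Y x) - k%:R * h|)%R] <= eta%:E)%E.
Proof.
move=> T0 del0 eta0.
pose del' := Num.min del (del * eta / 8).
have del'0 : 0 < del' by rewrite lt_min del0 !mulr_gt0.
pose q := Num.min (eta / 2) (del * eta / (8 * T)).
have q0 : 0 < q by rewrite lt_min !divr_gt0// !mulr_gt0.
(* chosen such that the Chernoff bound is exp (- 1 / q), hence at most q *)
pose lam := 2 / (del' * q).
have [C C0 CE] : exists2 C : R, 0 < C & 11 * 8 ^+ 2 = C.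
  by exists (11 * 8 ^+ 2).
have lam0 : 0 < lam by rewrite divr_gt0// mulr_gt0.
exists (del' / (4 * T)); first by rewrite divr_gt0// mulr_gt0.
exists (del' / (4 * C * lam * T)).
  by apply: divr_gt0 => //; apply: mulr_gt0 => //; apply: mulr_gt0 => //; apply: mulr_gt0.
move=> a h e /andP[h0 hh1] /andP[e0 ee1] ah y k kT.
have m0 : 0 <= k%:R * h by rewrite mulr_ge0// ltW.
have eT : e * (k%:R * h) <= del' / 4.
  apply: (@le_trans _ _ (del' / (4 * T) * T)); first exact: ler_pM.
  by rewrite invfM mulrA mulfVK ?gt_eqF.
have hT : C * (lam * h) * (k%:R * h) <= del' / 4.
  apply: (@le_trans _ _ (C * (lam * (del' / (4 * C * lam * T))) * T)).
    apply: ler_pM => //.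
      by apply: mulr_ge0; [exact: ltW|apply: mulr_ge0; exact: ltW].
    by rewrite ler_pM2l// ler_pM2l.
  have -> : C * (lam * (del' / (4 * C * lam * T))) * T = del' / 4.
    by field; rewrite !gt_eqF.
  by [].
have lower : (P y [set x | (embed_time a k (Y x) <= k%:R * h - del')%R] <= q%:E)%E.
  have := embed_time_lower h0 ah del' k y (ltW lam0).
  rewrite CE => /le_trans; apply.
  rewrite lee_fin; apply: (@le_trans _ _ (expR (- q^-1))).
    rewrite ler_expR lerN2.
    have -> : q^-1 = lam * (del' / 2) by rewrite /lam; field; rewrite !gt_eqF.
    by rewrite ler_pM2l//; lra.
  rewrite expRN -[leRHS]invrK lef_pV2 ?posrE ?expR_gt0 ?invr_gt0//.
  by apply: le_trans (expR_ge1Dx _); rewrite lerDr.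
have upper := embed_time_upper h0 ah (ltW del0) (ltW del'0) lower.
pose mt := measurableT_comp (measurable_embed_time (approx_scale_measurable ah) k)
  (measurable_diffusion Y_diffusion).
set A := [set x | _]; pose A1 := [set x | k%:R * h + del < embed_time a k (Y x)].
pose A2 := [set x | embed_time a k (Y x) <= k%:R * h - del'].
have mA1 : measurable A1 by apply: measurable_lt_set.
have mA2 : measurable A2 by apply: measurable_le_set.
have mA : measurable A.
  apply: measurable_lt_set => //; apply: measurableT_comp => //.
  by apply: measurable_funB.
have A12 : A `<=` A1 `|` A2.
  move=> x; rewrite /A /= ltr_normr opprB => /orP[H|H].
    by left; rewrite /A1 /= addrC -ltrBrDr.
  have : del' <= del by rewrite ge_min lexx.
  by right; rewrite /A2 /=; lra.
apply: (@le_trans _ _ (P y A1 + P y A2)%E).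
  apply: le_trans (measureU2 _ mA1 mA2).
  by apply: le_measure; rewrite ?inE//; exact: measurableU.
move: upper lower; rewrite -/A1 -/A2.
have /fineK <- : P y A1 \is a fin_num by exact: fin_num_measure.
have /fineK <- : P y A2 \is a fin_num by exact: fin_num_measure.
rewrite -!EFinM -!EFinD !lee_fin => upper lower.
have q1 : q <= eta / 2 by rewrite ge_min lexx.
have q2 : q * T <= del * eta / 8.
  apply: (@le_trans _ _ (del * eta / (8 * T) * T)).
    by rewrite ler_pM2r// ge_min lexx orbT.
  by rewrite invfM mulrA mulfVK ?gt_eqF.
have d2 : del' <= del * eta / 8 by rewrite ge_min lexx orbT.
have kq : k%:R * h * q <= q * T by rewrite mulrC ler_pM2l.
have : del * fine (P y A1) <= del * (eta / 2) by lra.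
by rewrite ler_pM2l//; lra.
Qed.

End embedded_walk.

(** * The law of the chain and of the embedded walk *)
Section walks.
Context {R : realType}.
Implicit Types (a : R -> R) (y h : R) (s : nat -> bool).

Definition sgn (b : bool) : R := if b then 1 else -1.

Lemma sgn_inj : injective sgn.
Proof. by move=> [] [] //=; rewrite /sgn; lra. Qed.

Fixpoint walk a y s (k : nat) : R :=
  if k is k'.+1 then walk a y s k' + a (walk a y s k') * sgn (s k') else y.

Lemma walkS a y s k :
  walk a y s k.+1 = walk a (y + a y * sgn (s 0%N)) (fun j => s j.+1) k.
Proof. by elim: k => [//|k IH]; rewrite [LHS]/= -/(walk a y s k.+1) IH. Qed.

Lemma walk_inj a y s s' n : (forall z, 0 < a z) ->
  (forall k, (k <= n)%N -> walk a y s k = walk a y s' k) ->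
  forall k, (k < n)%N -> s k = s' k.
Proof.
move=> a0 ww k kn; have := ww k.+1 kn; rewrite /= (ww k (ltnW kn)) => /addrI.
by move/mulfI => /(_ (lt0r_neq0 (a0 _))) /sgn_inj.
Qed.

Definition stop (n : nat) (x : nat -> R) (k : nat) : R := x (minn k n).

Lemma interp_stop_cvg h (x : nat -> R) (f : cpath R -> R) : 0 < h ->
  continuous f -> f (interp h (stop n x)) @[n --> \oo] --> f (interp h x).
Proof.
move=> h0 cf A /cf /nbhs_tube [m mA].
change (\forall n \near \oo, A (f (interp h (stop n x)))).
near=> n; suff /mA : tube (interp h x) m%:R m.+1%:R^-1 (interp h (stop n x)) by [].
move=> t /andP[t0 tm].
have th0 : 0 <= t / h by rewrite divr_ge0// ltW.
suff tn : (Num.truncn (t / h) < n)%N.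
  rewrite !ev_interp// /linear_interp /stop (minn_idPl tn) (minn_idPl (ltnW tn)).
  by rewrite subrr normr0 invr_gt0.
apply: (@leq_ltn_trans (Num.truncn (m%:R / h))).
  by rewrite le_truncn// ler_pM2r ?invr_gt0.
by near: n; exists (Num.truncn (m%:R / h)).+1.
Unshelve. all: by end_near. Qed.

Section expectation.
Context d (T : measurableType d) (Q : probability T R).
Variables (X : nat -> T -> R) (a : R -> R) (y h : R).
Hypotheses (a0 : forall z, 0 < a z) (h0 : 0 < h).
Hypothesis mX : forall k, measurable_fun setT (X k).

(** The event that the process makes the first [n] steps of the walk that is
    driven by the signs [s]. *)
Definition follows n s := [set w | forall k, (k <= n)%N -> X k w = walk a y s k].

Hypothesis QX : forall n s, Q (follows n s) = (2^-1 ^+ n)%:E.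

Lemma measurable_follows n s : measurable (follows n s).
Proof.
rewrite (_ : follows n s =
    \bigcap_(k in [set k | (k <= n)%N]) [set w | X k w = walk a y s k]) //.
apply: bigcap_measurable => [|k _]; first by exists 0%N.
by have := mX k measurableT (measurable_set1 (walk a y s k)); rewrite setTI.
Qed.

Lemma measurable_interp_process (g : nat -> nat) :
  measurable_fun setT (fun w => interp h (fun k => X (g k) w) : borel_cpath R).
Proof.
apply: measurable_path => t.
have -> : (fun w => ev (interp h (fun k => X (g k) w)) t) =
    (fun w => linear_interp (fun k => X (g k) w) (Num.max 0 t / h)).
  apply/funext => w; have [t0|t0] := leP 0 t; first by rewrite ev_interp.
  by rewrite (ev_neg _ (ltW t0)) ev_interp.
apply: measurable_funD => //; apply: measurable_funM => //.
exact: measurable_funB.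
Qed.

Variables (f : cpath R -> R) (M : R).
Hypotheses (cf : continuous f) (fM : forall w, `|f w| <= M).

Let mf g : measurable_fun setT (fun w => f (interp h (fun k => X (g k) w))).
Proof.
exact: (measurableT_comp (measurable_continuous_path cf) (measurable_interp_process g)).
Qed.

Let intf (g : nat -> nat) D : measurable D ->
  Q.-integrable D (EFin \o (fun w => f (interp h (fun k => X (g k) w)))).
Proof.
move=> mD; apply: measurable_bounded_integrable => //.
- by apply: le_lt_trans (ltry 1); exact: probability_le1.
- by apply: measurable_funTS; exact: mf.
- exists M; split; first exact: num_real.
  by move=> r Mr w _; apply: le_trans (fM _) (ltW Mr).
Qed.

Let tw n (s : n.-tuple bool) : nat -> bool := nth false s.

(** The first [n] positions take 2 ^ n equally likely values, one for each
    choice of signs: distinct signs give distinct walks as the scale is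
    positive. *)
Lemma integral_stopped_walk n :
  (\int[Q]_w (f (interp h (stop n (fun k => X k w))))%:E =
   \sum_(s : n.-tuple bool) (2^-1 ^+ n * f (interp h (stop n (walk a y (tw s)))))%:E)%E.
Proof.
pose A (s : n.-tuple bool) := follows n (tw s).
have mA (b : n.-tuple bool) : measurable (A b) by exact: measurable_follows.
have tA : trivIset [set` index_enum (n.-tuple bool : finType)] A.
  move=> s s' _ _ [w [ws ws']]; apply/val_inj/(@eq_from_nth _ false).
    by rewrite !size_tuple.
  rewrite size_tuple; apply: (@walk_inj a y _ _ n a0) => k kn.
  by rewrite -ws// -ws'.
pose D := \big[setU/set0]_(s <- index_enum (n.-tuple bool : finType)) A s.
have mD : measurable D by exact: bigsetU_measurable.
have QD : Q D = 1%E.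
  have I1 B : measurable B -> Q B = (\int[Q]_(x in B) (cst 1 x : R)%:E)%E.
    move=> mB; transitivity (\int[Q]_(x in B) cst 1%E x)%E => //.
    by rewrite integral_cst// mul1e.
  rewrite I1// integral_bigsetU_EFin//; last 2 first.
  - exact: index_enum_uniq.
  - by apply/measurable_EFinP; exact: measurable_cst.
  transitivity (\sum_(s : n.-tuple bool) (2^-1 ^+ n : R)%:E)%E.
    by apply: eq_bigr => s _; rewrite -I1//; exact: QX.
  rewrite sumEFin sumr_const card_tuple card_bool.
  by rewrite -(mulr_natl (2^-1 ^+ n)) natrX -exprMn divff ?expr1n.
have QDC : Q (~` D) = 0%E.
  transitivity (1 - Q D)%E; first exact: probability_setC.
  by rewrite QD subee.
rewrite (negligible_integral (measurableC mD) measurableT (intf _ measurableT) QDC).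
rewrite setTD setCK (integral_bigsetU_EFin _ mA (index_enum_uniq _) tA); last first.
  by apply/measurable_EFinP; apply: measurable_funTS; exact: mf.
apply: eq_bigr => s _.
rewrite (eq_integral (cst (f (interp h (stop n (walk a y (tw s)))))%:E)).
  by rewrite integral_cst// mulrC EFinM; congr (_ * _)%E; exact: QX.
move=> w; rewrite inE => ws; congr (f (interp h _))%:E.
by apply/funext => k; rewrite /stop ws// geq_minr.
Qed.

Lemma walk_expectation :
  (\sum_(s : n.-tuple bool) (2^-1 ^+ n * f (interp h (stop n (walk a y (tw s)))))%:E)%E
    @[n --> \oo] --> (\int[Q]_w (f (interp h (fun k => X k w)))%:E)%E.
Proof.
under eq_fun do rewrite -integral_stopped_walk.
have [| | | | |_ _ H] := @dominated_convergence _ _ _ Q setT measurableT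
  (fun n w => (f (interp h (stop n (fun k => X k w))))%:E)
  (fun w => (f (interp h (fun k => X k w)))%:E) (cst M%:E).
- by move=> n; apply/measurable_EFinP; exact: mf (fun k => minn k n).
- by apply/measurable_EFinP; exact: mf id.
- by apply: aeW => w _; apply/cvg_EFin; [exact: nearW|exact: interp_stop_cvg].
- apply/integrableP; split => //; rewrite integral_cst//= probability_setT mule1.
  by rewrite ltry.
- by apply: aeW => w n _; rewrite /= lee_fin.
exact: H.
Qed.

End expectation.

(** Two processes whose sign patterns are equally likely have the same law;
    stopping them after [n] steps reduces this to finite sums. *)
Lemma eq_walk_expectation d (T : measurableType d) (Q : probability T R)
    d' (T' : measurableType d') (Q' : probability T' R)
    (X : nat -> T -> R) (X' : nat -> T' -> R) a y h (f : cpath R -> R) :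
  (forall z, 0 < a z) -> 0 < h ->
  (forall k, measurable_fun setT (X k)) -> (forall k, measurable_fun setT (X' k)) ->
  (forall n s, Q (follows X a y n s) = (2^-1 ^+ n)%:E) ->
  (forall n s, Q' (follows X' a y n s) = (2^-1 ^+ n)%:E) ->
  bounded_continuous f ->
  (\int[Q]_w (f (interp h (fun k => X k w)))%:E =
   \int[Q']_w (f (interp h (fun k => X' k w)))%:E)%E.
Proof.
move=> a0 h0 mX mX' QX QX' [cf [M fM]].
have L := walk_expectation a0 h0 mX QX cf fM.
have L' := walk_expectation a0 h0 mX' QX' cf fM.
exact: cvg_unique L L'.
Qed.

End walks.

Section chain_walk.
Context {R : realType} d (Omega : measurableType d) (P : probability Omega R).
Variables (xi : nat -> Omega -> R).
Hypothesis xi_iid : iid_coin_tosses P xi.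
Variables (a : R -> R) (y : R).
Hypotheses (ma : measurable_fun setT a) (a0 : forall z, 0 < a z).

Lemma measurable_chain k : measurable_fun setT (fun w => chain a xi y w k).
Proof.
elim: k => [|k IH] /=; first exact: measurable_cst.
apply: measurable_funD => //; apply: measurable_funM.
  exact: (measurableT_comp ma IH).
exact: coin_measurable xi_iid k.
Qed.

(** As the scale is positive, the positions determine the coin tosses. *)
Lemma chain_follows n s :
  P (follows (fun k w => chain a xi y w k) a y n s) = (2^-1 ^+ n)%:E.
Proof.
pose J := [fset k | k in iota 0 n]%fset.
have -> : follows (fun k w => chain a xi y w k) a y n s =
    \bigcap_(k in [set` J]) xi k @^-1` [set sgn (s k)].
  apply/seteqP; split => w /=.
    move=> H k /=; rewrite !inE/= mem_iota/= add0n => kn.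
    have := H k.+1 kn; rewrite /= H 1?ltnW// => /addrI.
    by move/mulfI => /(_ (lt0r_neq0 (a0 _))).
  move=> H; elim=> [//|k IH] kn /=; rewrite IH 1?ltnW//.
  by rewrite (H k)//= !inE/= mem_iota.
rewrite (coin_independent xi_iid) => [|k]; last exact: measurable_set1.
rewrite (eq_bigr (fun=> (2^-1)%:E)); last first.
  by move=> k _; case: (s k); [exact: coin_up xi_iid k|exact: coin_down xi_iid k].
rewrite (perm_big (iota 0 n)) /=; last first.
  apply: uniq_perm; [exact: fset_uniq|exact: iota_uniq|].
  by move=> k; rewrite !inE.
rewrite prodEFin; congr (_%:E).
by rewrite big_const_seq count_predT size_iota iter_mulr_1.
Qed.

End chain_walk.

Section embedded_chain.
Context {R : realType} d (Omega : measurableType d).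
Variables (F : time R -> set (set Omega)) (P : R -> probability Omega R)
  (Y : Omega -> cpath R).
Hypothesis Y_diffusion : regular_diffusion F P Y.
Hypothesis Y_natural_scale : natural_scale P Y.
Variables (a : R -> R).
Hypotheses (ma : measurable_fun setT a) (a0 : forall z, 0 < a z).
Hypothesis exit_lty :
  forall y, P y [set x | (exit_time (y - a y) (y + a y) (Y x) < +oo)%E] = 1%E.

Lemma measurable_embedded k :
  measurable_fun setT (fun x => ev (iter k (next a) (Y x)) 0).
Proof.
apply: (measurableT_comp (@measurable_ev R 0)).
exact: (measurableT_comp (measurable_iter_next ma k) (measurable_diffusion Y_diffusion)).
Qed.

(** Induction on the number of steps.  After the first step the walk starts
    afresh from one of the two exit points, each with probability 1/2. *)
Lemma embedded_follows y n s :
  P y (follows (fun k x => ev (iter k (next a) (Y x)) 0) a y n s) = (2^-1 ^+ n)%:E.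
Proof.
have mw y' n' s' : measurable (follows (fun k (w : borel_cpath R) =>
    ev (iter k (next a) w) 0) a y' n' s').
  apply: measurable_follows => k.
  exact: (measurableT_comp (@measurable_ev R 0) (measurable_iter_next ma k)).
have mstart : measurable [set x | ev (Y x) 0 = y].
  by have := measurable_ev_eq Y_diffusion (s := cst 0) y; apply; exact: measurable_cst.
elim: n y s {mstart} => [|n IH] y s.
  rewrite expr0 -(diffusion_start0 Y_diffusion y); congr (P y _).
  apply/seteqP; split => x /= H; first exact: (H 0%N).
  by move=> k; rewrite leqn0 => /eqP ->.
have mstart : measurable [set x | ev (Y x) 0 = y].
  by have := measurable_ev_eq Y_diffusion (s := cst 0) y; apply; exact: measurable_cst.
pose z := y + a y * sgn (s 0%N); pose s' j := s j.+1.
pose B := follows (fun k (w : borel_cpath R) => ev (iter k (next a) w) 0) a z n s'.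
transitivity (P y ((fun x => next a (Y x)) @^-1` B)).
  apply: (probability_eq_on _ _ mstart (diffusion_start0 Y_diffusion y)).
  - by apply: measurable_follows; exact: measurable_embedded.
  - rewrite -[X in measurable X]setTI.
    exact: (measurable_next_diffusion Y_diffusion ma measurableT (mw _ _ _)).
  apply/seteqP; split => x [H x0]; split => //.
    by move=> k kn; rewrite -iterSr (H k.+1)// walkS.
  move=> k; case: k => [_|k kn]; first exact: x0.
  by rewrite walkS iterSr; exact: H.
have zul : z = y + a y \/ z = y - a y.
  by rewrite /z /sgn; case: (s 0%N); [left; rewrite mulr1|right; rewrite mulrN1].
have Bz w : B w -> ev w 0 = z by move=> /(_ 0%N); exact.
rewrite (step_markov_event Y_diffusion ma (a0 y) (exit_lty y) Y_natural_scale
  (mw z n s') zul Bz).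
by rewrite exprS EFinM; congr (_ * _)%E; exact: IH.
Qed.

End embedded_chain.

(** * Potentials of the approximations of the Cantor distribution *)
Section lebesgue_affine.
Context {R : realType}.
Let three : {nonneg R} := 3%:nng.
Let third : {nonneg R} := (3^-1)%:nng.
Local Open Scope ereal_scope.
Local Notation leb := (@lebesgue_measure R).

Definition triple (b x : R) : R := x * 3 - b.

Lemma continuous_triple b : continuous (triple b).
Proof.
move=> x; apply: cvgB; last exact: cvg_cst.
by apply: cvgM; [exact: cvg_id|exact: cvg_cst].
Qed.

Lemma measurable_triple b : measurable_fun setT (triple b).
Proof. by apply: continuous_measurable_fun; exact: continuous_triple. Qed.

(** The two measures agree on half-open intervals. *)
Lemma lebesgue_triple (b : R) (A : set R) : measurable A ->
  mscale third leb A = pushforward leb (triple b : R -> measurableTypeR R) A.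
Proof.
move=> mA; pose push := pushforward leb (triple b : R -> measurableTypeR R) : {measure set (measurableTypeR R) -> \bar R}.
pose mu : {measure set (measurableTypeR R) -> \bar R} := mscale three (push (measurable_triple b)).
have E : leb A = mu A.
  apply: lebesgue_measure_unique => // _ [[p q]] _ <-.
  rewrite /mu /= /mscale /= /push /= /pushforward.
  rewrite (_ : triple b @^-1` _ = `](p + b) / 3, (q + b) / 3]%classic)%R; last first.
    apply/seteqP; split => x /=; rewrite !in_itv/= /triple => /andP[? ?];
      apply/andP; split; lra.
  rewrite !lebesgue_measure_itv/= !lte_fin ltr_pM2r ?ltrD2r//.
  case: ifPn => _; last by rewrite mule0.
  by rewrite -!EFinB -EFinM; congr (_%:E); field.
rewrite /= /mscale/= E /mu /= /mscale /= muleA -EFinM mulVf// mul1e.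
by [].
Qed.

Lemma ge0_integral_triple (b : R) (C : set R) (g : R -> \bar R) :
  measurable C -> measurable_fun setT g -> (forall x, 0 <= g x) ->
  \int[leb]_(x in triple b @^-1` C) g x =
  (3^-1)%:E * \int[leb]_(u in C) g ((u + b) / 3)%R.
Proof.
move=> mC mg g0.
have maff : measurable_fun setT (fun u : R => ((u + b) / 3)%R).
  by apply: measurable_funM => //; exact: measurable_funD.
have mga : measurable_fun setT (fun u : R => g ((u + b) / 3)%R).
  exact: (measurableT_comp mg maff).
have -> : (3^-1)%:E * \int[leb]_(u in C) g ((u + b) / 3)%R =
    \int[mscale third leb]_(u in C) g ((u + b) / 3)%R.
  by rewrite ge0_integral_mscale//; exact: measurable_funTS.
transitivity (\int[pushforward leb (triple b : R -> measurableTypeR R)]_(u in C)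
    g ((u + b) / 3)%R); last first.
  apply: eq_measure_integral; first exact: measurable_triple.
  by move=> *; apply: esym; exact: lebesgue_triple.
rewrite ge0_integral_pushforward//; last 2 first.
- exact: measurable_triple.
- exact: measurable_funTS.
by apply: eq_integral => x _; rewrite /= /triple subrK mulfK.
Qed.

End lebesgue_affine.

Section cantor_integral.
Context {R : realType}.
Local Open Scope ereal_scope.
Local Notation leb := (@lebesgue_measure R).

Lemma cantor_approx_sub01 (k : nat) (x : R) : cantor_approx k x -> (0 <= x <= 1)%R.
Proof.
elim: k x => [|k IH] x /=; first by rewrite in_itv.
by move=> [] [z /IH /andP[? ?] <-]; apply/andP; split; lra.
Qed.

Lemma cantor_approxS (k : nat) :
  @cantor_approx R k.+1 = triple 0 @^-1` cantor_approx k `|` triple 2 @^-1` cantor_approx k.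
Proof.
apply/seteqP; split => x /=.
  by move=> [] [z zC <-]; [left|right]; rewrite /triple divfK// ?subr0 ?addrK.
move=> [zC|zC]; [left; exists (triple 0 x)|right; exists (triple 2 x)] => //;
  by rewrite /triple ?subr0 ?subrK mulfK.
Qed.

Lemma ge0_integral_cantor_approx (k : nat) (g : R -> \bar R) :
  measurable_fun setT g -> (forall x, 0 <= g x) ->
  \int[cantor_approx_measure k]_x g x =
  ((3 / 2) ^+ k)%:E * \int[leb]_(x in cantor_approx k) g x.
Proof.
move=> mg g0; rewrite ge0_integral_mscale//=.
by rewrite (ge0_integral_mrestr leb (measurable_cantor_approx k)).
Qed.

(** Self-similarity: the next approximation is the equal mixture of the images
    of the current one under the two contractions. *)
Lemma ge0_integral_cantor_approxS (k : nat) (g : R -> \bar R) :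
  measurable_fun setT g -> (forall x, 0 <= g x) ->
  \int[cantor_approx_measure k.+1]_x g x =
  2^-1%:E * (\int[cantor_approx_measure k]_x g (x / 3)%R +
             \int[cantor_approx_measure k]_x g ((x + 2) / 3)%R).
Proof.
move=> mg g0; have mC : measurable (@cantor_approx R k) by exact: measurable_cantor_approx.
have mga (b : R) : measurable_fun setT (fun u : R => g ((u + b) / 3)%R).
  apply: (measurableT_comp mg).
  by apply: measurable_funM => //; exact: measurable_funD.
have mg0 : measurable_fun setT (fun u : R => g (u / 3)%R).
  by have := mga 0%R; under eq_fun do rewrite addr0.
rewrite !ge0_integral_cantor_approx// cantor_approxS.
have mP (b : R) : measurable (triple b @^-1` cantor_approx k).
  by rewrite -[X in measurable X]setTI; exact: (@measurable_triple R b measurableT _ mC).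
rewrite ge0_integral_setU//; last 2 first.
- exact: measurable_funTS.
- apply/disj_set2P; apply/seteqP; split => // x [/=].
  move=> /cantor_approx_sub01 /andP[_ x1] /cantor_approx_sub01 /andP[x0 _].
  by move: x1 x0; rewrite /triple; lra.
rewrite !ge0_integral_triple//.
under eq_integral do rewrite addr0.
set I0 := integral _ _ _; set I2 := integral _ _ _.
have I00 : 0 <= I0 by exact: integral_ge0.
have I20 : 0 <= I2 by exact: integral_ge0.
rewrite -!ge0_muleDr// !muleA -!EFinM; congr (_%:E * _).
  by rewrite exprS; field.
all: exact: mP.
Qed.

End cantor_integral.

Section potential.
Context {R : realType}.
Local Notation leb := (@lebesgue_measure R).

Lemma measurable_dist (x : R) : measurable_fun setT (fun t : R => (`|x - t|%:E : \bar R)).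
Proof.
by apply/measurable_EFinP; apply: measurableT_comp => //; exact: measurable_funB.
Qed.

Lemma integral_ramp_up (p q : R) : p < q ->
  (\int[leb]_(v in `[p, q]) (v - p)%:E = ((q - p) ^+ 2 / 2)%:E)%E.
Proof.
move=> pq; pose f (v : R) := v - p; pose G (v : R) := (v - p) ^+ 2 / 2.
have cG : continuous G.
  move=> v; apply: cvgM; last exact: cvg_cst.
  by apply: cvgM; (apply: cvgB; [exact: cvg_id|exact: cvg_cst]).
have dG (v : R) : is_derive v (1 : R) G (v - p).
  rewrite /G; apply: is_derive_eq; rewrite /GRing.scale/=.
  by rewrite !mulr0 subr0 !mulr1 add0r; lra.
transitivity ((G q)%:E - (G p)%:E)%E; last first.
  by rewrite -EFinB /G subrr expr0n/= mul0r subr0.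
apply: (@continuous_FTC2 _ f G) => //.
- by apply: continuous_subspaceT => v; apply: cvgB; [exact: cvg_id|exact: cvg_cst].
- split => [v _||]; first by have [] := dG v.
  + exact/cvg_at_right_filter/cG.
  + exact/cvg_at_left_filter/cG.
- by move=> v _; rewrite derive1E; have [_ ->] := dG v.
Qed.

Lemma integral_ramp_down (p q : R) : p < q ->
  (\int[leb]_(v in `[p, q]) (q - v)%:E = ((q - p) ^+ 2 / 2)%:E)%E.
Proof.
move=> pq.
have mu : measurable_fun `[p, q] (fun v : R => (v - p)%:E : \bar R).
  by apply: measurable_funTS; apply/measurable_EFinP; exact: measurable_funB.
have md : measurable_fun `[p, q] (fun v : R => (q - v)%:E : \bar R).
  by apply: measurable_funTS; apply/measurable_EFinP; exact: measurable_funB.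
have H : (\int[leb]_(v in `[p, q]) (v - p)%:E + \int[leb]_(v in `[p, q]) (q - v)%:E =
    ((q - p) ^+ 2)%:E)%E.
  rewrite -ge0_integralD//; last 2 first.
  - by move=> v /=; rewrite in_itv/= lee_fin subr_ge0 => /andP[].
  - by move=> v /=; rewrite in_itv/= lee_fin subr_ge0 => /andP[].
  rewrite (eq_integral (cst (q - p)%:E)); last first.
    by move=> v _; rewrite -EFinD; congr (_%:E); ring.
  rewrite integral_cst//= lebesgue_measure_itv/= lte_fin pq -EFinB -EFinM.
  by rewrite expr2.
move: H; rewrite integral_ramp_up// => H.
have := congr1 (fun z => z - ((q - p) ^+ 2 / 2)%:E)%E H.
by rewrite addeAC subee// add0e => ->; rewrite -EFinB; congr (_%:E); field.
Qed.

Definition pot0 (x : R) : R := fine (\int[leb]_(t in `[0%R, 1%R]) `|x - t|%:E).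

(** The potential of the n-th approximation, i.e. the mean distance of x to a
    point of that distribution (see [integral_dist_cantor]).  Self-similarity makes
    it computable by recursion. *)
Fixpoint pot (n : nat) (x : R) : R :=
  if n is m.+1 then (pot m (3 * x) + pot m (3 * x - 2)) / 6 else pot0 x.

Let integral_dist_le (x K : R) : (forall t, 0 <= t <= 1 -> `|x - t| <= K) ->
  (\int[leb]_(t in `[0%R, 1%R]) `|x - t|%:E <= K%:E)%E.
Proof.
move=> xK; apply: (@le_trans _ _ (\int[leb]_(t in `[0%R, 1%R]) (cst K%:E t))%E).
  apply: ge0_le_integral => //.
  - by apply: measurable_funTS; exact: measurable_dist.
by rewrite integral_cst//= lebesgue_measure_itv/= lte_fin ltr01 oppr0 adde0 mule1.
Qed.

Lemma pot0E (x : R) : (\int[leb]_(t in `[0%R, 1%R]) `|x - t|%:E = (pot0 x)%:E)%E.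
Proof.
rewrite fineK// ge0_fin_numE; last by apply: integral_ge0 => t _; rewrite lee_fin.
apply: le_lt_trans (ltry (`|x| + 1)); apply: integral_dist_le => t /andP[t0 t1].
by rewrite (le_trans (ler_normB _ _))// lerD2l ger0_norm.
Qed.

Let pot0_le (x K : R) : (forall t, 0 <= t <= 1 -> `|x - t| <= K) -> pot0 x <= K.
Proof. by move=> /integral_dist_le; rewrite pot0E lee_fin. Qed.

Let pot0_ge0 (x : R) : 0 <= pot0 x.
Proof. by apply: fine_ge0; apply: integral_ge0 => t _; rewrite lee_fin. Qed.

Let cst_int (c : R) : (\int[leb]_(t in `[0%R, 1%R]) c%:E = c%:E)%E.
Proof.
by rewrite integral_cst//= lebesgue_measure_itv/= lte_fin ltr01 oppr0 adde0 mule1.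
Qed.

Let pot0_neg (x : R) : x <= 0 -> pot0 x = 2^-1 - x.
Proof.
move=> x0; have : (pot0 x)%:E = (2^-1 - x)%:E :> \bar R; last by case.
rewrite -pot0E.
transitivity (\int[leb]_(t in `[0%R, 1%R]) ((t - 0)%:E + (- x)%:E))%E.
  apply: eq_integral.
  move=> t; rewrite inE/= in_itv/= => /andP[t0 _].
  rewrite ler0_norm ?subr_le0 ?(le_trans x0)// -EFinD; congr (_%:E); ring.
rewrite ge0_integralD//; last 3 first.
- by move=> t /=; rewrite in_itv/= lee_fin subr0 => /andP[].
- by apply: measurable_funTS; apply/measurable_EFinP; exact: measurable_funB.
- by move=> t _; rewrite lee_fin oppr_ge0.
by rewrite integral_ramp_up// cst_int -EFinD subr0 expr1n mul1r.
Qed.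

Let pot0_ge1 (x : R) : 1 <= x -> pot0 x = x - 2^-1.
Proof.
move=> x1; have : (pot0 x)%:E = (x - 2^-1)%:E :> \bar R; last by case.
rewrite -pot0E.
transitivity (\int[leb]_(t in `[0%R, 1%R]) ((1 - t)%:E + (x - 1)%:E))%E.
  apply: eq_integral.
  move=> t; rewrite inE/= in_itv/= => /andP[_ t1].
  rewrite ger0_norm ?subr_ge0 ?(le_trans t1)// -EFinD; congr (_%:E); ring.
rewrite ge0_integralD//; last 3 first.
- by move=> t /=; rewrite in_itv/= lee_fin subr_ge0 => /andP[].
- by apply: measurable_funTS; apply/measurable_EFinP; exact: measurable_funB.
- by move=> t _; rewrite lee_fin subr_ge0.
rewrite integral_ramp_down// cst_int -EFinD subr0 expr1n mul1r.
by congr (_%:E); lra.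
Qed.

Let pot0_lipschitz (x z : R) : pot0 x <= pot0 z + `|x - z|.
Proof.
rewrite -lee_fin EFinD -!pot0E -[X in (_ <= _ + X)%E]cst_int -ge0_integralD//; last first.
  by apply: measurable_funTS; exact: measurable_dist.
apply: ge0_le_integral => //.
- by apply: measurable_funTS; exact: measurable_dist.
- by apply: emeasurable_funD => //; apply: measurable_funTS; exact: measurable_dist.
move=> t _; rewrite -EFinD lee_fin [leRHS]addrC; exact: ler_distD.
Qed.

Lemma pot_lipschitz n (x z : R) : pot n x <= pot n z + `|x - z|.
Proof.
elim: n x z => [|n IH] x z /=; first exact: pot0_lipschitz.
have := IH (3 * x) (3 * z); have := IH (3 * x - 2) (3 * z - 2).
have -> : 3 * x - 2 - (3 * z - 2) = 3 * (x - z) by ring.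
rewrite -mulrBr normrM ger0_norm//; lra.
Qed.

(** Outside of the unit interval the potential only depends on the mean, which is 1/2 for
    all approximations.  Since 3 x and 3 x - 2 are never both in the open unit
    interval, only one of the two terms of the recursion contributes to the
    increment, which is thus divided by 6 in each step. *)
Lemma pot_diff n (x : R) :
  (x <= 0 \/ 1 <= x -> pot n.+1 x = pot n x) /\
  `|pot n.+1 x - pot n x| <= 6^-1 ^+ n.
Proof.
elim: n x => [|n IH] x.
  have out : x <= 0 \/ 1 <= x -> pot 1 x = pot 0 x.
    rewrite /=; move=> [x0|x1].
      by rewrite !pot0_neg//; lra.
    by rewrite !pot0_ge1//; lra.
  split => //; rewrite expr0.
  have [x0|x0] := leP x 0; first by rewrite out ?subrr ?normr0//; left.
  have [x1|x1] := leP 1 x; first by rewrite out ?subrr ?normr0//; right.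
  have p0 : pot0 x <= 1.
    by apply: pot0_le => t /andP[? ?]; rewrite ler_norml; lra.
  have p1 : pot0 (3 * x) <= 3.
    by apply: pot0_le => t /andP[? ?]; rewrite ler_norml; lra.
  have p2 : pot0 (3 * x - 2) <= 3.
    by apply: pot0_le => t /andP[? ?]; rewrite ler_norml; lra.
  have := pot0_ge0 x; have := pot0_ge0 (3 * x); have := pot0_ge0 (3 * x - 2).
  by rewrite /= ler_norml; lra.
have E : pot n.+2 x - pot n.+1 x = ((pot n.+1 (3 * x) - pot n (3 * x)) +
    (pot n.+1 (3 * x - 2) - pot n (3 * x - 2))) / 6 by rewrite /=; ring.
have [out1 b1] := IH (3 * x); have [out2 b2] := IH (3 * x - 2); split.
  move=> x01; apply/eqP; rewrite -subr_eq0 E out1 ?out2 ?subrr ?addr0 ?mul0r//.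
    by case: x01 => ?; [left|right]; lra.
  by case: x01 => ?; [left|right]; lra.
have n6 : `|6^-1 : R| = 6^-1 by rewrite ger0_norm.
rewrite E exprS normrM n6 mulrC ler_pM2l//.
have [x3|x3] := leP 1 (3 * x); first by rewrite out1 ?subrr ?add0r//; right.
by rewrite out2 ?subrr ?addr0//; left; lra.
Qed.

Lemma integral_dist_cantor n (x : R) :
  (\int[cantor_approx_measure n]_t `|x - t|%:E = (pot n x)%:E)%E.
Proof.
elim: n x => [|n IH] x.
  rewrite ge0_integral_cantor_approx//; last exact: measurable_dist.
  by rewrite expr0 mul1e; exact: pot0E.
rewrite ge0_integral_cantor_approxS//; last exact: measurable_dist.
have H (z : R) : (\int[cantor_approx_measure n]_t (3^-1 * `|z - t|)%:E =
    (3^-1 * pot n z)%:E)%E.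
  rewrite EFinM -IH -ge0_integralZl//; exact: measurable_dist.
have E1 : (\int[cantor_approx_measure n]_t `|x - t / 3|%:E =
    (3^-1 * pot n (3 * x))%:E)%E.
  rewrite -H; apply: eq_integral => t _.
  have -> : x - t / 3 = 3^-1 * (3 * x - t) by field.
  by rewrite normrM ger0_norm.
have E2 : (\int[cantor_approx_measure n]_t `|x - (t + 2) / 3|%:E =
    (3^-1 * pot n (3 * x - 2))%:E)%E.
  rewrite -H; apply: eq_integral => t _.
  have -> : x - (t + 2) / 3 = 3^-1 * (3 * x - 2 - t) by field.
  by rewrite normrM ger0_norm.
by rewrite E1 E2 -EFinD -EFinM /=; congr (_%:E); field.
Qed.

End potential.

(** * Tents and scale factors *)
Section tent.
Context {R : realType}.
Local Notation leb := (@lebesgue_measure R).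
Implicit Types y a t : R.

Definition tent y a t : R := Num.max 0 (a - `|t - y|).

Lemma tent_ge0 y a t : 0 <= tent y a t.
Proof. by rewrite /tent le_max lexx. Qed.

(** The tent is a second difference of distances, so that its integrals are
    second differences of potentials. *)
Lemma tent_second_difference y a t : 0 <= a ->
  tent y a t + `|y - t| = 2^-1 * `|y - a - t| + 2^-1 * `|y + a - t|.
Proof.
move=> a0; rewrite /tent (distrC t y).
by do 3 (case: ger0P => ?); case: leP => ?; lra.
Qed.

Lemma continuous_tent y a : continuous (tent y a).
Proof.
move=> t; apply: (@continuous_max _ _ (cst 0) (fun t => a - `|t - y|)).
  exact: cvg_cst.
apply: cvgB; first exact: cvg_cst.
by apply: cvg_norm; apply: cvgB; [exact: cvg_id|exact: cvg_cst].
Qed.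

Lemma measurable_tent y a :
  measurable_fun setT (fun t : R => (tent y a t)%:E : \bar R).
Proof.
apply/measurable_EFinP; apply: continuous_measurable_fun.
exact: continuous_tent.
Qed.

Lemma tent_out y a t : ~ (y - a < t < y + a) -> tent y a t = 0.
Proof.
move=> H; rewrite /tent max_l// subr_le0 leNgt; apply/negP.
by rewrite ltr_distl.
Qed.

Lemma tent_in y a t : y - a <= t <= y + a -> tent y a t = a - `|t - y|.
Proof.
by move=> H; rewrite /tent max_r// subr_ge0 ler_distl.
Qed.

Lemma integral_tent_support (mu : {measure set (measurableTypeR R) -> \bar R})
    y a (D : set R) : (forall t, y - a < t < y + a -> D t) ->
  (\int[mu]_(t in D) (tent y a t)%:E = \int[mu]_t (tent y a t)%:E)%E.
Proof.
move=> HD; rewrite integral_mkcond; apply: eq_integral => t _.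
rewrite /patch; case: ifPn => // /negP tD; rewrite tent_out// => /HD tD'.
by apply: tD; rewrite inE.
Qed.

Lemma integral_tent_lebesgue y a : 0 < a ->
  (\int[leb]_t (tent y a t)%:E = (a ^+ 2)%:E)%E.
Proof.
move=> a0; have mt := measurable_tent y a.
rewrite -(@integral_tent_support leb y a `[y - a, y + a]%classic); last first.
  by move=> t /andP[? ?]; rewrite /= in_itv/= !ltW.
have -> : `[y - a, y + a]%classic = `[y - a, y] `|` `]y, y + a] :> set R.
  apply/seteqP; split => t /=; rewrite !in_itv/=.
    by move=> /andP[-> ->]; have [ty|ty] := leP t y; [left|right].
  by move=> [] /andP[? ?]; apply/andP; split; lra.
rewrite ge0_integral_setU//=; last 3 first.
- exact: measurable_funTS.
- by move=> t _; rewrite lee_fin tent_ge0.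
- apply/disj_set2P; apply/seteqP; split => // t [/=].
  by rewrite !in_itv/= => /andP[_ ?] /andP[? _]; lra.
rewrite integral_itv_obnd_cbnd; last exact: measurable_funTS.
have -> : (\int[leb]_(t in `[(y - a)%R, y]) (tent y a t)%:E =
    \int[leb]_(t in `[(y - a)%R, y]) (t - (y - a))%:E)%E.
  apply: eq_integral => t; rewrite inE/= in_itv/= => /andP[? ?].
  by rewrite tent_in ?ler0_norm; congr (_%:E) || lra; lra.
have -> : (\int[leb]_(t in `[y, (y + a)%R]) (tent y a t)%:E =
    \int[leb]_(t in `[y, (y + a)%R]) (y + a - t)%:E)%E.
  apply: eq_integral => t; rewrite inE/= in_itv/= => /andP[? ?].
  by rewrite tent_in ?ger0_norm; congr (_%:E) || lra; lra.
rewrite integral_ramp_up ?integral_ramp_down; [|lra..].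
by rewrite -EFinD; congr (_%:E); field.
Qed.

Definition tent_pot n y a : R := (pot n (y - a) + pot n (y + a)) / 2 - pot n y.

Lemma integral_tent_cantor n y a : 0 <= a ->
  (\int[cantor_approx_measure n]_t (tent y a t)%:E = (tent_pot n y a)%:E)%E.
Proof.
move=> a0; have mt := measurable_tent y a.
have t0 t : (0 <= (tent y a t)%:E)%E by rewrite lee_fin tent_ge0.
have H : (\int[cantor_approx_measure n]_t (tent y a t)%:E + (pot n y)%:E =
    (2^-1 * pot n (y - a) + 2^-1 * pot n (y + a))%:E)%E.
  rewrite -integral_dist_cantor -ge0_integralD//; last exact: measurable_dist.
  have md (z : R) := measurable_dist z.
  have half (z : R) : (2^-1 * pot n z)%:E =
      (\int[cantor_approx_measure n]_t (2^-1 * `|z - t|)%:E)%E.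
    by rewrite EFinM -integral_dist_cantor -ge0_integralZl//; exact: measurable_dist.
  have mh (z : R) : measurable_fun setT (fun t : R => (2^-1 * `|z - t|)%:E : \bar R).
    apply/measurable_EFinP; apply: measurable_funM => //.
    by apply: measurableT_comp => //; exact: measurable_funB.
  have h0 (z t : R) : (0 <= (2^-1 * `|z - t|)%:E)%E by rewrite lee_fin mulr_ge0.
  rewrite EFinD !half -ge0_integralD//; [|exact: mh..].
  by apply: eq_integral => t _; rewrite -!EFinD tent_second_difference.
have := congr1 (fun z => z - (pot n y)%:E)%E H.
by rewrite addeK// => ->; rewrite -EFinB; congr (_%:E); rewrite /tent_pot; field.
Qed.

Lemma tent_pot0 n y : tent_pot n y 0 = 0.
Proof. by rewrite /tent_pot subr0 addr0; field. Qed.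

Lemma tent_pot_ge0 n y a : 0 <= a -> 0 <= tent_pot n y a.
Proof.
move=> a0; rewrite -lee_fin -integral_tent_cantor//.
by apply: integral_ge0 => t _; rewrite lee_fin tent_ge0.
Qed.

Lemma tent_pot_le n y a a' : 0 <= a -> a <= a' -> tent_pot n y a <= tent_pot n y a'.
Proof.
move=> a0 aa'; rewrite -lee_fin -!integral_tent_cantor ?(le_trans a0)//.
apply: ge0_le_integral => //.
- by move=> t _; rewrite lee_fin tent_ge0.
- exact: measurable_tent.
- exact: measurable_tent.
by move=> t _; rewrite lee_fin /tent ge_max !le_max lexx/= lerD2r aa' orbT.
Qed.

Let pot_dist n (x z : R) : `|pot n x - pot n z| <= `|x - z|.
Proof.
have := pot_lipschitz n x z; have := pot_lipschitz n z x.
by rewrite (distrC z) ler_norml; lra.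
Qed.

Lemma continuous_pot n : continuous (@pot R n).
Proof.
move=> x; apply/cvgrPdist_lt => e e0; near=> z.
apply: (le_lt_trans (pot_dist n x z)).
near: z; exact: cvgr_dist_lt.
Unshelve. all: by end_near. Qed.

Lemma continuous_tent_pot_level n y : continuous (tent_pot n y).
Proof.
move=> a; apply: cvgB; last exact: cvg_cst.
apply: cvgM; last exact: cvg_cst; apply: cvgD.
  apply: (continuous_comp (f := fun a => y - a)); last exact: continuous_pot.
  by apply: cvgB; [exact: cvg_cst|exact: cvg_id].
apply: (continuous_comp (f := fun a => y + a)); last exact: continuous_pot.
by apply: cvgD; [exact: cvg_cst|exact: cvg_id].
Qed.

Lemma continuous_tent_pot_center n a : continuous (fun y => tent_pot n y a).
Proof.
move=> y; apply: cvgB; last exact: continuous_pot.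
apply: cvgM; last exact: cvg_cst; apply: cvgD.
  apply: (continuous_comp (f := fun y => y - a)); last exact: continuous_pot.
  by apply: cvgB; [exact: cvg_id|exact: cvg_cst].
apply: (continuous_comp (f := fun y => y + a)); last exact: continuous_pot.
by apply: cvgD; [exact: cvg_id|exact: cvg_cst].
Qed.

Lemma tent_pot_diff n y a : `|tent_pot n.+1 y a - tent_pot n y a| <= 2 * 6^-1 ^+ n.
Proof.
have [_ b1] := pot_diff n (y - a); have [_ b2] := pot_diff n (y + a).
have [_ b3] := pot_diff n y.
rewrite /tent_pot; move: b1 b2 b3; rewrite !ler_norml; lra.
Qed.

Lemma tent_pot_cauchy n j y a :
  `|tent_pot (n + j) y a - tent_pot n y a| <= 3 * 6^-1 ^+ n - 3 * 6^-1 ^+ (n + j).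
Proof.
elim: j => [|j IH]; first by rewrite addn0 !subrr normr0.
rewrite addnS -(subrKA (tent_pot (n + j) y a)) (le_trans (ler_normD _ _))//.
have := tent_pot_diff (n + j) y a; rewrite exprS.
have : 0 <= 6^-1 ^+ (n + j) :> R by rewrite exprn_ge0.
by move: IH; lra.
Qed.

Variable mC : probability (measurableTypeR R) R.
Hypothesis mC_cantor : is_cantor_distribution mC.

Definition cantor_tent y a : R := fine (\int[mC]_t (tent y a t)%:E).

Lemma integral_tent_mC y a : 0 <= a ->
  (\int[mC]_t (tent y a t)%:E = (cantor_tent y a)%:E)%E.
Proof.
move=> a0; rewrite /cantor_tent fineK// ge0_fin_numE; last first.
  by apply: integral_ge0 => t _; rewrite lee_fin tent_ge0.
apply: (@le_lt_trans _ _ (\int[mC]_t (cst a%:E t))%E).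
  apply: ge0_le_integral => //.
  - by move=> t _; rewrite lee_fin tent_ge0.
  - exact: measurable_tent.
  by move=> t _; rewrite /= lee_fin /tent ge_max a0 gerBl normr_ge0.
by rewrite integral_cst//= probability_setT mule1 ltry.
Qed.

(** The increments of the integrals are geometric with ratio 1/6; sum up and let
    the index of the approximation tend to infinity. *)
Lemma cantor_tent_approx n y a : 0 <= a ->
  `|cantor_tent y a - tent_pot n y a| <= 3 * 6^-1 ^+ n.
Proof.
move=> a0; have bt : bounded_continuous (tent y a).
  split; first exact: continuous_tent.
  exists a => t; rewrite ger0_norm ?tent_ge0//.
  by rewrite /tent ge_max a0 gerBl normr_ge0.
have cvgT : tent_pot k y a @[k --> \oo] --> cantor_tent y a.
  have := mC_cantor bt; rewrite integral_tent_mC//.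
  under eq_fun do rewrite integral_tent_cantor//.
  by move=> /fine_cvg.
rewrite leNgt; apply/negP => H.
have e0 : 0 < `|cantor_tent y a - tent_pot n y a| - 3 * 6^-1 ^+ n by rewrite subr_gt0.
move/cvgrPdist_lt : cvgT => /(_ _ e0) [N _ /(_ (n + N)%N) /=].
rewrite leq_addl => /(_ isT).
have := tent_pot_cauchy n N y a.
have : 0 <= 6^-1 ^+ (n + N) :> R by rewrite exprn_ge0.
have := ler_distD (tent_pot (n + N) y a) (cantor_tent y a) (tent_pot n y a).
by lra.
Qed.

End tent.

Section scale_factor.
Context {R : realType}.
Implicit Types h y a : R.
Local Notation leb := (@lebesgue_measure R).

Definition scale_fun n y a : R := 2^-1 * tent_pot n y a + a ^+ 2.

Lemma scale_factor_eqE n h y a : 0 <= a ->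
  scale_factor_eq n h y a <-> scale_fun n y a = h.
Proof.
move=> a0; rewrite /scale_factor_eq /scale_fun.
have -> : 2^-1 * (3 / 2) ^+ n * (\int[leb]_(u in `[y - a, y + a])
    (\1_(cantor_approx n) u * (a - `|u - y|))) = 2^-1 * tent_pot n y a; last by [].
rewrite -mulrA; congr (_ * _).
have c0 : (0 : R) < (3 / 2) ^+ n by rewrite exprn_gt0// divr_gt0.
have mC : measurable (@cantor_approx R n) by exact: measurable_cantor_approx.
rewrite /Rintegral.
have -> : (\int[leb]_(u in `[(y - a)%R, (y + a)%R])
    (\1_(cantor_approx n) u * (a - `|u - y|))%:E =
    \int[leb]_(u in cantor_approx n) (tent y a u)%:E)%E.
  rewrite integral_mkcond [RHS]integral_mkcond; apply: eq_integral => u _.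
  rewrite /patch; case: ifPn => [|/negP uI].
    rewrite inE/= in_itv/= => ul; rewrite indicE; case: ifPn => uC.
      by rewrite mul1r tent_in.
    by rewrite mul0r.
  case: ifPn => // _; rewrite tent_out// => /andP[? ?]; apply: uI.
  by rewrite inE/= in_itv/= !ltW.
have := integral_tent_cantor n y a0.
rewrite ge0_integral_cantor_approx//; last 2 first.
- exact: measurable_tent.
- by move=> t; rewrite lee_fin tent_ge0.
move=> E; have -> : (\int[leb]_(u in cantor_approx n) (tent y a u)%:E =
    ((3 / 2) ^- n * tent_pot n y a)%:E)%E.
  by rewrite EFinM -E muleA -EFinM mulVf ?mul1e// gt_eqF.
by rewrite /= mulrA mulfV ?mul1r// gt_eqF.
Qed.

Lemma scale_fun_lt n y a a' : 0 <= a -> a < a' -> scale_fun n y a < scale_fun n y a'.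
Proof.
move=> a0 aa'; rewrite /scale_fun; have := tent_pot_le n y a0 (ltW aa').
have : a ^+ 2 < a' ^+ 2 by rewrite ltr_pXn2r// nnegrE// (le_trans a0)// ltW.
by lra.
Qed.

Lemma scale_fun_le n y a a' : 0 <= a -> 0 <= a' ->
  (a <= a') = (scale_fun n y a <= scale_fun n y a').
Proof.
move=> a0 a0'; have [aa'|aa'] := leP a a'.
  move: aa'; rewrite le_eqVlt => /predU1P[->|aa']; first by rewrite lexx.
  by rewrite ltW// scale_fun_lt.
by apply/esym/negbTE; rewrite -ltNge scale_fun_lt.
Qed.

(** The left-hand side of the equation is continuous and strictly increasing in
    the scale factor, vanishes at 0, and is at least [h] at the square root of
    [h] because of its quadratic part. *)
Lemma scale_factor_exists n h y : 0 < h ->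
  exists! a, 0 < a <= Num.sqrt h /\ scale_factor_eq n h y a.
Proof.
move=> h0; have s0 : 0 < Num.sqrt h by rewrite sqrtr_gt0.
have cG : {within `[0, Num.sqrt h], continuous (scale_fun n y)}.
  apply: continuous_subspaceT => a; apply: cvgD; last first.
    by apply: cvgM; exact: cvg_id.
  by apply: cvgM; [exact: cvg_cst|exact: continuous_tent_pot_level].
have G0 : scale_fun n y 0 = 0.
  by rewrite /scale_fun tent_pot0 mulr0 expr0n addr0.
have Gs : h <= scale_fun n y (Num.sqrt h).
  rewrite /scale_fun sqr_sqrtr ?(ltW h0)// lerDr mulr_ge0//.
  by apply: tent_pot_ge0; exact: ltW.
have [|a] := @IVT _ _ _ _ h (ltW s0) cG.
  by rewrite ge_min le_max G0 (ltW h0) Gs orbT.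
rewrite in_itv/= => /andP[a0 as_] Ga.
have {}a0 : 0 < a.
  by rewrite lt_neqAle a0 andbT; apply/eqP => a0'; move: Ga h0; rewrite -a0' G0 => ->; rewrite ltxx.
exists a; split.
  by split; [rewrite a0|apply/scale_factor_eqE => //; exact: ltW].
move=> a' [/andP[a'0 _] /scale_factor_eqE -/(_ (ltW a'0)) Ga'].
apply/eqP; rewrite eq_le (scale_fun_le n y (ltW a0) (ltW a'0)).
by rewrite (scale_fun_le n y (ltW a'0) (ltW a0)) Ga Ga' lexx.
Qed.

(** By monotonicity a bound on the scale factor is a condition on the value of
    a continuous function of the center. *)
Lemma measurable_scale_factor n h (a : R -> R) : 0 < h ->
  (forall y, 0 < a y /\ scale_factor_eq n h y (a y)) -> measurable_fun setT a.
Proof.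
move=> h0 ah; apply: (measurability (@RGenOInfty.G R)).
  exact: RGenOInfty.measurableE.
move=> _ [_ [c ->] <-]; rewrite setTI.
have [c0|c0] := ltP c 0.
  rewrite (_ : _ @^-1` _ = setT)//; apply/seteqP; split => // y _ /=.
  by rewrite in_itv/= andbT (lt_trans c0)//; have [] := ah y.
rewrite (_ : _ @^-1` _ = [set y | scale_fun n y c < h]).
  apply: measurable_lt_set => //; apply: continuous_measurable_fun => y.
  apply: cvgD; last exact: cvg_cst.
  by apply: cvgM; [exact: cvg_cst|exact: continuous_tent_pot_center].
apply/seteqP; split => y /=; rewrite in_itv/= andbT.
  have [a0 /scale_factor_eqE -/(_ (ltW a0)) <-] := ah y.
  by rewrite !ltNge (scale_fun_le n y (ltW a0) c0).
have [a0 /scale_factor_eqE -/(_ (ltW a0)) <-] := ah y.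
by rewrite !ltNge (scale_fun_le n y (ltW a0) c0).
Qed.

End scale_factor.

(** * Exit times for the Cantor speed measure *)
Section cantor_diffusion.
Context {R : realType} (mC : probability (measurableTypeR R) R).
Hypothesis mC_cantor : is_cantor_distribution mC.
Context d (Omega : measurableType d).
Variables (P : R -> probability Omega R) (Y : Omega -> cpath R).
Hypothesis Y_speed : has_speed_measure P Y (cantor_speed mC).
Implicit Types y z a t : R.
Local Notation leb := (@lebesgue_measure R).

Lemma integral_tent_speed y a : 0 < a ->
  (\int[cantor_speed mC]_(t in `](y - a)%R, (y + a)%R[) (tent y a t)%:E =
   (cantor_tent mC y a + 2 * a ^+ 2)%:E)%E.
Proof.
move=> a0; have mt := measurable_tent y a.
rewrite integral_tent_support; last by move=> t; rewrite /= in_itv.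
rewrite ge0_integral_measure_add//; last by move=> t _; rewrite lee_fin tent_ge0.
rewrite ge0_integral_mscale//; last by move=> t _; rewrite lee_fin tent_ge0.
by rewrite (integral_tent_mC mC y (ltW a0)) integral_tent_lebesgue// EFinD EFinM.
Qed.

(** The Green function of an interval with pole at its center is half a tent. *)
Lemma exit_mean y a : 0 < a ->
  (\int[P y]_x exit_time (y - a) (y + a) (Y x) =
   (2^-1 * cantor_tent mC y a + a ^+ 2)%:E)%E.
Proof.
move=> a0; rewrite Y_speed; [|lra|by apply/andP; split; lra].
transitivity (\int[cantor_speed mC]_(t in `](y - a)%R, (y + a)%R[)
    (2^-1%:E * (tent y a t)%:E))%E.
  apply: eq_integral => t; rewrite inE/= in_itv/= => /andP[t1 t2].
  rewrite -EFinM tent_in ?ltW//; congr (_%:E).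
  have [ty|ty] := leP y t.
    by rewrite ger0_norm ?subr_ge0//; field; rewrite gt_eqF//; lra.
  by rewrite ltr0_norm ?subr_lt0//; field; rewrite gt_eqF//; lra.
rewrite ge0_integralZl//; last 2 first.
- by apply: measurable_funTS; exact: measurable_tent.
- by move=> t _; rewrite lee_fin tent_ge0.
by rewrite integral_tent_speed// -EFinM; congr (_%:E); field.
Qed.

(** With any pole, the Green function is at most its value on the diagonal,
    which is at most the tent. *)
Lemma exit_mean_inside y z a : 0 < a -> y - a <= z <= y + a ->
  (\int[P z]_x exit_time (y - a) (y + a) (Y x) <=
   (2 * (2^-1 * cantor_tent mC y a + a ^+ 2))%:E)%E.
Proof.
move=> a0 zya; rewrite Y_speed//; last by lra.
have -> : 2 * (2^-1 * cantor_tent mC y a + a ^+ 2) = cantor_tent mC y a + 2 * a ^+ 2.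
  by field.
rewrite -integral_tent_speed//; case/andP: zya => z1 z2.
have ba : y + a - (y - a) = 2 * a by ring.
have ba0 : 0 <= (2 * a)^-1 by rewrite invr_ge0 mulr_ge0// ltW.
apply: ge0_le_integral => //.
- move=> t /=; rewrite in_itv/= => /andP[t1 t2]; rewrite lee_fin ba mulr_ge0//.
  by rewrite mulr_ge0// subr_ge0 ?ge_max ?le_min ?z1 ?z2 ?ltW.
- apply: measurable_funTS; apply/measurable_EFinP; apply: measurable_funM => //.
  apply: measurable_funM; apply: measurable_funB => //.
    exact: measurable_maxr.
  exact: measurable_minr.
- by apply: measurable_funTS; exact: measurable_tent.
move=> t /=; rewrite in_itv/= => /andP[t1 t2]; rewrite lee_fin ba.
have tin : y - a <= t <= y + a by rewrite !ltW.
rewrite (tent_in tin) ler_pdivrMr ?mulr_gt0//.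
apply: (@le_trans _ _ ((y + a - t) * (t - (y - a)))).
  apply: ler_pM.
  - by rewrite subr_ge0 ge_max z2 ltW.
  - by rewrite subr_ge0 le_min z1 ltW.
  - by rewrite lerB// le_max lexx orbT.
  - by rewrite lerB// ge_min lexx orbT.
have [ty|ty] := leP y t.
  by rewrite ger0_norm ?subr_ge0//; nra.
by rewrite ltr0_norm ?subr_lt0//; nra.
Qed.

(** The mean duration of a step and the equation for the scale factor only
    differ in the measure against which the tent is integrated. *)
Lemma approx_scale_cantor (k : nat) (h e : R) (a : R -> R) : 0 < h -> e <= 1 ->
  3 * 6^-1 ^+ k <= e * h ->
  (forall y, 0 < a y /\ scale_factor_eq k h y (a y)) -> approx_scale P Y a h e.
Proof.
move=> h0 e1 ke ah.
have near_h y : `|2^-1 * cantor_tent mC y (a y) + a y ^+ 2 - h| <= e * h.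
  have [a0 /(scale_factor_eqE _ _ _ (ltW a0))] := ah y; rewrite /scale_fun => hE.
  have := cantor_tent_approx mC_cantor k y (ltW a0).
  have : 0 <= 3 * 6^-1 ^+ k :> R by rewrite mulr_ge0// exprn_ge0.
  by rewrite !ler_norml; move=> ? /andP[? ?]; apply/andP; split; lra.
split.
- exact: measurable_scale_factor h0 ah.
- by move=> y; have [] := ah y.
- move=> y; have [a0 _] := ah y; rewrite exit_mean// lee_fin.
  by have := near_h y; rewrite ler_norml => /andP[? ?]; lra.
- move=> y; have [a0 _] := ah y; rewrite exit_mean// lee_fin.
  by have := near_h y; rewrite ler_norml => /andP[? ?]; lra.
move=> y z zy; have [a0 _] := ah y.
apply: (le_trans (exit_mean_inside a0 zy)); rewrite lee_fin.
have eh : e * h <= h by rewrite -[leRHS]mul1r ler_pM2r.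
by have := near_h y; rewrite ler_norml => /andP[? ?]; lra.
Qed.

End cantor_diffusion.

(** * Convergence of the embedded paths *)
Section embedded_path_convergence.
Context {R : realType}.

Definition embedded_path (a : R -> R) (h : R) (w : cpath R) : cpath R :=
  interp h (fun k => ev (iter k (next a) w) 0).

(** At time t the interpolation is a convex combination of the values of the
    path at two exit times that are close to t. *)
Lemma embedded_path_cvg (w : cpath R) (a : nat -> R -> R) (h : nat -> R)
    (f : cpath R -> R) :
  (forall j, 0 < h j) -> h j @[j --> \oo] --> 0 ->
  (forall (T del : R), 0 < T -> 0 < del -> \forall j \near \oo,
     forall k, k%:R * h j <= T -> `|embed_time (a j) k w - k%:R * h j| <= del) ->
  continuous f -> f (embedded_path (a j) (h j) w) @[j --> \oo] --> f w.
Proof.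
move=> h0 hcvg tcvg cf A /cf /nbhs_tube [m mA].
change (\forall j \near \oo, A (f (embedded_path (a j) (h j) w))).
pose e : R := m.+1%:R^-1; have e20 : 0 < e / 2 by rewrite divr_gt0// invr_gt0.
have [del del0 ucont] := @uniformly_continuous_segment _ (ev w) m%:R (e / 2)
  (@continuous_ev _ w) e20.
have del20 : 0 < del / 2 by rewrite divr_gt0.
have := tcvg m.+1%:R (del / 2) (ltr0Sn _ _) del20.
move/cvgrPdist_lt : hcvg => hcvg.
have {}hcvg2 := hcvg _ del20; have {}hcvg1 := hcvg _ ltr01.
move: hcvg1 hcvg2; apply: filterS3 => j.
rewrite !sub0r !normrN !gtr0_norm// => h1 hdel tau; apply: mA => t /andP[t0 tm].
have th0 : 0 <= t / h j by rewrite divr_ge0// ltW.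
rewrite ev_interp//; apply: (@le_lt_trans _ _ (e / 2)); last first.
  by rewrite -/e; move: e20; lra.
have jt : (Num.truncn (t / h j))%:R * h j <= t by rewrite -ler_pdivlMr// truncn_le.
have tj : t < (Num.truncn (t / h j)).+1%:R * h j by rewrite -ltr_pdivrMr// truncnS_gt.
have mE : m.+1%:R = m%:R + 1 :> R by rewrite -natr1.
have close k : k%:R * h j <= m.+1%:R -> `|k%:R * h j - t| <= h j ->
    `|ev (iter k (next (a j)) w) 0 - ev w t| <= e / 2.
  move=> km kt; rewrite ev_iter_next// addr0 distrC ltW// ucont ?t0//.
  have := tau _ km; move: kt; rewrite !ler_norml => /andP[? ?] /andP[? ?].
  by apply/andP; split; lra.
move: jt tj; rewrite -natr1 mulrDl mul1r => jt tj.
apply: linear_interp_dist => //; apply: close.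
- by rewrite mE; lra.
- by rewrite ler_norml; apply/andP; split; lra.
- by rewrite -natr1 mulrDl mul1r mE; lra.
- by rewrite -natr1 mulrDl mul1r ler_norml; apply/andP; split; lra.
Qed.

End embedded_path_convergence.

Section uniform_tail.
Context {R : realType} d (Omega : measurableType d).
Variables (F : time R -> set (set Omega)) (P : R -> probability Omega R)
  (Y : Omega -> cpath R).
Hypothesis Y_diffusion : regular_diffusion F P Y.
Hypothesis Y_natural_scale : natural_scale P Y.

Definition late_event (a : R -> R) (h T del : R) : set Omega :=
  [set x | exists k, k%:R * h <= T /\ del < `|embed_time a k (Y x) - k%:R * h|].

Let mdist a k h : measurable_fun setT a ->
  measurable_fun setT (fun x => `|embed_time a k (Y x) - k%:R * h|).
Proof.
move=> ma; apply: measurableT_comp => //; apply: measurable_funB => //.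
exact: (measurableT_comp (measurable_embed_time ma k) (measurable_diffusion Y_diffusion)).
Qed.

Lemma measurable_late_event a h T del : measurable_fun setT a ->
  measurable (late_event a h T del).
Proof.
move=> ma; rewrite (_ : late_event a h T del = \bigcup_(k in [set k | k%:R * h <= T])
    [set x | del < `|embed_time a k (Y x) - k%:R * h|]); last first.
  by apply/seteqP; split => x /=; [move=> [k [kT H]]|move=> [k kT H]]; exists k.
apply: bigcup_measurable => k _; apply: measurable_lt_set => //.
exact: mdist.
Qed.

(** Both k h and the k-th exit time increase with k, so it suffices to compare
    them for the last k before each point of a finite grid of times. *)
Lemma late_event_small (T del eta : R) : 0 < T -> 0 < del -> 0 < eta ->
  exists2 e1, 0 < e1 & exists2 h1, 0 < h1 & forall a h e,
    0 < h <= h1 -> 0 <= e <= e1 -> approx_scale P Y a h e ->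
    forall y, (P y (late_event a h T del) <= eta%:E)%E.
Proof.
move=> T0 del0 eta0.
have [c c0 cE] : exists2 c, 0 < c & del = 4 * c.
  by exists (del / 4); [rewrite divr_gt0|field].
(* enough points of mesh [c] to have one beyond each time up to [T] *)
pose N := (Num.truncn (T / c)).+3.
have N0 : (0 : R) < N%:R by rewrite ltr0n.
have etaN : 0 < eta / N%:R by rewrite divr_gt0.
have Nc : 0 < N%:R * c by rewrite mulr_gt0.
have [e1 e10 [h1 h10 tail]] :=
  embed_time_tail Y_diffusion Y_natural_scale Nc c0 etaN.
exists e1 => //; exists (Num.min h1 c); first by rewrite lt_min h10.
move=> a h e /andP[h0]; rewrite le_min => /andP[hh1 hc] e01 ah y.
have ma := approx_scale_measurable ah.
pose g (i : nat) := Num.truncn (i%:R * c / h).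
have gc0 i : 0 <= i%:R * c / h by rewrite divr_ge0 ?mulr_ge0// ltW.
have gle i : (g i)%:R * h <= i%:R * c by rewrite -ler_pdivlMr// truncn_le.
have ggt i : i%:R * c < (g i)%:R * h + h.
  by rewrite -[X in _ + X]mul1r -mulrDl natr1 -ltr_pdivrMr// truncnS_gt.
pose A i := [set x | c < `|embed_time a (g i) (Y x) - (g i)%:R * h|].
have mA i : measurable (A i) by apply: measurable_lt_set => //; exact: mdist.
have PA (i : nat) : (i < N)%N -> (P y (A i) <= (eta / N%:R)%:E)%E.
  move=> iN; apply: (tail a h e) => //; first by rewrite h0.
  by rewrite (le_trans (gle i))// ler_pM2r// ler_nat ltnW.
have sub : late_event a h T del `<=` \big[setU/set0]_(i < N) A i.
  move=> x [k [kT kdel]]; apply: contrapT => notA.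
  have nA i : (i < N)%N -> `|embed_time a (g i) (Y x) - (g i)%:R * h| <= c.
    move=> iN; rewrite leNgt; apply/negP => H; apply: notA.
    by rewrite -bigcup_mkord; exists i.
  pose i := Num.truncn (k%:R * h / c).
  have kc0 : 0 <= k%:R * h / c by rewrite divr_ge0 ?mulr_ge0// ltW.
  have ik : i%:R * c <= k%:R * h by rewrite -ler_pdivlMr// truncn_le.
  have ki : k%:R * h < i%:R * c + c.
    by rewrite -[X in _ + X]mul1r -mulrDl natr1 -ltr_pdivrMr// truncnS_gt.
  have iN : (i.+1 < N)%N.
    have iT : (i <= Num.truncn (T / c))%N by rewrite le_truncn// ler_pM2r// invr_gt0.
    by rewrite /N !ltnS; exact: leqW.
  have gik : (g i <= k)%N.
    rewrite -(@ler_nat R) -(ler_pM2r h0); exact: le_trans (gle i) ik.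
  have kgi : (k <= g i.+1)%N.
    rewrite -ltnS -(@ltr_nat R) -(ltr_pM2r h0) -natr1 mulrDl mul1r.
    by apply: lt_trans (ggt i.+1); rewrite -natr1 mulrDl mul1r.
  have t1 := embed_time_le a (Y x) gik; have t2 := embed_time_le a (Y x) kgi.
  have := nA i (ltnW iN); have := nA i.+1 iN.
  have := gle i.+1; have := ggt i; rewrite -natr1 mulrDl mul1r.
  rewrite !ler_norml => ? ? /andP[? ?] /andP[? ?].
  suff : `|embed_time a k (Y x) - k%:R * h| <= del by rewrite leNgt kdel.
  by rewrite ler_norml; apply/andP; split; lra.
apply: (@le_trans _ _ (P y (\big[setU/set0]_(i < N) A i))).
  apply: le_measure; rewrite ?inE//; first exact: measurable_late_event.
  exact: bigsetU_measurable.
apply: (@le_trans _ _ (\sum_(i < N) (eta / N%:R)%:E)%E); last first.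
  by rewrite sumEFin sumr_const card_ord lee_fin -[leLHS]mulr_natr divfK// gt_eqF.
apply: le_trans (Boole_inequality _ _) _ => //.
by apply: lee_sum => i _; exact: PA.
Qed.

End uniform_tail.

(** * The functional limit theorem *)
Section functional_limit.
Context {R : realType} d (Omega : measurableType d).
Variables (F : time R -> set (set Omega)) (P : R -> probability Omega R)
  (Y : Omega -> cpath R).
Hypothesis Y_diffusion : regular_diffusion F P Y.
Hypothesis Y_natural_scale : natural_scale P Y.

Section bounded_functional.
Variables (f : cpath R -> R) (M : R).
Hypotheses (cf : continuous f) (fM : forall w, `|f w| <= M).

Lemma measurable_functional d' (T : measurableType d') (W : T -> cpath R) :
  measurable_fun setT (W : T -> borel_cpath R) ->
  measurable_fun setT (fun x => (f (W x))%:E).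
Proof.
move=> mW; apply/measurable_EFinP.
exact: (measurableT_comp (measurable_continuous_path cf) mW).
Qed.

Lemma integrable_functional d' (T : measurableType d') (Q : probability T R)
    (W : T -> cpath R) : measurable_fun setT (W : T -> borel_cpath R) ->
  Q.-integrable setT (fun x => (f (W x))%:E).
Proof.
move=> mW; apply: (@measurable_bounded_integrable _ _ _ Q (fun x => f (W x))) => //.
- by apply: le_lt_trans (ltry 1); exact: probability_le1.
- exact: (measurableT_comp (measurable_continuous_path cf) mW).
- exists M; split; first exact: num_real.
  by move=> r Mr w _; apply: le_trans (fM _) (ltW Mr).
Qed.

Lemma integral_law d' (T : measurableType d') (Q : probability T R)
    (W : T -> cpath R) : measurable_fun setT (W : T -> borel_cpath R) ->
  (\int[law Q W]_w (f w)%:E = (fine (\int[Q]_x (f (W x))%:E))%:E)%E.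
Proof.
move=> mW; rewrite fineK; last first.
  by apply: integrable_fin_num => //; exact: integrable_functional.
rewrite /law (@integral_pushforward _ _ _ _ _ _ mW Q setT (fun w => (f w)%:E)) //.
- by apply/measurable_EFinP; exact: measurable_continuous_path.
- exact: integrable_functional.
Qed.

Lemma measurable_embedded_path a h : measurable_fun setT a ->
  measurable_fun setT (fun x => embedded_path a h (Y x) : borel_cpath R).
Proof.
move=> ma; exact: (measurable_interp_process
  (X := fun k x => ev (iter k (next a) (Y x)) 0) h
  (measurable_embedded Y_diffusion ma) id).
Qed.

(** By the Borel-Cantelli lemma the embedded paths converge almost surely, and
    dominated convergence applies. *)
Lemma embedded_expectation_cvg (a : nat -> R -> R) (h : nat -> R) (y : R) :
  (forall j, 0 < h j) -> h j @[j --> \oo] --> 0 ->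
  (forall j, measurable_fun setT (a j)) ->
  (forall j, (P y (late_event Y (a j) (h j) j.+1%:R j.+1%:R^-1) <= (2^-1 ^+ j)%:E)%E) ->
  (\int[P y]_x (f (embedded_path (a j) (h j) (Y x)))%:E)%E @[j --> \oo] -->
  (\int[P y]_x (f (Y x))%:E)%E.
Proof.
move=> h0 hcvg ma Pbad.
pose bad j := late_event Y (a j) (h j) j.+1%:R j.+1%:R^-1.
have mbad j : measurable (bad j) by exact: (measurable_late_event Y_diffusion).
have summable : (\sum_(j <oo) P y (bad j) < +oo)%E.
  apply: (@le_lt_trans _ _ 2%:E); last exact: ltry.
  apply: lime_le; first by apply: is_cvg_nneseries => *; exact: measure_ge0.
  apply: nearW => N.
  apply: (@le_trans _ _ (\sum_(0 <= j < N) (2^-1 ^+ j)%:E)%E).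
    by apply: lee_sum => j _; exact: Pbad.
  have -> : (\sum_(0 <= j < N) (2^-1 ^+ j)%:E = (2 - 2 * 2^-1 ^+ N)%:E :> \bar R)%E.
    elim: N => [|N IH]; first by rewrite big_geq// expr0 mulr1 subrr.
    rewrite big_nat_recr//= IH -EFinD; congr (_%:E).
    by rewrite exprS; lra.
  by rewrite lee_fin gerBl mulr_ge0// exprn_ge0.
have bad0 := lim_sup_set_cvg0 mbad summable.
have mlim : measurable (lim_sup_set bad).
  apply: bigcap_measurable; first by exists 0%N.
  by move=> n _; apply: bigcup_measurable => j _.
have [| | | | |_ _ H] := @dominated_convergence _ _ _ (P y) setT measurableT
  (fun j x => (f (embedded_path (a j) (h j) (Y x)))%:E)
  (fun x => (f (Y x))%:E) (cst M%:E).
- by move=> j; apply: measurable_functional; exact: measurable_embedded_path.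
- by apply: measurable_functional; exact: (measurable_diffusion Y_diffusion).
- exists (lim_sup_set bad); split => // x; apply: contra_notP => notbad _.
  apply/cvg_EFin; first exact: nearW.
  apply: embedded_path_cvg => // T del T0 del0.
  have [J badJ] : exists J, forall j, (J <= j)%N -> ~ bad j x.
    apply: contrapT => H; apply: notbad => J _; apply: contrapT => H'.
    by apply: H; exists J => j Jj badj; apply: H'; exists j.
  exists (maxn J (maxn (Num.truncn T) (Num.truncn del^-1))) => // j /=.
  rewrite !geq_max => /and3P[Jj Tj dj] k kT; rewrite leNgt; apply/negP => H.
  apply: (badJ j Jj); exists k; split.
    by rewrite (le_trans kT)// (le_trans (ltW (truncnS_gt _)))// ler_nat ltnS.
  apply: le_lt_trans H; rewrite invf_ple ?posrE//.
  by rewrite (le_trans (ltW (truncnS_gt _)))// ler_nat ltnS.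
- apply/integrableP; split => //; rewrite integral_cst//= probability_setT mule1.
  by rewrite ltry.
- by apply: aeW => x j _; rewrite /= lee_fin.
exact: H.
Qed.

(** If convergence failed, it would fail along a sequence of time steps that may
    be chosen to decrease so fast that the late events are summable. *)
Lemma embedded_expectation_cvg0 (a : R -> R -> R) (y : R) :
  (forall e, 0 < e -> \forall h \near 0^'+, approx_scale P Y (a h) h e) ->
  fine (\int[P y]_x (f (embedded_path (a h) h (Y x)))%:E)%E @[h --> 0^'+] -->
  fine (\int[P y]_x (f (Y x))%:E)%E.
Proof.
move=> approx; apply/cvgrPdist_lt => e e0; apply: contrapT => notcvg.
set l := fine _ in notcvg.
pose phi h := fine (\int[P y]_x (f (embedded_path (a h) h (Y x)))%:E)%E.
have pick (j : nat) : exists h, [/\ 0 < h < j.+1%:R^-1, measurable_fun setT (a h),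
    (P y (late_event Y (a h) h j.+1%:R j.+1%:R^-1) <= (2^-1 ^+ j)%:E)%E &
    e <= `|l - phi h|].
  have j0 : 0 < j.+1%:R^-1 :> R by rewrite invr_gt0.
  have p0 : 0 < 2^-1 ^+ j :> R by rewrite exprn_gt0.
  have [e1 e10 [h1 h10 small]] :=
    late_event_small Y_diffusion Y_natural_scale (ltr0Sn R j) j0 p0.
  apply: contrapT => nopick; apply: notcvg; near=> h; rewrite ltNge; apply/negP => far.
  have h0 : 0 < h by near: h; exact: nbhs_right_gt.
  have ah : approx_scale P Y (a h) h e1 by near: h; exact: approx.
  apply: nopick; exists h; split => //.
  - by rewrite h0/=; near: h; exact: nbhs_right_lt.
  - exact: approx_scale_measurable ah.
  - apply: (small _ _ e1) => //; last by rewrite ltW//=.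
    by rewrite h0/=; near: h; exact: nbhs_right_le.
have [h_ hP] := choice pick.
have h0 j : 0 < h_ j by have [/andP[]] := hP j.
have hcvg : h_ j @[j --> \oo] --> 0.
  apply/cvgrPdist_lt => r r0; near=> j; rewrite sub0r normrN gtr0_norm//.
  have [/andP[_ hj] _ _ _] := hP j; apply: (lt_trans hj).
  near: j; exact: near_infty_natSinv_lt (PosNum r0).
have ma j : measurable_fun setT (a (h_ j)) by have [] := hP j.
have Pbad j : (P y (late_event Y (a (h_ j)) (h_ j) j.+1%:R j.+1%:R^-1) <= (2^-1 ^+ j)%:E)%E.
  by have [] := hP j.
have := embedded_expectation_cvg h0 hcvg ma Pbad.
have lE : (\int[P y]_x (f (Y x))%:E = l%:E)%E.
  rewrite fineK//; apply: integrable_fin_num => //.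
  by apply: integrable_functional; exact: (measurable_diffusion Y_diffusion).
rewrite lE => /fine_cvg /cvgrPdist_lt /(_ _ e0) [N _ /(_ N (leqnn N))].
by have [_ _ _] := hP N; rewrite leNgt => /negP.
Unshelve. all: by end_near. Qed.

End bounded_functional.

(** A functional limit theorem for any diffusion on the line in natural scale.
    The speed measure only enters through the mean durations of the steps. *)
Theorem coin_tossing_cvg_weakly d' (Omega' : measurableType d')
    (P' : probability Omega' R) (xi : nat -> Omega' -> R) (a : R -> R -> R) (y : R) :
  iid_coin_tosses P' xi ->
  (forall e, 0 < e -> \forall h \near 0^'+, approx_scale P Y (a h) h e) ->
  cvg_weakly (fun h => law P' (chain_path (a h) xi h y)) (law (P y) Y).
Proof.
move=> xi_iid approx f bf; have [cf [M fM]] := bf.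
rewrite (integral_law cf fM _ (measurable_diffusion Y_diffusion)).
have L := embedded_expectation_cvg0 cf fM (y := y) approx.
have phiE : \forall h \near 0^'+,
    (fine (\int[P y]_x (f (embedded_path (a h) h (Y x)))%:E))%:E =
    (\int[law P' (chain_path (a h) xi h y)]_w (f w)%:E)%E.
  near=> h.
  have h0 : 0 < h by near: h; exact: nbhs_right_gt.
  have ah : approx_scale P Y (a h) h 1 by near: h; exact: approx.
  have ma := approx_scale_measurable ah; have a0 := approx_scale_gt0 ah.
  have mX k : measurable_fun setT (fun w => chain (a h) xi y w k).
    by apply: measurable_chain; [exact: xi_iid|exact: ma].
  rewrite (integral_law cf fM P'); last exact: (measurable_interp_process h mX id).
  congr (fine _)%:E.
  apply: (eq_walk_expectation (X := fun k x => ev (iter k (next (a h)) (Y x)) 0)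
    (X' := fun k w => chain (a h) xi y w k) (y := y) a0 h0) => //.
  - exact: (measurable_embedded Y_diffusion ma).
  - move=> n s; apply: (embedded_follows Y_diffusion Y_natural_scale ma a0) => z.
    exact: (approx_scale_exit_lty Y_diffusion ah).
  - by move=> n s; exact: (chain_follows xi_iid y a0).
apply: cvg_trans (near_eq_cvg phiE) _.
by apply/cvg_EFin; [exact: nearW|exact: L].
Unshelve. all: by end_near. Qed.

End functional_limit.

(** Because 6 ^ n(h) is at least 4 ^ n(h), and 4 ^ n(h) h tends to infinity. *)
Lemma cantor_error_small {R : realType} (n : R -> nat) (e : R) :
  2 ^+ n h * Num.sqrt h @[h --> 0^'+] --> +oo -> 0 < e ->
  \forall h \near 0^'+, 3 * 6^-1 ^+ n h <= e * h.
Proof.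
move=> n_lim e0.
have /cvgryPge /(_ (1 + 3 / e)) := n_lim.
move=> big; near=> h.
have h0 : 0 < h by near: h; exact: nbhs_right_gt.
have : 1 + 3 / e <= 2 ^+ n h * Num.sqrt h by near: h.
set q : R := 2 ^+ n h; set s := Num.sqrt h => qs.
have q0 : 0 < q by rewrite exprn_gt0.
have ssE : s ^+ 2 = h by rewrite sqr_sqrtr// ltW.
have e30 : 0 < 3 / e by rewrite divr_gt0.
have : 3 / e <= (q * s) ^+ 2.
  rewrite expr2; apply: (@le_trans _ _ ((1 + 3 / e) * (1 + 3 / e))); first by nra.
  by apply: ler_pM => //; rewrite addr_ge0// ltW.
rewrite exprMn ssE ler_pdivrMr// => main.
have six : 6^-1 ^+ n h <= (q ^+ 2)^-1.
  rewrite exprVn lef_pV2 ?posrE ?exprn_gt0// /q -exprM mulnC exprM.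
  by apply: lerXn2r; rewrite ?nnegrE//; lra.
apply: (@le_trans _ _ (3 * (q ^+ 2)^-1)); first by rewrite ler_pM2l.
rewrite ler_pdivrMr ?exprn_gt0//; lra.
Unshelve. all: by end_near. Qed.

Theorem proposition8p1 (R : realType)
  (mC : probability (measurableTypeR R) R)
  (mC_cantor : is_cantor_distribution mC)
  (d : measure_display) (Omega : measurableType d)
  (F : time R -> set (set Omega)) (P : R -> probability Omega R)
  (Y : Omega -> cpath R)
  (Y_diffusion : regular_diffusion F P Y)
  (Y_natural_scale : natural_scale P Y)
  (Y_speed : has_speed_measure P Y (cantor_speed mC))
  (n : R -> nat)
  (n_gt0 : forall h, 0 < h < 1 -> (0 < n h)%N)
  (n_lim : 2 ^+ n h * Num.sqrt h @[h --> 0^'+] --> +oo)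
  (d' : measure_display) (Omega' : measurableType d')
  (P' : probability Omega' R) (xi : nat -> Omega' -> R)
  (xi_iid : iid_coin_tosses P' xi) :
  (forall h y : R, 0 < h < 1 ->
     exists! a : R, 0 < a <= Num.sqrt h /\ scale_factor_eq (n h) h y a) /\
  (forall a : R -> R -> R,
     (forall h y : R, 0 < h < 1 ->
        0 < a h y <= Num.sqrt h /\ scale_factor_eq (n h) h y (a h y)) ->
     forall y : R,
       cvg_weakly (fun h => law P' (chain_path (a h) xi h y)) (law (P y) Y)).
Proof.
split=> [h y /andP[h0 _]|a aP y]; first exact: scale_factor_exists.
apply: (coin_tossing_cvg_weakly Y_diffusion Y_natural_scale xi_iid) => e e0.
pose e' := Num.min e 1.
have e'0 : 0 < e' by rewrite lt_min e0 ltr01.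
have small := cantor_error_small n_lim e'0.
near=> h.
have h01 : 0 < h < 1.
  by apply/andP; split; near: h; [exact: nbhs_right_gt|exact: nbhs_right_lt].
case/andP: (h01) => h0 h1.
have e'1 : e' <= 1 by rewrite ge_min lexx orbT.
have ke : 3 * 6^-1 ^+ n h <= e' * h by near: h.
have ah z : 0 < a h z /\ scale_factor_eq (n h) h z (a h z).
  by have [/andP[? _] ?] := aP h z h01.
have [m p ge le inside] := approx_scale_cantor mC_cantor Y_speed h0 e'1 ke ah.
have ee' : e' * h <= e * h by rewrite ler_pM2r// ge_min lexx.
split => // z.
  by apply: le_trans (ge z); rewrite lee_fin; lra.
by apply: le_trans (le z) _; rewrite lee_fin; lra.
Unshelve. all: by end_near. Qed.
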